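(* Let $\mathfrak{U}$ be the affine polar space obtained from a polar space $\mathfrak{Q}$ of index $m$ by deleting a hyperplane $\mathcal{H}$. (i) If $0<k\le m$, then $\mathfrak{U}$ can be recovered from the structure $\langle \mathrm{Sub}_k(\mathfrak{U}),\sim_{-}\rangle$. (ii) If $0\le k\le m-1$, then $\mathfrak{U}$ can be recovered from the structure $\langle \mathrm{Sub}_k(\mathfrak{U}),\sim^{+}\rangle$, and also from the structure $\langle \mathrm{Sub}_k(\mathfrak{U}),\sim_{-}^{+}\rangle$.
   Context: $\mathfrak{Q}=\langle Q,\mathcal{L}\rangle$ is a polar space (in the standard Buekenhout–Shult sense, a point-line structure) of index $m$. Points $a,b$ are written $a\perp b$ if they are collinear; a subspace $X$ is strong if all its points are pairwise collinear. $\mathrm{Sub}_k(\mathfrak{Q})$ is the family of $k$-dimensional strong subspaces (each carries the geometry of a $k$-dimensional projective space); $m$ is the maximal dimension of a strong subspace. $\mathcal{H}$ is a hyperplane of $\mathfrak{Q}$: a proper subspace that meets every line. The affine polar space $\mathfrak{U}$ has point set $Q\setminus\mathcal{H}$ and lines $L\setminus\mathcal{H}$ for $L\in\mathcal{L}$, $L\not\subset\mathcal{H}$. Strong subspaces of $\mathfrak{U}$ are defined in the same way as for $\mathfrak{Q}$, and $\mathrm{Sub}_k(\mathfrak{U})=\{X\setminus\mathcal{H}: X\in\mathrm{Sub}_k(\mathfrak{Q}),\ X\not\subset\mathcal{H}\}$ is the family of $k$-dimensional strong subspaces of $\mathfrak{U}$ (the dimension of $X\setminus\mathcal H$ equals that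 of $X$); the empty set is the only subspace of dimension $-1$. $A_1\sqcup A_2$ denotes the least subspace of $\mathfrak{U}$ containing $A_1\cup A_2$. Adjacencies on $\mathrm{Sub}_k(\mathfrak{U})$: $A_1\sim_{-}A_2$ iff $A_1\cap A_2\in\mathrm{Sub}_{k-1}(\mathfrak{U})$; $A_1\sim^{+}A_2$ iff $A_1\sqcup A_2\in\mathrm{Sub}_{k+1}(\mathfrak{U})$; $A_1\sim_{-}^{+}A_2$ iff both hold. ''Recovered from / definable in'': a structure $N$ is definable in (recoverable from) a structure $M$ if the elements of $N$ can be identified with suitable configurations (tuples, sets, families of sets) of elements of $M$ and, under this identification, the underlying domain and the relations of $N$ (here: points and lines of $\mathfrak{U}$) are characterized, without parameters, solely in terms of the primitive notions of $M$; quantification over sets such as cliques and over families of sets is permitted. *)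

(* Defs.v *)
From mathcomp Require Import all_boot all_order all_algebra.
From mathcomp Require Import classical_sets.

Set Implicit Arguments.
Unset Strict Implicit.
Unset Printing Implicit Defensive.

Import GRing.Theory.
Local Open Scope classical_set_scope.
Local Open Scope ring_scope.

Record point_line := PointLine { pt :> Type; lines : set (set pt) }.
Arguments lines : clear implicits.

Section PointLine.
Variable Q : point_line.

(* Reflexive by convention, as usual for the perp notation. *)
Definition collinear (a b : Q) : Prop :=
  a = b \/ exists L, [/\ lines Q L, L a & L b].

Definition subspace (S : set Q) : Prop :=
  forall L a b, lines Q L -> L a -> L b -> a <> b -> S a -> S b -> L `<=` S.

Definition strong (X : set Q) : Prop :=
  subspace X /\ forall a b, X a -> X b -> collinear a b.

Definition span (A : set Q) : set Q :=
  [set x | forall S, subspace S -> A `<=` S -> S x].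

Definition generated_by (X : set Q) (n : nat) : Prop :=
  exists f : 'I_n -> Q, X = span [set f i | i in setT].

(* Projective dimension: one less than the least number of generators, so
   that the empty subspace has dimension -1. *)
Definition has_dim (X : set Q) (d : int) : Prop :=
  exists n : nat, [/\ d = n%:Z - 1, generated_by X n &
                     forall j : nat, generated_by X j -> (n <= j)%N].

Definition StrongSub (k : int) : set (set Q) :=
  [set X | strong X /\ has_dim X k].

(* The Buekenhout-Shult axioms; the finiteness of rank is in the last two
   clauses, which say that m is the maximal dimension of a strong subspace. *)
Definition polar_space_of_index (m : nat) : Prop :=
  [/\ (forall L, lines Q L -> exists a b c,
         [/\ L a, L b & L c] /\ [/\ a <> b, b <> c & a <> c]),
      (forall a : Q, exists b, ~ collinear a b),
      (forall (L : set Q) (a : Q), lines Q L ->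
         (forall b, L b -> collinear a b) \/
         (exists! b, L b /\ collinear a b)),
      (exists X, StrongSub m%:Z X)
    & (forall X, strong X -> exists2 d : int, (d <= m%:Z) & has_dim X d)].

Definition hyperplane (H : set Q) : Prop :=
  [/\ subspace H, H <> setT & forall L, lines Q L -> L `&` H !=set0].

End PointLine.

Section Affine.
Variables (Q : point_line) (H : set Q).

Definition affine_point : Type := {x : Q | ~ H x}.

(* X \ H, as a set of points of the affine polar space. *)
Definition trace (X : set Q) : set affine_point :=
  [set u | X (proj1_sig u)].

Definition affine_polar : point_line :=
  @PointLine affine_point
    [set l | exists L, [/\ lines Q L, ~ (L `<=` H) & l = trace L]].

(* The extra clause k = -1 is needed because the empty set is contained
   in H. *)
Definition SubU (k : int) : set (set affine_polar) :=
  [set A | (k = -1 /\ A = set0) \/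
           exists X, [/\ StrongSub k X, ~ (X `<=` H) & A = trace X]].

(* The subspaces of the affine polar space are the sets S \ H with S a
   subspace of Q.  If the lines of Q have exactly three points, affine lines
   have two and closure under lines would be vacuous (as in affine spaces of
   order 2).  If they have at least four points, then
   SubU (k + 1) (joinU A B) holds iff it holds with joinU replaced by the
   closure under affine lines. *)
Definition subspaceU (S : set affine_polar) : Prop :=
  exists2 X : set Q, subspace X & S = trace X.

Definition joinU (A B : set affine_polar) : set affine_polar :=
  [set x | forall S, subspaceU S -> A `|` B `<=` S -> S x].

Definition adj_meet (k : int) (A B : set affine_polar) : Prop :=
  SubU (k - 1) (A `&` B).

Definition adj_join (k : int) (A B : set affine_polar) : Prop :=
  SubU (k + 1) (joinU A B).

Definition adj_both (k : int) (A B : set affine_polar) : Prop :=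
  adj_meet k A B /\ adj_join k A B.

End Affine.

Arguments adj_meet {Q H}.
Arguments adj_join {Q H}.
Arguments adj_both {Q H}.

Record graph := Graph { vertex :> Type; adj : vertex -> vertex -> Prop }.

Definition SubU_graph (Q : point_line) (H : set Q) (k : int)
    (r : set (affine_polar H) -> set (affine_polar H) -> Prop) : graph :=
  @Graph {A : set (affine_polar H) | SubU k A}
         (fun A B => r (proj1_sig A) (proj1_sig B)).

(* Parameter-free definability, in higher-order logic with one binary relation
   symbol.  Configurations are objects of finite type: elements, pairs, sets,
   iterated. *)
Inductive ty := Elt | Pair of ty & ty | Pow of ty.

Fixpoint obj (M : Type) (t : ty) : Type :=
  match t with
  | Elt => M
  | Pair s t => (obj M s * obj M t)%type
  | Pow t => set (obj M t)
  end.

(* Well-typed de Bruijn variables. *)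
Inductive var : seq ty -> ty -> Type :=
| VZ G t : var (t :: G) t
| VS G s t : var G t -> var (s :: G) t.

Inductive formula : seq ty -> Type :=
| FAdj G : var G Elt -> var G Elt -> formula G
| FEq G t : var G t -> var G t -> formula G
| FIn G t : var G t -> var G (Pow t) -> formula G
| FPair G s t : var G s -> var G t -> var G (Pair s t) -> formula G
| FNot G : formula G -> formula G
| FAnd G : formula G -> formula G -> formula G
| FOr G : formula G -> formula G -> formula G
| FImp G : formula G -> formula G -> formula G
| FAll G t : formula (t :: G) -> formula G
| FEx G t : formula (t :: G) -> formula G.

Fixpoint env (M : Type) (G : seq ty) : Type :=
  if G is t :: G' then (obj M t * env M G')%type else unit.

Fixpoint lookup (M : Type) G t (v : var G t) : env M G -> obj M t :=
  match v in var G t return env M G -> obj M t with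
  | VZ _ _ => fun e => e.1
  | VS _ _ _ w => fun e => lookup w e.2
  end.

Fixpoint sat (M : graph) G (f : formula G) : env M G -> Prop :=
  match f in formula G return env M G -> Prop with
  | FAdj _ x y => fun e => @adj M (lookup x e) (lookup y e)
  | FEq _ _ x y => fun e => lookup x e = lookup y e
  | FIn _ _ x y => fun e => (lookup y e : set _) (lookup x e)
  | FPair _ _ _ x y z => fun e => lookup z e = (lookup x e, lookup y e)
  | FNot _ f1 => fun e => ~ sat f1 e
  | FAnd _ f1 f2 => fun e => sat f1 e /\ sat f2 e
  | FOr _ f1 f2 => fun e => sat f1 e \/ sat f2 e
  | FImp _ f1 f2 => fun e => sat f1 e -> sat f2 e
  | FAll _ t f1 => fun e => forall c : obj M t, @sat M _ f1 (c, e)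
  | FEx _ t f1 => fun e => exists c : obj M t, @sat M _ f1 (c, e)
  end.

(* A description of a point-line structure inside a graph: points are coded by
   configurations of type code, lines by sets of such configurations. *)
Record description := Description {
  code : ty;
  point_formula : formula [:: code];
  line_formula : formula [:: Pow code] }.

(* D recovers N from M: under some injective coding of points of N, the codes
   of points and of lines of N are exactly the objects over M defined by the
   formulas of D. *)
Definition recovers (D : description) (M : graph) (N : point_line) : Prop :=
  exists iota : N -> obj M (code D),
    [/\ injective iota,
        forall c : obj M (code D),
          @sat M _ (point_formula D) (c, tt) <-> exists x, iota x = c
      & forall C : set (obj M (code D)),
          @sat M _ (line_formula D) (C, tt) <->
          exists2 L, lines N L & C = [set iota x | x in L]].

(* Main.v *)
From mathcomp Require Import all_boot all_order all_algebra.
From mathcomp Require Import zify.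
From mathcomp Require Import boolp classical_sets.
Require Import Defs.

Set Implicit Arguments.
Unset Strict Implicit.
Unset Printing Implicit Defensive.

Local Open Scope classical_set_scope.

(** The proof works with the rank (dimension plus one) of strong
    subspaces. Call a strong subspace visible if it is not contained in H;
    the visible subspaces of rank n are the elements of Sub_(n-1) of the
    affine polar space. Each of the three graphs is shown to define the
    incidence between the visible subspaces of two consecutive ranks n and
    n + 1, for some n with 0 < n <= m. From there one descends one rank at
    a time, until the incidence of points and lines is reached.

    Geometry. From the Buekenhout-Shult axioms one lemma, [biperp_step],
    gives by induction that every strong subspace of finite rank is its
    own double perp. Consequences are that lines are determined by two
    points, that joining a point to a strong subspace yields the cone over
    it (so strong subspaces are projective), that the rank is well
    behaved, and that the points collinear with a non-maximal X are not
    mutually collinear, in the strong form [perp_witness].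

    Descent ([interpretable_step]). Let C, C' range over rank n + 1 and A,
    A' over rank n + 2. Suppose that A and A' share no C and are not
    parallel in a common strong subspace. Then the C in A that lie
    together with some C' in A' in a subspace of rank n + 2 all contain
    the meet F of A and A', which has rank n ([cross_rank]). If F is
    visible, this set is the full pencil of F in A; if F lies in H, it is
    a part of a parallel class of hyperplanes of the affine space A, and
    has to be told apart. This may be hard to see locally, since for lines
    with few points or for hyperbolic quadrics the residues of visible and
    invisible F can look alike. But parallelism on the hyperplanes of A
    can be defined by quantifying over relations. A nontrivial equivalence
    such that inequivalent hyperplanes lie in a common pencil, a pencil
    with two equivalent members lies in one class, and pencils through a
    common member which meet a second common class meet the same classes,
    cannot contain a pair of non-parallel hyperplanes
    ([parallelism_trace]); and parallelism itself is such an equivalence.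
    So parallelism is the union of all these relations.

    Starting points. For the meet graph, the star of a visible subspace of
    one rank less consists of two adjacent vertices that are not in a
    common strong subspace and of their common neighbours
    ([pair_star_names]). For the join graph, {u, v}^perp^perp in the graph
    is the pencil of u and v ([pencilE]), which for points is a line; in
    ranks 1 < n < m the failure of the Veblen axiom detects whether the
    meet of u and v is visible ([meetingE]), so that it defines the graph
    of both relations. In the latter graph, a maximal clique is an
    interval [between C Y] with Y maximal, or consists of pairwise
    non-parallel hyperplanes of some D; the second kind has a vertex outside
    with exactly one non-neighbour inside, the first kind never
    ([star_between]). For rank m the neighbourhoods of edges give the
    maximal subspaces ([pair_top_names], [twice_adjE]). *)

(** * Definability in higher-order logic *)

(** A predicate on environments is tested in all graphs by one and the same
    formula.  Definable predicates are thereby written as ordinary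
    propositions, and their formulas are found by proof search. *)
Definition dfn (G : seq ty) (P : forall M : graph, env M G -> Prop) :=
  exists f : formula G, forall (M : graph) (e : env M G), @sat M G f e <-> P M e.

Definition isvar (G : seq ty) (t : ty) (a : forall M : graph, env M G -> obj M t) :=
  exists v : var G t, forall (M : graph) (e : env M G), lookup v e = a M e.

Section Dfn.
Variable G : seq ty.
Implicit Types P R : forall M : graph, env M G -> Prop.

Lemma dfn_ext P R : (forall M e, P M e <-> R M e) -> dfn P -> dfn R.
Proof. by move=> PR [f hf]; exists f => M e; rewrite hf. Qed.

Lemma dfn_adj (a b : forall M : graph, env M G -> obj M Elt) :
  isvar a -> isvar b -> dfn (fun M e => @adj M (a M e) (b M e)).
Proof. by move=> [v hv] [w hw]; exists (FAdj v w) => M e /=; rewrite hv hw. Qed.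

Lemma dfn_eq t (a b : forall M : graph, env M G -> obj M t) :
  isvar a -> isvar b -> dfn (fun M e => a M e = b M e).
Proof. by move=> [v hv] [w hw]; exists (FEq v w) => M e /=; rewrite hv hw. Qed.

Lemma dfn_in t (a : forall M : graph, env M G -> obj M t)
    (b : forall M : graph, env M G -> obj M (Pow t)) :
  isvar a -> isvar b -> dfn (fun M e => (b M e : set _) (a M e)).
Proof. by move=> [v hv] [w hw]; exists (FIn v w) => M e /=; rewrite hv hw. Qed.

Lemma dfn_pair s t (a : forall M : graph, env M G -> obj M s)
    (b : forall M : graph, env M G -> obj M t)
    (p : forall M : graph, env M G -> obj M (Pair s t)) :
  isvar a -> isvar b -> isvar p -> dfn (fun M e => p M e = (a M e, b M e)).
Proof. by move=> [v hv] [w hw] [u hu]; exists (FPair v w u) => M e /=; rewrite hv hw hu. Qed.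

Lemma dfn_not P : dfn P -> dfn (fun M e => ~ P M e).
Proof. by move=> [f hf]; exists (FNot f) => M e /=; rewrite hf. Qed.

Lemma dfn_and P R : dfn P -> dfn R -> dfn (fun M e => P M e /\ R M e).
Proof. by move=> [f hf] [g hg]; exists (FAnd f g) => M e /=; rewrite hf hg. Qed.

Lemma dfn_or P R : dfn P -> dfn R -> dfn (fun M e => P M e \/ R M e).
Proof. by move=> [f hf] [g hg]; exists (FOr f g) => M e /=; rewrite hf hg. Qed.

Lemma dfn_imp P R : dfn P -> dfn R -> dfn (fun M e => P M e -> R M e).
Proof. by move=> [f hf] [g hg]; exists (FImp f g) => M e /=; rewrite hf hg. Qed.

Lemma dfn_all t (P : forall M : graph, obj M t -> env M G -> Prop) :
  dfn (G := t :: G) (fun M e => P M e.1 e.2) -> dfn (fun M e => forall c : obj M t, P M c e).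
Proof.
move=> [f hf]; exists (FAll f) => M e /=.
by split=> h c; [apply/(hf M (c, e))|apply/hf].
Qed.

Lemma dfn_ex t (P : forall M : graph, obj M t -> env M G -> Prop) :
  dfn (G := t :: G) (fun M e => P M e.1 e.2) -> dfn (fun M e => exists c : obj M t, P M c e).
Proof.
move=> [f hf]; exists (FEx f) => M e /=.
by split=> -[c h]; exists c; [apply/(hf M (c, e))|apply/hf].
Qed.

End Dfn.

Section DfnDerived.
Variable G : seq ty.
Implicit Types P R : forall M : graph, env M G -> Prop.

Lemma dfn_ex2 t (P P' : forall M : graph, obj M t -> env M G -> Prop) :
  dfn (G := t :: G) (fun M e => P M e.1 e.2) -> dfn (G := t :: G) (fun M e => P' M e.1 e.2) ->
  dfn (fun M e => exists2 c : obj M t, P M c e & P' M c e).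
Proof.
move=> dP dP'; apply: (@dfn_ext _ (fun M e => exists c : obj M t, P M c e /\ P' M c e)).
  by move=> M e; split=> [[c [? ?]]|[c ? ?]]; exists c.
by apply: dfn_ex; apply: (dfn_and dP dP').
Qed.

Lemma dfn_iff P R : dfn P -> dfn R -> dfn (fun M e => P M e <-> R M e).
Proof. by move=> dP dR; apply: dfn_and; apply: dfn_imp. Qed.

Lemma dfn_and3 P P' R : dfn P -> dfn P' -> dfn R -> dfn (fun M e => [/\ P M e, P' M e & R M e]).
Proof.
move=> dP dP' dR; apply: (@dfn_ext _ (fun M e => P M e /\ (P' M e /\ R M e))).
  by move=> M e; split=> [[? [? ?]]|[? ? ?]].
by do !apply: dfn_and.
Qed.

Lemma dfn_and4 P P' R R' : dfn P -> dfn P' -> dfn R -> dfn R' ->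
  dfn (fun M e => [/\ P M e, P' M e, R M e & R' M e]).
Proof.
move=> dP dP' dR dR'; apply: (@dfn_ext _ (fun M e => P M e /\ [/\ P' M e, R M e & R' M e])).
  by move=> M e; split=> [[? [? ? ?]]|[? ? ? ?]].
by apply: dfn_and => //; apply: dfn_and3.
Qed.

Lemma dfn_and5 P P' R R' R'' : dfn P -> dfn P' -> dfn R -> dfn R' -> dfn R'' ->
  dfn (fun M e => [/\ P M e, P' M e, R M e, R' M e & R'' M e]).
Proof.
move=> dP dP' dR dR' dR''; apply: (@dfn_ext _ (fun M e => P M e /\ [/\ P' M e, R M e, R' M e & R'' M e])).
  by move=> M e; split=> [[? [? ? ? ?]]|[? ? ? ? ?]].
by apply: dfn_and => //; apply: dfn_and4.
Qed.

End DfnDerived.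

(** Closed under all contexts and variables, so that a definable predicate can
    be used as an atom below quantifiers without renaming its formula. *)
Definition definable1 s (P : forall M : graph, obj M s -> Prop) :=
  forall G (x : var G s), dfn (fun M (e : env M G) => P M (lookup x e)).

Definition definable2 s t (P : forall M : graph, obj M s -> obj M t -> Prop) :=
  forall G (x : var G s) (y : var G t), dfn (fun M (e : env M G) => P M (lookup x e) (lookup y e)).

Definition definable3 s t u (P : forall M : graph, obj M s -> obj M t -> obj M u -> Prop) :=
  forall G (x : var G s) (y : var G t) (z : var G u),
    dfn (fun M (e : env M G) => P M (lookup x e) (lookup y e) (lookup z e)).

Lemma dfn_app1 s (P : forall M : graph, obj M s -> Prop) G (a : forall M : graph, env M G -> obj M s) :
  definable1 P -> isvar a -> dfn (fun M e => P M (a M e)).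
Proof. by move=> dP [v hv]; apply: dfn_ext (dP G v) => M e; rewrite hv. Qed.

Lemma dfn_app2 s t (P : forall M : graph, obj M s -> obj M t -> Prop) G
    (a : forall M : graph, env M G -> obj M s) (b : forall M : graph, env M G -> obj M t) :
  definable2 P -> isvar a -> isvar b -> dfn (fun M e => P M (a M e) (b M e)).
Proof. by move=> dP [v hv] [w hw]; apply: dfn_ext (dP G v w) => M e; rewrite hv hw. Qed.

Lemma dfn_app3 s t u (P : forall M : graph, obj M s -> obj M t -> obj M u -> Prop) G
    (a : forall M : graph, env M G -> obj M s) (b : forall M : graph, env M G -> obj M t)
    (c : forall M : graph, env M G -> obj M u) :
  definable3 P -> isvar a -> isvar b -> isvar c -> dfn (fun M e => P M (a M e) (b M e) (c M e)).
Proof. by move=> dP [v hv] [w hw] [r hr]; apply: dfn_ext (dP G v w r) => M e; rewrite hv hw hr. Qed.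

Ltac try_var n v :=
  lazymatch n with S ?n' =>
    first [exists v; intros; reflexivity | try_var n' uconstr:(VS _ v)] end.
Ltac solve_isvar := first [try_var 12%N uconstr:(VZ _ _) |
  match goal with x : var _ _ |- _ => try_var 12%N uconstr:(x) end].

(** Higher-order unification does not split an application into a set and its
    member, so both parts are read off the goal. *)
Ltac dfn_mem :=
  match goal with |- @dfn ?G ?f =>
    let a := constr:(fun (M : graph) (e : env M G) => ltac:(
      let h := eval cbv beta in (f M e) in match h with ?b ?a => exact a end)) in
    let b := constr:(fun (M : graph) (e : env M G) => ltac:(
      let h := eval cbv beta in (f M e) in match h with ?b ?a => exact b end)) in
    apply: (@dfn_in G _ a b); solve_isvar
  end.

Lemma dfn_inpair s t G (a : forall M : graph, env M G -> obj M s)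
    (b : forall M : graph, env M G -> obj M t)
    (E : forall M : graph, env M G -> obj M (Pow (Pair s t))) :
  isvar a -> isvar b -> isvar E -> dfn (fun M e => (E M e : set _) (a M e, b M e)).
Proof.
move=> [v hv] [w hw] [u hu].
apply: (@dfn_ext _ (fun M e => exists p : obj M (Pair s t), p = (lookup v e, lookup w e) /\ (lookup u e : set _) p)).
  by move=> M e; rewrite hv hw hu; split=> [[p [->]]|] //; exists (a M e, b M e).
apply: dfn_ex; cbv beta; apply: dfn_and.
- apply: dfn_pair; solve_isvar.
- dfn_mem.
Qed.

Ltac dfn_mem_pair :=
  match goal with |- @dfn ?G ?f =>
    let a := constr:(fun (M : graph) (e : env M G) => ltac:(
      let h := eval cbv beta in (f M e) in match h with ?E (?a, ?b) => exact a end)) in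
    let b := constr:(fun (M : graph) (e : env M G) => ltac:(
      let h := eval cbv beta in (f M e) in match h with ?E (?a, ?b) => exact b end)) in
    let E := constr:(fun (M : graph) (e : env M G) => ltac:(
      let h := eval cbv beta in (f M e) in match h with ?E (?a, ?b) => exact E end)) in
    apply: (@dfn_inpair _ _ G a b E); solve_isvar
  end.

Ltac dfn_solve := cbv beta; lazymatch goal with
  | |- dfn (fun M e => ex2 _ _) => apply: dfn_ex2; dfn_solve
  | |- dfn (fun M e => exists c, _) => apply: dfn_ex; dfn_solve
  | |- dfn (fun M e => and5 _ _ _ _ _) => apply: dfn_and5; dfn_solve
  | |- dfn (fun M e => and4 _ _ _ _) => apply: dfn_and4; dfn_solve
  | |- dfn (fun M e => and3 _ _ _) => apply: dfn_and3; dfn_solve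
  | |- dfn (fun M e => _ /\ _) => apply: dfn_and; dfn_solve
  | |- dfn (fun M e => _ \/ _) => apply: dfn_or; dfn_solve
  | |- dfn (fun M e => _ <-> _) => apply: dfn_iff; dfn_solve
  | |- dfn (fun M e => ~ _) => apply: dfn_not; dfn_solve
  | |- dfn (fun M e => @?P M e -> @?R M e) => apply: (@dfn_imp _ P R); dfn_solve
  | |- dfn (fun M e => forall c, _) => apply: dfn_all; dfn_solve
  | |- dfn (fun M e => _ = _) => apply: dfn_eq; solve_isvar
  | _ => first
    [ match goal with
      | h : definable1 _ |- _ => apply: (dfn_app1 h); solve_isvar
      | h : definable2 _ |- _ => apply: (dfn_app2 h); solve_isvar
      | h : definable3 _ |- _ => apply: (dfn_app3 h); solve_isvar
      end
    | apply: dfn_adj; solve_isvar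
    | dfn_mem_pair
    | dfn_mem ]
  end.

(** * From incidence of two consecutive ranks to the next lower rank *)

(** A coding of the family [fam]: the codes are the elements that satisfy [P], and
    [d] decodes them. *)
Definition names (U S : Type) (P : S -> Prop) (fam : set (set U)) (d : S -> set U) :=
  [/\ forall c, P c -> fam (d c),
      forall c c', P c -> P c' -> d c = d c' -> c = c'
    & forall X, fam X -> exists2 c, P c & d c = X].

Section Descent.
Variables (S T : Type) (PX : S -> Prop) (PY : T -> Prop) (In : S -> T -> Prop).

(** Throughout, c ranges over codes of subspaces of rank n + 1, and a over codes of
    subspaces of rank n + 2. *)
Definition joined (c c' : S) := c <> c' /\ exists b, [/\ PY b, In c b & In c' b].

Definition hyp_of (a : T) (c : S) := PX c /\ In c a.

(** The trace on a of the lines joining a to a' in the residue of their meet. *)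
Definition side (a a' : T) (c : S) := hyp_of a c /\ exists c', hyp_of a' c' /\ joined c c'.

(** In terms of subspaces, the meet of a and a' has rank n: the last condition
    excludes that a and a' are parallel in a common strong subspace, in which case
    every hyperplane of a is joined to one of a'. *)
Definition crossing (a a' : T) :=
  [/\ PY a /\ PY a', ~ exists c, hyp_of a c /\ hyp_of a' c,
      exists c c', [/\ side a a' c, side a a' c' & c <> c']
    & exists c, hyp_of a c /\ ~ side a a' c].

(** The properties of parallelism that can be expressed by pencils.  Other relations may
    have them too, but none of these identifies non-parallel hyperplanes
    ([parallelism_trace]); hence [parallel] is parallelism. *)
Definition parallelism (a : T) (E : set (S * S)) :=
  [/\ [/\ forall c, hyp_of a c -> E (c, c),
          forall c d, hyp_of a c -> hyp_of a d -> E (c, d) -> E (d, c)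
        & forall c d e, hyp_of a c -> hyp_of a d -> hyp_of a e -> E (c, d) -> E (d, e) -> E (c, e)],
      exists c d, [/\ hyp_of a c, hyp_of a d & ~ E (c, d)],
      forall c d, hyp_of a c -> hyp_of a d -> ~ E (c, d) ->
        exists a', [/\ crossing a a', side a a' c & side a a' d],
      forall a' c d x, crossing a a' -> side a a' c -> side a a' d -> side a a' x ->
        c <> d -> E (c, d) -> E (c, x)
    & forall a' a'' c x x' y, crossing a a' -> crossing a a'' ->
        side a a' c -> side a a'' c -> side a a' x -> side a a'' x' -> E (x, x') ->
        ~ E (c, x) -> side a a' y -> exists2 w, side a a'' w & E (w, y)].

Definition parallel (a : T) (c d : S) := c = d \/ exists2 E, parallelism a E & E (c, d).

(** Two non-parallel hyperplanes of a have a visible meet, so this says that the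
    meet of a and a' is visible. *)
Definition affine_crossing (a a' : T) :=
  crossing a a' /\ exists c d, [/\ side a a' c, side a a' d & ~ parallel a c d].

(** In the residue of the meet of a and a', where a is a line, a point off a
    lies on a line a'' disjoint from a. *)
Definition star (a a' : T) (c : S) := side a a' c \/
  exists a'', [/\ crossing a a'', forall d, side a a'' d <-> side a a' d & side a'' a c].

Definition star_code (f : set S) := exists a a', affine_crossing a a' /\ forall c, f c <-> star a a' c.

Definition mem_code (f : set S) (c : S) := f c.

End Descent.

Section StepDef.
Variables (s t : ty) (PX : forall M : graph, obj M s -> Prop)
  (PY : forall M : graph, obj M t -> Prop) (In : forall M : graph, obj M s -> obj M t -> Prop).
Hypotheses (dX : definable1 PX) (dY : definable1 PY) (dI : definable2 In).

Lemma def_joined : definable2 (fun M => joined (@PY M) (@In M)).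
Proof. by move=> G x y; rewrite /joined; dfn_solve. Qed.

Lemma def_hyp_of : definable2 (fun M a c => hyp_of (@PX M) (@In M) a c).
Proof. by move=> G x y; rewrite /hyp_of; dfn_solve. Qed.

Lemma def_side : definable3 (fun M => side (@PX M) (@PY M) (@In M)).
Proof.
move=> G x y z; have h1 := def_joined; have h2 := def_hyp_of.
by rewrite /side; dfn_solve.
Qed.

Lemma def_crossing : definable2 (fun M => crossing (@PX M) (@PY M) (@In M)).
Proof.
move=> G x y; have h1 := def_side; have h2 := def_hyp_of.
by rewrite /crossing; dfn_solve.
Qed.

Lemma def_parallelism : definable2 (fun M (a : obj M t) (E : obj M (Pow (Pair s s))) =>
  parallelism (@PX M) (@PY M) (@In M) a E).
Proof.
move=> G x y; have h1 := def_side; have h2 := def_hyp_of; have h3 := def_crossing.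
by rewrite /parallelism; dfn_solve.
Qed.

Lemma def_parallel : definable3 (fun M => parallel (@PX M) (@PY M) (@In M)).
Proof.
move=> G x y z; have h1 := def_parallelism; rewrite /parallel; apply: dfn_or; first by dfn_solve.
by apply: (@dfn_ex2 _ (Pow (Pair s s))); dfn_solve.
Qed.

Lemma def_affine_crossing : definable2 (fun M => affine_crossing (@PX M) (@PY M) (@In M)).
Proof.
move=> G x y; have h1 := def_side; have h2 := def_parallel; have h3 := def_crossing.
by rewrite /affine_crossing; dfn_solve.
Qed.

Lemma def_star : definable3 (fun M => star (@PX M) (@PY M) (@In M)).
Proof.
move=> G x y z; have h1 := def_side; have h3 := def_crossing.
by rewrite /star; dfn_solve.
Qed.

Lemma def_star_code : definable1 (fun M (f : obj M (Pow s)) => star_code (@PX M) (@PY M) (@In M) f).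
Proof.
move=> G x; have h1 := def_star; have h3 := def_affine_crossing.
by rewrite /star_code; dfn_solve.
Qed.

Lemma def_mem_code : definable2 (fun M (f : obj M (Pow s)) (c : obj M s) => mem_code f c).
Proof. by move=> G x y; rewrite /mem_code; dfn_solve. Qed.

End StepDef.

(** * Cliques, stars and pencils of a graph *)

Section GraphPredicates.
Variables (V : Type) (adj : V -> V -> Prop).

Definition pair_hull (u v w : V) := w = u \/ w = v \/ (adj w u /\ adj w v).

(** The common neighbours of an edge form a clique exactly if the two ends
    are not in a common strong subspace. *)
Definition pair_star (c : set V) :=
  exists u v, [/\ adj u v, forall w, c w <-> pair_hull u v w &
    forall w w', c w -> c w' -> w <> w' -> adj w w'].

Definition pair_top (c : set V) := exists u v, adj u v /\ forall w, c w <-> pair_hull u v w.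

(** The set {u, v}^perp^perp, where perp stands for being adjacent or equal. *)
Definition pencil (u v w : V) :=
  [/\ w = u \/ adj w u, w = v \/ adj w v & forall z, adj z u -> adj z v -> z = w \/ adj z w].

Definition pencil_code (c : set V) := exists u v, adj u v /\ forall w, c w <-> pencil u v w.

(** A triangle e, u, v whose sides e u and e v carry points u', v' such that the
    lines u v and u' v' do not meet. *)
Definition veblen_gap (u v : V) := exists e u' v',
  [/\ [/\ adj e u, adj e v & ~ pencil u v e],
      [/\ pencil e u u', u' <> e & u' <> u],
      [/\ pencil e v v', v' <> e & v' <> v]
    & forall w, pencil u v w -> ~ pencil u' v' w].

Definition meeting (u v : V) := adj u v /\ ~ veblen_gap u v.

Definition clique (K : set V) := forall u v, K u -> K v -> u <> v -> adj u v.

Definition max_clique (K : set V) :=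
  clique K /\ forall w, (forall u, K u -> u <> w -> adj w u) -> K w.

(** A maximal clique can also consist of pairwise non-parallel hyperplanes of one
    strong subspace.  A hyperplane outside it that is parallel to a member has exactly
    one non-neighbour in it; so the second condition excludes this kind. *)
Definition star_clique (K : set V) := max_clique K /\
  ~ exists w u, [/\ ~ K w, K u, ~ adj w u & forall v, K v -> v <> u -> adj w v].

(** The star of C is the union of the intervals from C to maximal subspaces.  Given one
    of them, every vertex over C lies in one that shares two elements with it,
    and two elements determine C as their meet. *)
Definition clique_star (c : set V) := exists K, star_clique K /\
  forall w, c w <-> exists K' u v, [/\ star_clique K', K' w, u <> v, K u /\ K v & K' u /\ K' v].

(** Parallel hyperplanes u and v of a maximal strong subspace are not adjacent, but
    there is an edge whose ends are adjacent to both. *)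
Definition twice_adj (u v : V) := u <> v /\
  (adj u v \/ exists a b, [/\ adj a b, adj a u /\ adj b u & adj a v /\ adj b v]).

Definition union_dec (Q : Type) (d : V -> set Q) (c : set V) : set Q := [set x | exists2 v, c v & d v x].

End GraphPredicates.

Section GraphDefinable.
Variable A : forall M : graph, obj M Elt -> obj M Elt -> Prop.
Hypothesis dA : definable2 A.

Lemma def_pair_hull : definable3 (fun M => pair_hull (@A M)).
Proof. by move=> G x y z; rewrite /pair_hull; dfn_solve. Qed.

Lemma def_pair_star : definable1 (fun M (c : obj M (Pow Elt)) => pair_star (@A M) c).
Proof. by move=> G x; have h := def_pair_hull; rewrite /pair_star; dfn_solve. Qed.

Lemma def_pair_top : definable1 (fun M (c : obj M (Pow Elt)) => pair_top (@A M) c).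
Proof. by move=> G x; have h := def_pair_hull; rewrite /pair_top; dfn_solve. Qed.

Lemma def_pencil : definable3 (fun M => pencil (@A M)).
Proof. by move=> G x y z; rewrite /pencil; dfn_solve. Qed.

Lemma def_pencil_code : definable1 (fun M (c : obj M (Pow Elt)) => pencil_code (@A M) c).
Proof. by move=> G x; have h := def_pencil; rewrite /pencil_code; dfn_solve. Qed.

Lemma def_meeting : definable2 (fun M => meeting (@A M)).
Proof. by move=> G x y; have h := def_pencil; rewrite /meeting /veblen_gap; dfn_solve. Qed.

Lemma def_star_clique : definable1 (fun M (K : obj M (Pow Elt)) => star_clique (@A M) K).
Proof. by move=> G x; rewrite /star_clique /max_clique /clique; dfn_solve. Qed.

Lemma def_clique_star : definable1 (fun M (c : obj M (Pow Elt)) => clique_star (@A M) c).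
Proof.
move=> G x; have h := def_star_clique; rewrite /clique_star.
apply: (@dfn_ex _ (Pow Elt)); cbv beta; apply: dfn_and; first by dfn_solve.
apply: dfn_all; cbv beta; apply: dfn_iff; first by dfn_solve.
by apply: (@dfn_ex _ (Pow Elt)); dfn_solve.
Qed.

Lemma def_twice_adj : definable2 (fun M => twice_adj (@A M)).
Proof. by move=> G x y; rewrite /twice_adj; dfn_solve. Qed.

End GraphDefinable.

Lemma def_mem_code_rev : definable2 (fun M (w : obj M Elt) (c : obj M (Pow Elt)) => mem_code c w).
Proof. by move=> G x y; have h := @def_mem_code Elt; rewrite /mem_code; dfn_solve. Qed.

Lemma def_adj : definable2 (fun M (u v : obj M Elt) => @adj M u v).
Proof. by move=> G x y; dfn_solve. Qed.

Lemma def_true t : definable1 (fun M (u : obj M t) => True).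
Proof.
move=> G x; apply: (@dfn_ext _ (fun M (e : env M G) => lookup x e = lookup x e)) => //.
by dfn_solve.
Qed.

(** * Perpendicularity and spans *)

Section Perp.
Variable Q : point_line.
Implicit Types (a b c d x y z s t w : Q) (A B S X Y Z K L M : set Q).

Lemma coll_refl a : collinear a a. Proof. by left. Qed.

Lemma coll_sym a b : collinear a b -> collinear b a.
Proof. by case=> [->|[L [? ? ?]]]; [left|right; exists L]. Qed.

Lemma coll_line L a b : lines Q L -> L a -> L b -> collinear a b.
Proof. by move=> ? ? ?; right; exists L. Qed.

Definition perp A : set Q := [set x | forall a, A a -> collinear x a].

Lemma perpS A B : A `<=` B -> perp B `<=` perp A.
Proof. by move=> sAB x xB a /sAB/xB. Qed.

Lemma sub_biperp A : A `<=` perp (perp A).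
Proof. by move=> a Aa x /(_ a Aa)/coll_sym. Qed.

Lemma sub_span A : A `<=` span A. Proof. by move=> a Aa S _; apply. Qed.

Lemma span_subspace A : subspace (span A).
Proof.
move=> L a b LL La Lb nab Sa Sb z Lz S SS AS.
exact: (SS L a b LL La Lb nab (Sa S SS AS) (Sb S SS AS)).
Qed.

Lemma span_min A S : subspace S -> A `<=` S -> span A `<=` S.
Proof. by move=> SS AS x; apply. Qed.

Lemma spanS A B : A `<=` B -> span A `<=` span B.
Proof. move=> sAB; apply: span_min; [exact: span_subspace|move=> a /sAB; exact: sub_span]. Qed.

Lemma span_id S : subspace S -> span S = S.
Proof. by move=> SS; apply/seteqP; split; [exact: span_min|exact: sub_span]. Qed.

Lemma subspaceI A B : subspace A -> subspace B -> subspace (A `&` B).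
Proof.
move=> SA SB L a b LL La Lb nab [Aa Ba] [Ab Bb] z Lz.
by split; [exact: (SA L a b)|exact: (SB L a b)].
Qed.

Definition join1 X x := span (X `|` [set x]).
Local Notation "X <+ x" := (join1 X x) (at level 50, left associativity).

Lemma join1_sub X x : X `<=` X <+ x.
Proof. by move=> y Xy; apply: sub_span; left. Qed.

Lemma join1_in X x : (X <+ x) x.
Proof. by apply: sub_span; right. Qed.

Lemma join1_subspace X x : subspace (X <+ x). Proof. exact: span_subspace. Qed.

Lemma join1_min X x S : subspace S -> X `<=` S -> S x -> X <+ x `<=` S.
Proof. by move=> SS XS Sx; apply: span_min => // y [/XS|->]. Qed.

Lemma cone_join1 X x w L y : X w -> w <> x -> lines Q L -> L x -> L w -> L y ->
  (X <+ x) y.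
Proof.
move=> Xw nwx LL Lx Lw; apply: (join1_subspace LL Lw Lx nwx); last exact: join1_in.
exact: join1_sub.
Qed.

End Perp.

Local Notation "X <+ x" := (join1 X x) (at level 50, left associativity).

Section PolarSpace.
Variables (Q : point_line) (m : nat).
Hypothesis polQ : polar_space_of_index Q m.

(** * Strong subspaces of a polar space and their rank *)
Section Geometry.
Implicit Types (a b c d x y z s t w : Q) (A B S X Y Z K L M : set Q).

Lemma line_third L x y : lines Q L -> exists z, [/\ L z, z <> x & z <> y].
Proof.
case: polQ => thick _ _ _ _ /thick[a [b [c [[La Lb Lc] [nab nbc nac]]]]].
have [[ax ay]|ha] := EM (a <> x /\ a <> y); first by exists a.
have [[bx b_y]|hb] := EM (b <> x /\ b <> y); first by exists b.
have [[cx cy]|hc] := EM (c <> x /\ c <> y); first by exists c.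
exfalso; move: ha hb hc => /not_andP[/contrapT|/contrapT] ha
  /not_andP[/contrapT|/contrapT] hb /not_andP[/contrapT|/contrapT] hc; congruence.
Qed.

Lemma line_meet L a : lines Q L -> exists2 b, L b & collinear a b.
Proof.
move=> LL; have [_ _ one _ _] := polQ; have [all|[b [[Lb ab] _]]] := one L a LL.
- have [z [Lz _ _]] := line_third a a LL; exists z => //; exact: all.
- by exists b.
Qed.

Lemma coll_two L a x y z : lines Q L -> L x -> L y -> x <> y ->
  collinear a x -> collinear a y -> L z -> collinear a z.
Proof.
move=> LL Lx Ly nxy ax ay Lz; have [_ _ one _ _] := polQ.
have [all|[b [_ ub]]] := one L a LL; first exact: all.
by case: nxy; rewrite -(ub x) ?(ub y).
Qed.

Lemma perp_subspace A : subspace (perp A).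
Proof.
move=> L a b LL La Lb nab Pa Pb z Lz c Ac; apply: coll_sym.
by apply: (coll_two LL La Lb nab) => //; apply: coll_sym; [apply: Pa|apply: Pb].
Qed.

Lemma span_perp A : A `<=` perp A -> span A `<=` perp (span A).
Proof.
move=> AA; have h : span A `<=` perp A by apply: span_min => //; exact: perp_subspace.
apply: span_min; first exact: perp_subspace.
by move=> a Aa x /h/(_ a Aa)/coll_sym.
Qed.

Lemma span_strong A : A `<=` perp A -> strong (span A).
Proof. by move=> /span_perp AA; split=> [|a b /AA]; [exact: span_subspace|apply]. Qed.

Lemma strong_perp X : strong X -> X `<=` perp X.
Proof. by case=> _ h x Xx y; apply: h. Qed.

(** The point w is taken collinear with t.  A point s of B^perp not collinear with
    x is compared with t: if s and t are collinear, their line has a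
    point collinear with x, hence with w, and so w is collinear with s; in
    general s is collinear with a point of the line t w, which takes the place of
    t.  Both the uniqueness of lines and the projective structure of strong
    subspaces are derived from this lemma. *)
Lemma biperp_step B x y L t : lines Q L -> L x -> L y -> x <> y ->
    perp B x -> perp B y ->
    (forall s, perp B s -> collinear s x -> collinear s y) ->
    perp B t -> ~ collinear t x ->
  exists2 w, L w & perp (perp B) w.
Proof.
move=> LL Lx Ly nxy Bx By xy Bt ntx.
have [w Lw tw] := line_meet t LL.
have Bw : perp B w by apply: (perp_subspace LL Lx Ly nxy).
have Lperp s : perp B s -> collinear s x -> collinear s w.
  by move=> Bs sx; apply: (coll_two LL Lx Ly nxy) => //; exact: xy.
have adj s g : perp B s -> perp B g -> collinear g w -> ~ collinear g x ->
    collinear s g -> collinear s w.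
  move=> Bs Bg gw ngx sg; have [->//|nsg] := EM (s = g).
  case: sg => // -[M [LM Ms Mg]].
  have [r Mr xr] := line_meet x LM.
  have Br : perp B r by apply: (perp_subspace LM Ms Mg nsg).
  have rw := Lperp r Br (coll_sym xr).
  have nrg : r <> g by move=> e; apply: ngx; rewrite -e; exact: coll_sym.
  by apply/coll_sym/(coll_two LM Mr Mg nrg) => //; exact: coll_sym.
exists w => // s Bs; apply: coll_sym.
have [sx|nsx] := EM (collinear s x); first exact: Lperp.
have [st|nst] := EM (collinear s t); first exact: (adj s t).
have ntw : t <> w by move=> e; apply: ntx; rewrite e; exact: (coll_line LL).
case: tw => // -[M [LM Mt Mw]].
have [g Mg sg] := line_meet s LM.
have [<-//|ngw] := EM (g = w).
apply: (adj s g) => //.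
- by apply: (perp_subspace LM Mt Mw ntw).
- exact: (coll_line LM).
- move=> gx; apply/ntx/coll_sym.
  apply: (coll_two LM Mg Mw ngw) => //; first exact: coll_sym.
  exact: (coll_line LL).
Qed.

Lemma clique_join1 X x : strong X -> perp X x -> X `|` [set x] `<=` perp (X `|` [set x]).
Proof.
move=> sX Xx a [Xa|->] b [Xb|->]; first exact: strong_perp Xb.
- exact/coll_sym/Xx. - exact: Xx. - exact: coll_refl.
Qed.

Lemma join1_strong X x : strong X -> perp X x -> strong (X <+ x).
Proof. by move=> sX Xx; apply/span_strong/clique_join1. Qed.

Definition closed X := perp (perp X) `<=` X.

(** Finite rank strong subspaces arise from the empty set by adding points; this is
    the inductive step both for their closedness and for their projective
    structure. *)
Lemma biperp_cone X x y : strong X -> closed X -> perp X x -> ~ X x ->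
    perp (perp (X `|` [set x])) y ->
  y = x \/ exists w L, [/\ X w, lines Q L & [/\ L x, L w & L y]].
Proof.
move=> sX cX Xx nXx ppy; have [->|nyx] := EM (y = x); [by left|right].
have cl := clique_join1 sX Xx.
have : collinear x y by apply/coll_sym/ppy/cl; right.
case=> [/esym//|[L [LL Lx Ly]]].
have [t Xt ntx] : exists2 t, perp X t & ~ collinear t x.
  apply: contrapT => h; apply/nXx/cX => t Xt; apply: coll_sym; apply: contrapT => ntx.
  by apply: h; exists t.
have [] := @biperp_step X x y L t LL Lx Ly (fun e => nyx (esym e)) Xx _ _ Xt ntx.
- by move=> b Xb; apply: ppy; apply: cl; left.
- by move=> s Xs sx; apply/coll_sym/ppy => a [/Xs|->].
- by move=> w Lw /cX Xw; exists w, L.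
Qed.

Lemma span_biperp A : span A `<=` perp (perp A).
Proof. by apply: span_min; [exact: perp_subspace|exact: sub_biperp]. Qed.

Lemma perp_span A : perp (span A) = perp A.
Proof.
apply/seteqP; split; first by apply: perpS; exact: sub_span.
by move=> x Ax a /span_biperp/(_ x Ax)/coll_sym.
Qed.

Lemma perp_join1 X x y : perp (X <+ x) y <-> perp X y /\ collinear y x.
Proof.
rewrite perp_span; split=> [h|[Xy yx] a [/Xy|->]//].
by split=> [a Xa|]; apply: h; [left|right].
Qed.

Lemma biperp_join1 X x : strong X -> closed X -> perp X x -> ~ X x ->
  perp (perp (X `|` [set x])) `<=` X <+ x.
Proof.
move=> sX cX Xx nXx y /(biperp_cone sX cX Xx nXx)[->|[w [L [Xw LL [Lx Lw Ly]]]]].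
- exact: join1_in.
- by apply: (cone_join1 Xw _ LL) => // e; apply: nXx; rewrite -e.
Qed.

Lemma join1_cone X x y : strong X -> closed X -> perp X x -> ~ X x -> (X <+ x) y ->
  y = x \/ exists w L, [/\ X w, lines Q L & [/\ L x, L w & L y]].
Proof. by move=> sX cX Xx nXx /span_biperp; exact: biperp_cone. Qed.

Lemma join1_closed X x : strong X -> closed X -> perp X x -> ~ X x -> closed (X <+ x).
Proof. by move=> sX cX Xx nXx; rewrite /closed perp_span; exact: biperp_join1. Qed.

Lemma strong0 : strong (set0 : set Q).
Proof. by split=> [L a b _ _ _ _ []|a b []]. Qed.

(** This is where nondegeneracy enters. *)
Lemma closed0 : closed (set0 : set Q).
Proof.
move=> x h; have [_ nd _ _ _] := polQ; have [b nxb] := nd x.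
by exfalso; apply: nxb; apply: h => a [].
Qed.

Lemma biperp1 x y : perp (perp [set x]) y -> y = x.
Proof.
move=> h; have x0 : perp set0 x by move=> a [].
have [] // := biperp_cone strong0 closed0 x0 id (y := y).
- by rewrite set0U.
- by move=> [w [L [w0 _ _]]]; case: w0.
Qed.

(** Any line through p and another point of {p, q}^perp^perp meets
    q^perp^perp, which is the point q alone. *)
Lemma biperp2_line p q y L : p <> q -> collinear p q ->
    perp (perp ([set p] `|` [set q])) y -> y <> p ->
  lines Q L -> L p -> L y -> L q.
Proof.
move=> npq pq ppy nyp LL Lp Ly.
have [t qt ntp] : exists2 t, perp [set q] t & ~ collinear t p.
  apply: contrapT => h; apply: npq; apply: (@biperp1 q p) => t qt.
  by apply: coll_sym; apply: contrapT => ntp; apply: h; exists t.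
have [] := @biperp_step [set q] p y L t LL Lp Ly (fun e => nyp (esym e)) _ _ _ qt ntp.
- by move=> b ->.
- move=> b ->; apply: ppy => a [->|->]; [exact: coll_sym|exact: coll_refl].
- by move=> s qs sp; apply/coll_sym/ppy => a [->|->] //; apply: qs.
- by move=> w Lw /biperp1 <-.
Qed.

Lemma line_biperp p q L : p <> q -> lines Q L -> L p -> L q ->
  L `<=` perp (perp ([set p] `|` [set q])).
Proof.
move=> npq LL Lp Lq y Ly s sP; apply: coll_sym.
by apply: (coll_two LL Lp Lq npq _ _ Ly); apply: sP; [left|right].
Qed.

(** If a is a third point of M, then {p, a}^perp = {p, q}^perp, because
    both are the perp of M; as L joins p to a point of {p, a}^perp^perp,
    it contains a. *)
Lemma line_unique p q L M : p <> q -> lines Q L -> lines Q M ->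
  L p -> L q -> M p -> M q -> L = M.
Proof.
wlog suff sub : L M / p <> q -> lines Q L -> lines Q M -> L p -> L q -> M p -> M q -> M `<=` L.
  by move=> *; apply/seteqP; split; apply: sub.
move=> npq LL LM Lp Lq Mp Mq a Ma; apply: contrapT => nLa.
have npa : p <> a by move=> e; apply: nLa; rewrite -e.
have nqa : q <> a by move=> e; apply: nLa; rewrite -e.
apply: nLa; apply: (@biperp2_line p a q L) => //; last by move=> e; apply: npq.
- exact: (coll_line LM).
- exact: (line_biperp npa LM Mp Ma).
Qed.

Lemma line_subspace L : lines Q L -> subspace L.
Proof. by move=> LL M a b LM Ma Mb nab La Lb; rewrite (line_unique nab LM LL). Qed.

(** The rank of a strong subspace, as the length of a sequence of points each of which
    is outside the span of its predecessors. *)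
Inductive rk : nat -> set Q -> Prop :=
| rk0 : rk 0 set0
| rkS n X x : rk n X -> perp X x -> ~ X x -> rk n.+1 (X <+ x).

Lemma rk_strong_closed n X : rk n X -> strong X /\ closed X.
Proof.
elim=> [|{}n {}X x _ [sX cX] Xx nXx]; first by split; [exact: strong0|exact: closed0].
by split; [exact: join1_strong|exact: join1_closed].
Qed.

Lemma rk_strong n X : rk n X -> strong X. Proof. by case/rk_strong_closed. Qed.
Lemma rk_subspace n X : rk n X -> subspace X. Proof. by case/rk_strong. Qed.
Lemma rk_closed n X : rk n X -> closed X. Proof. by case/rk_strong_closed. Qed.

Lemma rk_cone n X x y : rk n X -> perp X x -> ~ X x -> (X <+ x) y ->
  y = x \/ exists w L, [/\ X w, lines Q L & [/\ L x, L w & L y]].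
Proof. by case/rk_strong_closed => sX cX; exact: join1_cone. Qed.

(** The exchange property, immediate from the description of X <+ x as a cone. *)
Lemma join1_exchange n X x y : rk n X -> perp X x -> ~ X x -> (X <+ x) y -> ~ X y ->
  X <+ y = X <+ x.
Proof.
move=> rX Xx nXx xy nXy; apply/seteqP; split; apply: join1_min => //;
  try exact: join1_subspace; try exact: join1_sub.
case: (rk_cone rX Xx nXx xy) => [<-|[w [L [Xw LL [Lx Lw Ly]]]]]; first exact: join1_in.
by apply: (cone_join1 Xw _ LL) => // e; apply: nXy; rewrite -e.
Qed.

Lemma rk_perp n X : rk n X -> X `<=` perp X.
Proof. by move=> /rk_strong/strong_perp. Qed.

Lemma hyp_meet n X x L : rk n X -> perp X x -> ~ X x -> lines Q L -> L `<=` X <+ x ->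
  exists2 w, L w & X w.
Proof.
move=> rX Xx nXx LL sL; have [p [Lp _ _]] := line_third x x LL.
have [Xp|nXp] := EM (X p); first by exists p.
have [q [Lq nqp _]] := line_third p p LL.
have e := join1_exchange rX Xx nXx (sL p Lp) nXp.
have Xp : perp X p.
  move=> a Xa; have sX := join1_strong (rk_strong rX) Xx.
  by apply: (strong_perp sX); [apply: sL|apply: join1_sub].
have : (X <+ p) q by rewrite e; apply: sL.
case/(rk_cone rX Xp nXp) => [//|[w [M [Xw LM [Mp Mw Mq]]]]].
by exists w => //; rewrite (@line_unique p q L M) // => ?; apply: nqp.
Qed.

(** [K] behaves like a hyperplane of the projective space [X], possibly equal to it. *)
Definition blocks K X := forall L, lines Q L -> L `<=` X -> exists2 w, L w & K w.

Lemma line_in X a b : strong X -> X a -> X b -> a <> b ->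
  exists L, [/\ lines Q L, L a, L b & L `<=` X].
Proof.
move=> [SX cX] Xa Xb nab; have [//|[L [LL La Lb]]] := cX a b Xa Xb.
by exists L; split=> //; apply: SX Xa Xb.
Qed.

(** A line of X through b and y meets K, so y is on a line from b to a point of X in K.
    Applied to hyperplanes, to perps of points and to H. *)
Lemma strong_section X K b : strong X -> subspace K -> blocks K X -> X b -> ~ K b ->
  X = (X `&` K) <+ b.
Proof.
move=> sX SK bK Xb nKb; apply/seteqP; split; last first.
  by apply: join1_min; [case: sX|move=> x []|].
move=> y Xy; have [->|nyb] := EM (y = b); first exact: join1_in.
have [L [LL Lb Ly sL]] := line_in sX Xb Xy (fun e => nyb (esym e)).
have [w Lw Kw] := bK L LL sL.
apply: (cone_join1 (w := w) _ _ LL) => //; first by split=> //; exact: sL.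
by move=> e; apply: nKb; rewrite -e.
Qed.

Lemma rk_sub n X Y : rk n X -> subspace Y -> Y `<=` X ->
  exists p, [/\ (p <= n)%N, rk p Y & p = n -> Y = X].
Proof.
move=> rX; elim: rX Y => [|{}n {}X x rX IH Xx nXx] Y SY sYX.
  have -> : Y = set0 by apply/seteqP; split.
  by exists 0%N; split=> //; exact: rk0.
have [sYX'|/nonsubset[b [Yb nXb]]] := EM (Y `<=` X).
  by have [p [lp rY _]] := IH Y SY sYX'; exists p; split=> //; [exact: leqW|move=> e; move: lp; rewrite e ltnn].
have e := join1_exchange rX Xx nXx (sYX b Yb) nXb.
have sXx := join1_strong (rk_strong rX) Xx.
have sY : strong Y by split=> // a c Ya Yc; case: sXx => _; apply; apply: sYX.
have eY : Y = (Y `&` X) <+ b.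
  apply: strong_section => //; first exact: rk_subspace rX.
  by move=> L LL sL; apply: (hyp_meet rX Xx nXx LL) => z /sL/sYX.
have [p [lp rY h]] := IH (Y `&` X) (subspaceI SY (rk_subspace rX)) (@subIsetr _ Y X).
exists p.+1; split=> //.
- rewrite eY; apply: rkS => //; last by case.
  by move=> a [Ya _]; apply: (strong_perp sY).
- by move=> [/h e']; rewrite eY e' e.
Qed.

(** Two hyperplanes of X of ranks n and q have a common hyperplane of rank k by
    [strong_section], and induction gives n = k + 1 = q. *)
Lemma rk_inj n p X : rk n X -> rk p X -> n = p.
Proof.
elim: n p X => [|n IH] p X rX rX'.
  inversion rX; subst X; inversion rX' as [|q Y y rY _ nYy e1 e2] => //.
  by exfalso; have : (Y <+ y) y := @join1_in _ Y y; rewrite e2.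
inversion rX as [|n' X1 x r1 Xx1 nXx1 e1 e2]; subst n' X.
inversion rX' as [e1 e2|q X2 y r2 Xy2 nXy2 e1 e2].
  by exfalso; have : (X1 <+ x) x := @join1_in _ X1 x; rewrite -e2.
subst p; congr S.
have [e|ne] := EM (X2 = X1); first by apply: IH r1 _; rewrite -e.
have sX := rk_strong rX.
have s1 : X1 `<=` X1 <+ x by exact: join1_sub.
have s2 : X2 `<=` X1 <+ x by rewrite -e2; exact: join1_sub.
have max1 : ~ X2 `<=` X1.
  move=> s21; apply: ne; apply/seteqP; split=> // b X1b; apply: contrapT => nX2b.
  have e := join1_exchange r2 Xy2 nXy2 (_ : (X2 <+ y) b) nX2b.
  apply: nXx1; have : (X2 <+ b) x by rewrite e ?e2; [exact: join1_in|exact: s1].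
  by apply: join1_min => //; exact: rk_subspace r1.
have max2 : ~ X1 `<=` X2.
  move=> s12; apply: ne; apply/seteqP; split=> // b X2b; apply: contrapT => nX1b.
  have e := join1_exchange r1 Xx1 nXx1 (s2 b X2b) nX1b.
  apply: nXy2; have : (X1 <+ b) y by rewrite e -e2; exact: join1_in.
  by apply: join1_min => //; exact: rk_subspace r2.
have [b [X2b nX1b]] := nonsubset max1; have [c [X1c nX2c]] := nonsubset max2.
have E2 : X2 = (X2 `&` X1) <+ b.
  apply: strong_section (rk_strong r2) (rk_subspace r1) _ X2b nX1b.
  by move=> L LL sL; apply: (hyp_meet r1 Xx1 nXx1 LL) => z /sL/s2.
have E1 : X1 = (X1 `&` X2) <+ c.
  apply: strong_section (rk_strong r1) (rk_subspace r2) _ X1c nX2c.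
  by move=> L LL sL; apply: (hyp_meet r2 Xy2 nXy2 LL) => z /sL/s1; rewrite e2.
have [k [_ rk' _]] := rk_sub r1 (subspaceI (rk_subspace r1) (rk_subspace r2)) (@subIsetl _ X1 X2).
have r1' : rk k.+1 X1.
  rewrite E1; apply: rkS => //; last by case.
  by move=> a [Xa _]; apply: (rk_perp r1).
have r2' : rk k.+1 X2.
  rewrite E2; apply: rkS; rewrite 1?setIC //; last by case.
  by move=> a [_ Xa]; apply: (rk_perp r2).
by have ek := IH _ _ r1 r1'; rewrite -ek in r2'; exact: IH r2' r2.
Qed.

Lemma rk0_eq X : rk 0 X -> X = set0. Proof. by inversion 1. Qed.

Lemma rk_leq p n X Y : rk p Y -> rk n X -> Y `<=` X -> (p <= n)%N.
Proof.
move=> rY rX sYX; have [q [lq rq _]] := rk_sub rX (rk_subspace rY) sYX.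
by rewrite (rk_inj rY rq).
Qed.

Lemma rk_eq n X Y : rk n Y -> rk n X -> Y `<=` X -> Y = X.
Proof.
move=> rY rX sYX; have [q [_ rq]] := rk_sub rX (rk_subspace rY) sYX.
by apply; rewrite (rk_inj rY rq).
Qed.

Lemma rk_section n X K b : rk n.+1 X -> subspace K -> blocks K X -> X b -> ~ K b ->
  rk n (X `&` K) /\ X = (X `&` K) <+ b.
Proof.
move=> rX SK bK Xb nKb; have e := strong_section (rk_strong rX) SK bK Xb nKb; split=> //.
have [p [_ rp _]] := rk_sub rX (subspaceI (rk_subspace rX) SK) (@subIsetl _ X K).
suff : rk p.+1 X by move=> /(rk_inj rX)[->].
rewrite e; apply: rkS => //; last by case.
by move=> a [Xa _]; apply: (rk_perp rX).
Qed.

Lemma blocks_sub K X Y : Y `<=` X -> blocks K X -> blocks K Y.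
Proof. by move=> sYX bK L LL sL; apply: bK => // z /sL/sYX. Qed.

Lemma blocks_perp a X : blocks (perp [set a]) X.
Proof.
move=> L LL _; have [w Lw aw] := line_meet a LL.
by exists w => // b ->; exact: coll_sym.
Qed.

Lemma rk_lt_nonsub p n X Y : rk p X -> rk n Y -> (p < n)%N -> exists2 y, Y y & ~ X y.
Proof.
move=> rX rY ltpn; have /nonsubset[y [Yy nXy]] : ~ Y `<=` X by move=> /(rk_leq rY rX); rewrite leqNgt ltpn.
by exists y.
Qed.

Lemma rk_sub_perp n X Y : rk n Y -> X `<=` Y -> Y `<=` perp X.
Proof. by move=> rY sXY y Yy x /sXY; apply: (rk_perp rY). Qed.

Lemma rk_cover n Z K b : rk n K -> rk n.+1 Z -> K `<=` Z -> Z b -> ~ K b -> Z = K <+ b.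
Proof.
move=> rK rZ sKZ Zb nKb; apply/esym/(@rk_eq n.+1) => //.
- by apply: rkS => //; exact: (rk_sub_perp rZ sKZ).
- by apply: join1_min => //; exact: rk_subspace rZ.
Qed.

Lemma blocks_hyp n Z K : rk n K -> rk n.+1 Z -> K `<=` Z -> blocks K Z.
Proof.
move=> rK rZ sKZ; have [b Zb nKb] := rk_lt_nonsub rK rZ (ltnSn n).
rewrite (rk_cover rK rZ sKZ Zb nKb) => L LL; apply: (hyp_meet rK _ nKb LL).
exact: (rk_sub_perp rZ sKZ).
Qed.

Lemma rk_meet n Z K K' : rk n.+1 K -> rk n.+1 K' -> rk n.+2 Z -> K `<=` Z -> K' `<=` Z ->
  K <> K' -> rk n (K `&` K').
Proof.
move=> rK rK' rZ sK sK' ne.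
have /nonsubset[b [Kb nKb]] : ~ K `<=` K' by move=> /(rk_eq rK rK').
by have [] := rk_section rK (rk_subspace rK') (blocks_sub sK (blocks_hyp rK' rZ sK')) Kb nKb.
Qed.

Lemma rk_between p q n X Y : rk p X -> rk n Y -> X `<=` Y -> (p <= q <= n)%N ->
  exists Z, [/\ rk q Z, X `<=` Z & Z `<=` Y].
Proof.
move=> rX rY sXY /andP[pq]; elim: q pq => [|q IH].
  by rewrite leqn0 => /eqP p0 _; exists X; split=> //; move: rX; rewrite p0.
rewrite leq_eqVlt => /predU1P[<- _|lpq lqn]; first by exists X; split.
have [Z [rZ sXZ sZY]] := IH lpq (ltnW lqn).
have [y Yy nZy] := rk_lt_nonsub rZ rY lqn.
exists (Z <+ y); split.
- by apply: rkS => //; exact: (rk_sub_perp rY sZY).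
- by move=> x /sXZ; exact: join1_sub.
- by apply: join1_min => //; exact: rk_subspace rY.
Qed.

Lemma perp_singleton a x : perp [set a] x <-> collinear x a.
Proof. by split=> [|h b ->//]; apply. Qed.

(** Each point added to X cuts at most one dimension from the part of M that is
    perpendicular to X, and none if the point can be chosen in M. *)
Lemma rk_perp_count n r X M : rk n X -> rk r M ->
  exists p q, [/\ rk p (X `&` M), rk q (M `&` perp X) & (r + p <= q + n)%N].
Proof.
move=> rX rM; elim: rX => [|{}n {}X x rX [p [q [rp rq le]]] Xx nXx].
  exists 0%N, r; split=> //; first by rewrite set0I; exact: rk0.
  by rewrite (_ : perp set0 = setT) ?setIT //; apply/seteqP; split=> // y _ a [].
have sXx := join1_strong (rk_strong rX) Xx.
have rXx := rkS rX Xx nXx.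
have [[z [Xz Mz nXz]]|none] := EM (exists z, [/\ (X <+ x) z, M z & ~ X z]).
  have e := join1_exchange rX Xx nXx Xz nXz.
  exists p.+1, q; split.
  - have -> : (X <+ x) `&` M = (X `&` M) <+ z.
      have -> : X `&` M = ((X <+ x) `&` M) `&` X.
        apply/seteqP; split=> y; first by move=> [Xy My]; split=> //; split=> //; exact: join1_sub.
        by move=> [[_ My] Xy].
      apply: strong_section => //.
      + split; first by apply: subspaceI; [case: sXx|exact: rk_subspace rM].
        by move=> a b [Xa _] [Xb _]; case: sXx => _; apply.
      + exact: rk_subspace rX.
      + by move=> L LL sL; apply: (hyp_meet rX Xx nXx LL) => y /sL[].
    apply: rkS => //; last by case.
    by move=> a [Xa Ma]; apply: (rk_perp rM).
  - rewrite (_ : M `&` perp (X <+ x) = M `&` perp X) //.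
    apply/seteqP; split=> y [My Xy]; split=> //; first by move=> a Xa; apply: Xy; exact: join1_sub.
    by rewrite -e; apply/perp_join1; split=> //; apply: (rk_perp rM).
  - by rewrite !addnS.
have eM : (X <+ x) `&` M = X `&` M.
  apply/seteqP; split=> y [Xy My]; split=> //; last exact: join1_sub.
  by apply: contrapT => nXy; apply: none; exists y.
rewrite eM; have -> : M `&` perp (X <+ x) = (M `&` perp X) `&` perp [set x].
  apply/seteqP; split=> y; first by move=> [My /perp_join1[? ?]]; split=> //; apply/perp_singleton.
  by move=> [[My Xy] /perp_singleton yx]; split=> //; apply/perp_join1.
have [sK|/nonsubset[b [Wb nb]]] := EM (M `&` perp X `<=` perp [set x]).
  by exists p, q; rewrite (setIidl sK); split=> //; rewrite addnS leqW.
case: q rq le => [|q] rq le.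
  by move: Wb; rewrite (rk0_eq rq).
have [rq' _] := rk_section rq (@perp_subspace _) (@blocks_perp x _) Wb nb.
by exists p, q; split=> //; rewrite addnS -addSn.
Qed.

Lemma generated_rk n (f : 'I_n -> Q) : [set f i | i in setT] `<=` perp [set f i | i in setT] ->
  exists2 p, (p <= n)%N & rk p (span [set f i | i in setT]).
Proof.
elim: n f => [|n IH] f.
  move=> _; exists 0%N => //; rewrite (_ : [set f i | i in setT] = set0).
    by rewrite span_id; [exact: rk0|exact: (strong0).1].
  by apply/seteqP; split=> // x [[]].
set A := [set f i | i in setT] => clA.
set B := [set f (widen_ord (leqnSn n) i) | i in setT].
have eA : A = B `|` [set f ord_max].
  apply/seteqP; split=> x.
  - move=> [i _ <-]; case: (ltnP i n) => [lin|lni].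
      by left; exists (Ordinal lin) => //; congr f; apply: val_inj.
    right; congr f; apply: val_inj; apply/eqP; rewrite eqn_leq lni andbT -ltnS; exact: ltn_ord.
  - by move=> [[i _ <-]|->]; [exists (widen_ord (leqnSn n) i)|exists ord_max].
have sBA : B `<=` A by rewrite eA; left.
have clB : B `<=` perp B by move=> x /sBA/clA xA y /sBA; exact: xA.
have [p lp rp] := IH _ clB; rewrite -/B in rp.
have -> : span A = span B <+ f ord_max.
  rewrite eA; apply/seteqP; split.
    apply: span_min => [|x [Bx|->]]; [exact: join1_subspace|by apply: join1_sub; apply: sub_span|exact: join1_in].
  apply: join1_min; [exact: span_subspace|by apply: spanS; left|by apply: sub_span; right].
have [Bf|nBf] := EM (span B (f ord_max)).
  exists p; first exact: leqW.
  rewrite (_ : span B <+ _ = span B) //; apply/seteqP; split; last exact: join1_sub.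
  by apply: join1_min => //; exact: span_subspace.
exists p.+1 => //; apply: rkS => //; rewrite perp_span => b /sBA Ab; apply: clA => //.
by exists ord_max.
Qed.

Lemma rk_generated n X : rk n X -> generated_by X n.
Proof.
elim=> [|{}n {}X x rX [f eX] Xx nXx].
  have f : 'I_0 -> Q by case.
  exists f; rewrite (_ : [set f i | i in setT] = set0).
    by rewrite span_id //; exact: (strong0).1.
  by apply/seteqP; split=> // y [[]].
exists (fun i => if unlift ord_max i is Some j then f j else x).
apply/seteqP; split.
- apply: join1_min; first exact: span_subspace.
    rewrite eX; apply: spanS => y [i _ <-]; exists (lift ord_max i) => //.
    by rewrite liftK.
  by apply: sub_span; exists ord_max; rewrite // unlift_none.
- apply: span_min; first exact: join1_subspace.
  move=> y [i _ <-]; case: unliftP => [j _|_]; last exact: join1_in.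
  by apply: join1_sub; rewrite eX; apply: sub_span; exists j.
Qed.

Lemma has_dim_rk X (d : int) : strong X ->
  has_dim X d <-> exists2 n : nat, d = (Posz n - 1)%R & rk n X.
Proof.
move=> sX; have gen j : generated_by X j -> exists2 p, (p <= j)%N & rk p X.
  move=> [f eX]; have [|p lp rp] := generated_rk (f := f); last by exists p => //; rewrite eX.
  by move=> a Aa b Ab; case: sX => _; apply; rewrite eX; exact: sub_span.
split=> [[n [-> gn mn]]|[n -> rX]]; last first.
  exists n; split=> //; first exact: rk_generated.
  by move=> j /gen[p lp rp]; rewrite (rk_inj rX rp).
exists n => //; have [p lp rp] := gen n gn.
have := mn p (rk_generated rp) => lnp.
by rewrite (_ : n = p) //; apply/eqP; rewrite eqn_leq lnp.
Qed.

Lemma StrongSub_rk n X : StrongSub (Posz n.+1 - 1)%R X <-> rk n.+1 X.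
Proof.
split=> [[sX /(has_dim_rk _ sX)[p e rp]]|rX].
  have e' : Posz p = Posz n.+1 by apply: (@GRing.addIr _ (-1)%R).
  by case: e' rp => ->.
by split; [exact: rk_strong rX|apply/has_dim_rk; [exact: rk_strong rX|exists n.+1]].
Qed.

Lemma strong_rk X : strong X -> exists2 n, (n <= m.+1)%N & rk n X.
Proof.
move=> sX; have [_ _ _ _ /(_ X sX)[d ld /(has_dim_rk _ sX)[n e rX]]] := polQ.
by exists n => //; move: ld; rewrite e; lia.
Qed.

Lemma max_rk : exists M, rk m.+1 M.
Proof.
have [_ _ _ [X [sX /(has_dim_rk _ sX)[n e rX]]] _] := polQ.
by exists X; rewrite (_ : m.+1 = n) //; lia.
Qed.

(** All maximal strong subspaces have rank m + 1: with M of that rank, the part of M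
    perpendicular to X is too large to lie in X. *)
Lemma perp_extra n X : rk n X -> (n <= m)%N -> exists2 y, perp X y & ~ X y.
Proof.
move=> rX lnm; have [M rM] := max_rk.
have [p [q [rp rq le]]] := rk_perp_count rX rM.
have ltpq : (p < q)%N by lia.
have [y [My Xy] ny] := rk_lt_nonsub rp rq ltpq.
by exists y => // Xy'; apply: ny.
Qed.

(** Nondegeneracy of the residue of X. *)
Lemma perp_witness n X y : rk n X -> ~ X y -> exists2 d, perp X d & ~ collinear d y.
Proof.
move=> rX nXy; apply: contrapT => h; apply/nXy/(rk_closed rX) => d Xd.
by apply: coll_sym; apply: contrapT => ndy; apply: h; exists d.
Qed.

Lemma rk1 x : rk 1 [set x].
Proof.
have -> : [set x] = set0 <+ x.
  rewrite /join1 set0U span_id // => L a b LL La Lb nab ax bx.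
  by case: nab; rewrite ax bx.
by apply: rkS => //; exact: rk0.
Qed.

Lemma max_perp M x : rk m.+1 M -> perp M x -> M x.
Proof.
move=> rM Mx; apply: contrapT => nMx; have rMx := rkS rM Mx nMx.
have [n ln rn] := strong_rk (rk_strong rMx).
by move: ln; rewrite -(rk_inj rMx rn) ltnn.
Qed.

Lemma rk1_ex (X : set Q) : rk 1 X -> exists x, X = [set x].
Proof.
move=> rX; have [x Xx _] := rk_lt_nonsub rk0 rX isT.
exists x; apply/esym/(rk_eq (rk1 x) rX) => y ->; exact: Xx.
Qed.

Lemma rk2_line (L : set Q) : lines Q L <-> rk 2 L.
Proof.
have lineE (M : set Q) x y : lines Q M -> M x -> M y -> x <> y -> [set x] <+ y = M.
  move=> LM Mx My nxy; apply/seteqP; split.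
    apply: join1_min => [|z ->|] //; first exact: (line_subspace LM).
  by apply: (join1_subspace LM Mx My nxy); [apply: join1_sub|exact: join1_in].
split=> [LL|rL].
  have [[a [b [_ [[La Lb _] [nab _ _]]]]] _] : (exists a b c, [/\ L a, L b & L c] /\
    [/\ a <> b, b <> c & a <> c]) /\ True by case: polQ => h _ _ _ _; split=> //; apply: h.
  rewrite -(lineE L a b LL La Lb nab); apply: rkS; first exact: rk1.
  - by move=> x ->; exact: (coll_line LL Lb La).
  - by move=> e; apply: nab.
have [X [rX _ XL]] := rk_between rk0 rL (@sub0set _ _) (isT : (0 <= 1 <= 2)%N).
have [x eX] := rk1_ex rX.
have Lx : L x by apply: XL; rewrite eX.
have [y Ly nxy] := rk_lt_nonsub (rk1 x) rL isT.
have nxy' : x <> y by move=> e; apply: nxy.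
have [M [LM Mx My sM]] := line_in (rk_strong rL) Lx Ly nxy'.
by rewrite -(rk_eq _ rL sM) // -(lineE M x y) //; apply: rkS;
  [exact: rk1|move=> z ->; exact: (coll_line LM My Mx)|move=> e; apply: nxy'].
Qed.

End Geometry.

Variable H : set Q.
Hypothesis hypH : hyperplane H.

(** * Strong subspaces outside the hyperplane *)
Section Affine.
Implicit Types (a b c d x y z s t w : Q) (A B C D F S X Y Z K L M : set Q).

(** These are the subspaces of dimension n - 1 of the affine polar space, represented by
    the strong subspaces that they come from. *)
Definition visible n X := rk n X /\ exists2 x, X x & ~ H x.

Lemma H_subspace : subspace H. Proof. by case: hypH. Qed.

Lemma H_blocks X : blocks H X.
Proof. by move=> L LL _; have [_ _ /(_ L LL)[w [Lw Hw]]] := hypH; exists w. Qed.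

Lemma visible_sup n p X Y : visible n X -> rk p Y -> X `<=` Y -> visible p Y.
Proof. by move=> [_ [x Xx nHx]] rY sXY; split=> //; exists x => //; apply: sXY. Qed.

Lemma visible_notH n X : visible n X -> ~ X `<=` H.
Proof. by move=> [_ [x Xx nHx]] sXH; apply/nHx/sXH. Qed.

Lemma visible_section n X x : rk n.+1 X -> X x -> ~ H x ->
  rk n (X `&` H) /\ X = (X `&` H) <+ x.
Proof. move=> rX Xx nHx; exact: rk_section rX H_subspace (@H_blocks X) Xx nHx. Qed.

Lemma visible_rkH n X : visible n.+1 X -> rk n (X `&` H).
Proof. by move=> [rX [x Xx nHx]]; have [] := visible_section rX Xx nHx. Qed.

Lemma good0 X : ~ visible 0 X.
Proof. by move=> [/rk0_eq-> [x []]]. Qed.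

(** A visible subspace is determined by its points in H and one point outside
    H.  This replaces most dimension counts below. *)
Lemma visible_joinH n X x : visible n X -> X x -> ~ H x -> X = (X `&` H) <+ x.
Proof. by case: n => [/good0//|n] [rX _] Xx nHx; have [] := visible_section rX Xx nHx. Qed.

(** A line has at least three points, so a projective space is not the union of
    two proper subspaces. *)
Lemma visible_off n X K : visible n X -> subspace K -> ~ X `<=` K ->
  exists x, [/\ X x, ~ K x & ~ H x].
Proof.
move=> [rX [x Xx nHx]] SK /nonsubset[y [Xy nKy]].
have [Kx|nKx] := EM (K x); last by exists x.
have [Hy|nHy] := EM (H y); last by exists y.
have nxy : x <> y by move=> e; apply: nKy; rewrite -e.
have [L [LL Lx Ly sL]] := line_in (rk_strong rX) Xx Xy nxy.
have [z [Lz nzx nzy]] := line_third x y LL.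
exists z; split; first exact: sL.
- by move=> Kz; apply: nKy; apply: (SK L x z) => //; apply: nesym.
- by move=> Hz; apply: nHx; apply: (H_subspace LL Ly Lz) => //; apply: nesym.
Qed.

Lemma visible_sub n X S : visible n X -> subspace S -> (forall x, X x -> ~ H x -> S x) -> X `<=` S.
Proof.
move=> gX SS h; apply: contrapT => ns.
by have [x [Xx nSx nHx]] := visible_off gX SS ns; apply/nSx/h.
Qed.

Lemma rk_extend n p X : rk n X -> (n <= p <= m.+1)%N -> exists2 Y, rk p Y & X `<=` Y.
Proof.
move=> rX /andP[]; elim: p => [|p IH].
  by rewrite leqn0 => /eqP n0 _; exists X => //; move: rX; rewrite n0.
rewrite leq_eqVlt => /predU1P[<- _|lnp lpm]; first by exists X.
have [Y rY sXY] := IH lnp (ltnW lpm).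
have [y Yy nYy] := perp_extra rY lpm.
by exists (Y <+ y); [exact: rkS|move=> x /sXY; exact: join1_sub].
Qed.

Lemma visible_extend n p X : visible n X -> (n <= p <= m.+1)%N -> exists2 Y, visible p Y & X `<=` Y.
Proof.
move=> gX le; have [Y rY sXY] := rk_extend gX.1 le.
by exists Y => //; exact: visible_sup gX rY sXY.
Qed.

Lemma perp_pair n X : rk n X -> (n <= m)%N ->
  exists d e, [/\ perp X d, perp X e, ~ X d, ~ X e & ~ collinear d e].
Proof.
move=> rX lnm; have [e Xe nXe] := perp_extra rX lnm.
have [d Xd nde] := perp_witness rX nXe.
by exists d, e; split=> // X_d; apply: nde; apply/coll_sym/Xe.
Qed.

Lemma visible_parts n X p : visible n X -> (0 < p <= n)%N -> exists2 Y, visible p Y & Y `<=` X.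
Proof.
move=> gX lp; have [x Xx nHx] := gX.2.
have xX : [set x] `<=` X by move=> y ->.
have [Y [rY sY sYX]] := rk_between (rk1 x) gX.1 xX lp.
by exists Y => //; split=> //; exists x => //; apply: sY.
Qed.

Lemma rk_joinIn n p X Y x : rk n X -> rk p Y -> X `<=` Y -> Y x -> ~ X x ->
  rk n.+1 (X <+ x) /\ X <+ x `<=` Y.
Proof.
move=> rX rY sXY Yx nXx; split; last by apply: join1_min => //; exact: rk_subspace rY.
by apply: rkS => //; exact: (rk_sub_perp rY sXY).
Qed.

Lemma pencil2 n F A : rk n F -> rk n.+2 A -> F `<=` A ->
  exists C D, [/\ rk n.+1 C, rk n.+1 D, C <> D & [/\ F `<=` C, C `<=` A, F `<=` D & D `<=` A]].
Proof.
move=> rF rA sFA; have [a Aa nFa] := rk_lt_nonsub rF rA (ltnW (ltnSn n.+1)).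
have [rC sCA] := rk_joinIn rF rA sFA Aa nFa.
have [b Ab nCb] := rk_lt_nonsub rC rA (ltnSn n.+1).
have nFb : ~ F b by move=> Fb; apply: nCb; exact: join1_sub.
have [rD sDA] := rk_joinIn rF rA sFA Ab nFb.
exists (F <+ a), (F <+ b); split=> //; last by split=> //; exact: join1_sub.
by move=> e; apply: nCb; rewrite e; exact: join1_in.
Qed.

Lemma pencil3 n F A C X : rk n F -> rk n.+2 A -> rk n.+1 C -> rk n.+1 X -> C <> X ->
    F `<=` C -> F `<=` X -> C `<=` A -> X `<=` A ->
  exists Y, [/\ rk n.+1 Y, Y <> C, Y <> X, F `<=` Y & Y `<=` A].
Proof.
move=> rF rA rC rX ne FC FX CA XA.
have /nonsubset[c [Cc nXc]] : ~ C `<=` X by move=> /(rk_eq rC rX).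
have /nonsubset[x [Xx nCx]] : ~ X `<=` C by move=> /(rk_eq rX rC)/esym.
have nxc : x <> c by move=> e; apply: nCx; rewrite e.
have [L [LL Lx Lc sL]] := line_in (rk_strong rA) (XA _ Xx) (CA _ Cc) nxc.
have [y [Ly nyx nyc]] := line_third x c LL.
have nCy : ~ C y.
  by move=> Cy; apply: nCx; apply: (rk_subspace rC LL Ly Lc).
have nXy : ~ X y.
  by move=> Xy; apply: nXc; apply: (rk_subspace rX LL Ly Lx).
have nFy : ~ F y by move=> /FC.
have [rY sYA] := rk_joinIn rF rA (subset_trans FC CA) (sL _ Ly) nFy.
exists (F <+ y); split=> //; last exact: join1_sub.
- by move=> e; apply: nCy; rewrite -e; exact: join1_in.
- by move=> e; apply: nXy; rewrite -e; exact: join1_in.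
Qed.

(** The traces X `&` H represent parallel classes; parallel subspaces with a
    common affine point are equal. *)
Lemma trace_eq n X Y x : visible n X -> visible n Y -> X `&` H = Y `&` H -> X x -> Y x -> ~ H x -> X = Y.
Proof.
by move=> gX gY e Xx Yx nHx; rewrite (visible_joinH gX Xx nHx) (visible_joinH gY Yx nHx) e.
Qed.

Lemma nonpar_meet n A C D : rk n.+2 A -> visible n.+1 C -> visible n.+1 D -> C `<=` A -> D `<=` A ->
  C `&` H <> D `&` H -> C <> D /\ visible n (C `&` D).
Proof.
move=> rA gC gD CA DA ne; have nCD : C <> D by move=> e; apply: ne; rewrite e.
case: n rA gC gD => [|n] rA gC gD.
  by case: ne; rewrite (rk0_eq (visible_rkH gC)) (rk0_eq (visible_rkH gD)).
have rI := rk_meet gC.1 gD.1 rA CA DA nCD.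
split=> //; split=> //; apply: contrapT => none; apply: ne.
have sI : C `&` D `<=` H by move=> x Ix; apply: contrapT => nHx; apply: none; exists x.
have e1 : C `&` D = C `&` H.
  by apply: (rk_eq rI (visible_rkH gC)) => x [Cx Dx]; split=> //; apply: sI.
rewrite -e1; apply: (rk_eq rI (visible_rkH gD)) => x [Cx Dx]; split=> //; exact: sI.
Qed.

Lemma par_meet n A C D : rk n.+2 A -> visible n.+1 C -> visible n.+1 D -> C `<=` A -> D `<=` A ->
  C <> D -> C `&` H = D `&` H -> C `&` D `<=` H.
Proof.
move=> rA gC gD CA DA nCD e x [Cx Dx]; apply: contrapT => nHx.
exact/nCD/(trace_eq gC gD e Cx Dx).
Qed.

Lemma visible_trace_eq n X G : visible n.+1 X -> rk n G -> G `<=` X -> G `<=` H -> X `&` H = G.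
Proof.
move=> gX rG GX GH; apply/esym/(rk_eq rG (visible_rkH gX)) => x Gx; split; [exact: GX|exact: GH].
Qed.

Lemma rk_avoid p q n X Y c : rk p Y -> rk n X -> Y `<=` X -> X c -> ~ Y c -> (p <= q < n)%N ->
  exists Z, [/\ rk q Z, Y `<=` Z, Z `<=` X & ~ Z c].
Proof.
move=> rY rX YX Xc nYc /andP[]; elim: q => [|q IH].
  by rewrite leqn0 => /eqP p0 _; exists Y; split=> //; move: rY; rewrite p0.
rewrite leq_eqVlt => /predU1P[<- _|lpq lqn]; first by exists Y; split.
have [Z [rZ YZ ZX nZc]] := IH lpq (ltnW lqn).
have [rZc ZcX] := rk_joinIn rZ rX ZX Xc nZc.
have [y Xy nZcy] := rk_lt_nonsub rZc rX lqn.
have nZy : ~ Z y by move=> Zy; apply: nZcy; exact: join1_sub.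
have [rZy ZyX] := rk_joinIn rZ rX ZX Xy nZy.
exists (Z <+ y); split=> //; first by move=> x /YZ; exact: join1_sub.
move=> Zyc; apply: nZcy; rewrite (join1_exchange rZ _ nZy Zyc nZc); first exact: join1_in.
exact: (rk_sub_perp rX ZX).
Qed.

Lemma visible_avoid n X c : visible n.+2 X -> X c ->
  exists Z, [/\ visible n.+1 Z, Z `<=` X & ~ Z c].
Proof.
move=> gX Xc; have r1 := rk1 c.
have [a [Xa nac nHa]] : exists a, [/\ X a, ~ [set c] a & ~ H a].
  by apply: (visible_off gX (rk_subspace r1)) => /(rk_leq gX.1 r1).
have aX : [set a] `<=` X by move=> x ->.
have nac' : ~ [set a] c by move=> e; apply: nac.
have ln : (1 <= n.+1 < n.+2)%N by lia.
have [Z [rZ aZ ZX nZc]] := rk_avoid (rk1 a) gX.1 aX Xc nac' ln.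
by exists Z; split=> //; split=> //; exists a => //; apply: aZ.
Qed.

Lemma perp_extra_visible n X : visible n X -> (n <= m)%N -> exists y, [/\ perp X y, ~ X y & ~ H y].
Proof.
move=> gX lnm; have [y Xy nXy] := perp_extra gX.1 lnm.
have [Hy|nHy] := EM (H y); last by exists y.
have [a Xa nHa] := gX.2; have nay : a <> y by move=> e; apply: nXy; rewrite -e.
have [e|[L [LL La Ly]]] := coll_sym (Xy a Xa); first by case: nay.
have [z [Lz nza nzy]] := line_third a y LL; exists z; split.
- by apply: (perp_subspace LL La Ly nay) => //; exact: (rk_perp gX.1).
- by move=> Xz; apply: nXy; apply: (rk_subspace gX.1 LL La Lz (nesym nza)).
- by move=> Hz; apply: nHa; apply: (H_subspace LL Ly Lz (nesym nzy)).
Qed.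

Lemma perp_witness_visible n X x : visible n X -> perp X x -> ~ X x ->
  exists d, [/\ perp X d, ~ H d & ~ collinear d x].
Proof.
move=> gX Xx nXx; have [d Xd ndx] := perp_witness gX.1 nXx.
have [Hd|nHd] := EM (H d); last by exists d.
have [a Xa nHa] := gX.2; have nad : a <> d by move=> e; apply: nHa; rewrite e.
have [e|[L [LL La Ld]]] := coll_sym (Xd a Xa); first by case: nad.
have [z [Lz nza nzd]] := line_third a d LL; exists z; split.
- by apply: (perp_subspace LL La Ld nad) => //; exact: (rk_perp gX.1).
- by move=> Hz; apply: nHa; apply: (H_subspace LL Ld Lz (nesym nzd)).
- move=> zx; apply: ndx; apply: coll_sym.
  by apply: (coll_two LL La Lz (nesym nza)) => //; [exact: Xx|exact: coll_sym].
Qed.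

Lemma inter_cover n F C D : rk n F -> rk n.+1 C -> rk n.+1 D -> F `<=` C -> F `<=` D -> C <> D ->
  C `&` D = F.
Proof.
move=> rF rC rD FC FD ne.
have [p [lp rI eI]] := rk_sub rC (subspaceI (rk_subspace rC) (rk_subspace rD)) (@subIsetl _ C D).
have FI : F `<=` C `&` D by move=> x Fx; split; [exact: FC|exact: FD].
have lnp := rk_leq rF rI FI.
have npn : p <> n.+1.
  by move=> /eI e; apply: ne; apply: (rk_eq rC rD); rewrite -e => x [].
have ep : p = n by lia.
by apply/esym/(rk_eq rF _ FI); rewrite -ep.
Qed.

(** Two points of F^perp that are not collinear exist since the residue of F
    is nondegenerate. *)
Lemma over_pair n F : rk n F -> (n <= m)%N ->
  exists C D, [/\ rk n.+1 C, rk n.+1 D, F `<=` C, F `<=` D & exists x y, [/\ C x, D y & ~ collinear x y]].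
Proof.
move=> rF lnm; have [d [e [Fd Fe nFd nFe nde]]] := perp_pair rF lnm.
exists (F <+ d), (F <+ e); split; try exact: rkS; try exact: join1_sub.
by exists d, e; split=> //; exact: join1_in.
Qed.

(** The usual dichotomy for three subspaces that meet pairwise in
    codimension one: they have a common hyperplane or a common strong span.
    Points c1 of W in U and c2 of W in V outside the meet C of U and V
    generate U and V over C and are collinear, being in W. *)
Lemma triangle n U V W : rk n.+1 U -> rk n.+1 V -> rk n.+1 W ->
    rk n (U `&` V) -> rk n (W `&` U) -> rk n (W `&` V) -> ~ U `&` V `<=` W ->
  exists D, [/\ rk n.+2 D, U `<=` D, V `<=` D & W `<=` D].
Proof.
move=> rU rV rW rC rC1 rC2 nCW.
have WU : W `&` U `<=` U by move=> x [].
have [c1 [[Wc1 Uc1] nC1]] : W `&` U `&` ~` (U `&` V) !=set0.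
  apply: nonsubset => /(rk_eq rC1 rC) e; apply: nCW; rewrite -e => x [] //.
have [c2 [[Wc2 Vc2] nC2]] : W `&` V `&` ~` (U `&` V) !=set0.
  apply: nonsubset => /(rk_eq rC2 rC) e; apply: nCW; rewrite -e => x [] //.
have nVc1 : ~ V c1 by move=> Vc1; apply: nC1.
have eU := rk_cover rC rU (@subIsetl _ U V) Uc1 nC1.
have eV := rk_cover rC rV (@subIsetr _ U V) Vc2 nC2.
have Vp : perp V c1.
  rewrite eV; apply/perp_join1; split; first exact: (rk_sub_perp rU (@subIsetl _ U V)).
  by case: (rk_strong rW) => _; apply.
have eW := rk_cover rC2 rW (@subIsetl _ W V) Wc1 (fun h => nVc1 h.2).
exists (V <+ c1); split.
- exact: rkS.
- rewrite {1}eU; apply: join1_min; [exact: join1_subspace|by move=> x [_ Vx]; exact: join1_sub|exact: join1_in].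
- exact: join1_sub.
- rewrite {1}eW; apply: join1_min; [exact: join1_subspace|by move=> x [_ Vx]; exact: join1_sub|exact: join1_in].
Qed.

Lemma rk_join_eq n U V D D' : rk n.+1 U -> rk n.+1 V -> U <> V -> rk n.+2 D -> U `<=` D -> V `<=` D ->
  rk n.+2 D' -> U `<=` D' -> V `<=` D' -> D = D'.
Proof.
move=> rU rV ne rD UD VD rD' UD' VD'.
have /nonsubset[v [Vv nUv]] : ~ V `<=` U by move=> /(rk_eq rV rU)/esym.
by rewrite (rk_cover rU rD UD (VD _ Vv) nUv) (rk_cover rU rD' UD' (VD' _ Vv) nUv).
Qed.

(** The meet F of A and A' contains the meet of C and C', so its rank is n or n + 1.
    In the latter case F is the trace of both A and A' in H, and one collinear
    pair of affine points makes A and A' perpendicular; then C0 is joined to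
    the hyperplane of A' with the same trace in H. *)
Lemma cross_rank n A A' B C C' C0 : visible n.+2 A -> visible n.+2 A' ->
    (forall D, visible n.+1 D -> D `<=` A -> D `<=` A' -> False) ->
    visible n.+1 C -> C `<=` A -> visible n.+1 C' -> C' `<=` A' -> C <> C' ->
    visible n.+2 B -> C `<=` B -> C' `<=` B ->
    visible n.+1 C0 -> C0 `<=` A ->
    (forall D B', visible n.+1 D -> D `<=` A' -> C0 <> D -> visible n.+2 B' ->
       C0 `<=` B' -> D `<=` B' -> False) ->
  rk n (A `&` A') /\ A `&` A' `<=` C.
Proof.
move=> gA gA' noD gC CA gC' CA' ne gB CB CB' gC0 C0A no0.
have rI := rk_meet gC.1 gC'.1 gB.1 CB CB' ne.
have sF := subspaceI (rk_subspace gA.1) (rk_subspace gA'.1).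
have sIF : C `&` C' `<=` A `&` A' by move=> x [/CA ? /CA' ?].
have [p [lp rF eF]] := rk_sub gA.1 sF (@subIsetl _ A A').
have lnp := rk_leq rI rF sIF.
have [pn|npn] := EM (p = n).
  move: pn rF {lp eF lnp} => -> rF; split=> //.
  by rewrite -(rk_eq rI rF sIF); exact: subIsetl.
exfalso; have [p2|np2] := EM (p = n.+2).
  by apply: (noD C) => // x /CA; rewrite -(eF p2) => -[].
have pn1 : p = n.+1 by lia.
move: pn1 rF {lp eF lnp npn np2} => -> rF.
set F := A `&` A' in sF sIF rF.
have FH : F `<=` H.
  by move=> x Fx; apply: contrapT => nHx; apply: (noD F); [split=> //; exists x|move=> y []|move=> y []].
have FA : F `<=` A by move=> y [].
have FA' : F `<=` A' by move=> y [].
have eAF := visible_trace_eq gA rF FA FH.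
have [c Cc nHc] := gC.2; have [c' Cc' nHc'] := gC'.2.
have cc' : collinear c c'.
  by case: (rk_strong gB.1) => _; apply; [exact: CB|exact: CB'].
have A'E : A' = F <+ c'.
  by rewrite (visible_joinH gA' (CA' _ Cc') nHc') (visible_trace_eq gA' rF FA' FH).
have [x [C0x nFx _]] : exists x, [/\ C0 x, ~ F x & ~ H x].
  by have [x C0x nHx] := gC0.2; exists x; split=> // /FH.
have AE : A = F <+ c.
  by rewrite (visible_joinH gA (CA _ Cc) nHc) eAF.
have cA' : perp A' c.
  rewrite A'E; apply/perp_join1; split=> // y Fy.
  by apply: (rk_sub_perp gA.1 FA) => //; exact: CA.
have AA' : perp A c'.
  rewrite AE; apply/perp_join1; split; last exact: coll_sym.
  by move=> y Fy; apply: (rk_sub_perp gA'.1 FA') => //; exact: CA'.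
have [x0 C0x0 nHx0] := gC0.2.
have [rG eC0] := visible_section gC0.1 C0x0 nHx0.
have GF : C0 `&` H `<=` F by move=> y [/C0A Ay Hy]; rewrite -eAF.
have nG : ~ (C0 `&` H) c' by move=> [].
have nA : ~ A c' by move=> Ac'; apply: nHc'; apply: FH; split=> //; exact: CA'.
have [rD DA'] := rk_joinIn rG gA'.1 (subset_trans GF FA') (CA' _ Cc') nG.
have nC0 : ~ C0 c' by move/C0A.
have rB' : rk n.+2 (C0 <+ c') by apply: rkS => //; [exact: gC0.1|by move=> y /C0A; exact: AA'].
apply: (no0 _ (C0 <+ c') _ DA').
- by split=> //; exists c' => //; exact: join1_in.
- by move=> e; apply: nC0; rewrite e; exact: join1_in.
- by apply: (visible_sup gC0 rB'); exact: join1_sub.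
- exact: join1_sub.
- apply: join1_min; [exact: join1_subspace|by move=> y [C0y _]; exact: join1_sub|exact: join1_in].
Qed.

(** One-or-all: a point c of C outside F is collinear with a point of A' outside F,
    because A' has rank two more than F. *)
Lemma side_full n A A' F C : visible n F -> visible n.+2 A -> visible n.+2 A' -> A `&` A' = F ->
    visible n.+1 C -> F `<=` C -> C `<=` A ->
  exists C' B, [/\ visible n.+1 C', C' `<=` A', C <> C', visible n.+2 B & C `<=` B /\ C' `<=` B].
Proof.
move=> gF gA gA' eF gC FC CA.
have FA' : F `<=` A' by rewrite -eF => y [].
have FA : F `<=` A by rewrite -eF => y [].
have [c Cc nFc] := rk_lt_nonsub gF.1 gC.1 (ltnSn n).
have [c' [A'c' nFc' cc']] : exists c', [/\ A' c', ~ F c' & collinear c c'].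
  have [s|/nonsubset[b [A'b nb]]] := EM (A' `<=` perp [set c]).
    have [c' A'c' nFc'] := rk_lt_nonsub gF.1 gA'.1 (ltnW (ltnSn n.+1)).
    by exists c'; split=> //; apply: coll_sym; apply: (s c' A'c').
  have [rI _] := rk_section gA'.1 (@perp_subspace _) (@blocks_perp c _) A'b nb.
  have [c' [A'c' c'c] nFc'] := rk_lt_nonsub gF.1 rI (ltnSn n).
  by exists c'; split=> //; apply: coll_sym; apply: c'c.
have [rC' C'A'] := rk_joinIn gF.1 gA'.1 FA' A'c' nFc'.
have eC := rk_cover gF.1 gC.1 FC Cc nFc.
have nCc' : ~ C c' by move=> /CA Ac'; apply: nFc'; rewrite -eF.
have Cp : perp C c'.
  rewrite eC; apply/perp_join1; split; last exact: coll_sym.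
  exact: (rk_sub_perp gA'.1 FA').
have rB : rk n.+2 (C <+ c') by apply: rkS => //; exact: gC.1.
exists (F <+ c'), (C <+ c'); split=> //.
- by apply: (visible_sup gF) => //; exact: join1_sub.
- by move=> e; apply: nCc'; rewrite e; exact: join1_in.
- by apply: (visible_sup gC) => //; exact: join1_sub.
- split; first exact: join1_sub.
  apply: join1_min; [exact: join1_subspace|by move=> y /FC; exact: join1_sub|exact: join1_in].
Qed.

(** The extensions of C by a point that meet A in more than F are contained in the strong
    subspace spanned by C and the part of A perpendicular to it.  As C^perp
    is not a clique, some point of C^perp is outside this subspace. *)
Lemma transversal_through n A F C : rk n F -> rk n.+2 A -> F `<=` A -> rk n.+1 C -> F `<=` C ->
    ~ C `<=` A -> (n.+1 <= m)%N ->
  exists A', [/\ rk n.+2 A', C `<=` A' & A `&` A' = F].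
Proof.
move=> rF rA FA rC FC nCA lnm.
have eAC x : A x -> C x -> F x.
  move=> Ax Cx; apply: contrapT => nFx; apply: nCA.
  by rewrite (rk_cover rF rC FC Cx nFx); apply: join1_min => //; exact: rk_subspace rA.
(* W contains all extensions of C that meet A in more than F. *)
set W := span (C `|` (A `&` perp C)).
have sW : strong W.
  apply: span_strong => x [Cx|[Ax Cx]] y [Cy|[Ay Cy]].
  - exact: (rk_perp rC). - by apply: coll_sym; apply: Cy.
  - exact: Cx. - exact: (rk_perp rA).
have [d Cd nWd] : exists2 d, perp C d & ~ W d.
  have [d [e [Cd Ce _ _ nde]]] := perp_pair rC lnm.
  have [Wd|nWd] := EM (W d); last by exists d.
  by exists e => // We; apply: nde; case: sW => _; apply.
have nCd : ~ C d by move=> h; apply: nWd; apply: sub_span; left.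
exists (C <+ d); split; [exact: rkS|exact: join1_sub|].
apply/seteqP; split=> e; last by move=> Fe; split; [exact: FA|by apply: join1_sub; apply: FC].
move=> [Ae Ze]; apply: contrapT => nFe.
have nCe : ~ C e by move=> Ce; apply/nFe/eAC.
have Ce : perp C e.
  have rZ := rkS rC Cd nCd.
  exact: (rk_sub_perp rZ (@join1_sub _ C d)).
apply: nWd; have : (C <+ e) d by rewrite (join1_exchange rC Cd nCd Ze nCe); exact: join1_in.
apply: join1_min; first exact: span_subspace.
- by move=> x Cx; apply: sub_span; left.
- by apply: sub_span; right.
Qed.

Lemma off_extension n A F : rk n F -> strong A -> F `<=` A -> (n <= m)%N ->
  exists C, [/\ rk n.+1 C, F `<=` C & ~ C `<=` A].
Proof.
move=> rF sA FA lnm; have [d [e [Fd Fe nFd nFe nde]]] := perp_pair rF lnm.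
have [x [Fx nFx nAx]] : exists x, [/\ perp F x, ~ F x & ~ A x].
  have [Ad|nAd] := EM (A d); last by exists d.
  by exists e; split=> // Ae; apply: nde; case: sA => _; apply.
exists (F <+ x); split; [exact: rkS|exact: join1_sub|].
by move=> s; apply: nAx; apply: s; exact: join1_in.
Qed.

Lemma transversal_ex n A F : visible n F -> rk n.+2 A -> F `<=` A -> (n.+1 <= m)%N ->
  exists2 A', visible n.+2 A' & A `&` A' = F.
Proof.
move=> gF rA FA lnm.
have [C [rC FC nCA]] := off_extension gF.1 (rk_strong rA) FA (ltnW lnm).
have [A' [rA' CA' e]] := transversal_through gF.1 rA FA rC FC nCA lnm.
by exists A' => //; apply: (visible_sup gF rA') => x /FC/CA'.
Qed.

(** In the projective space at infinity of A, F and F' represent the same point, so every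
    parallel class met by the pencil of F is met by that of F'. *)
Lemma par_transfer n A F F' Y : visible n F -> visible n F' -> rk n.+2 A -> F' `<=` A ->
    F `&` H = F' `&` H -> visible n.+1 Y -> F `<=` Y -> Y `<=` A ->
  exists W, [/\ visible n.+1 W, F' `<=` W, W `<=` A & W `&` H = Y `&` H].
Proof.
move=> gF gF' rA F'A e gY FY YA; have [f F'f nHf] := gF'.2.
have rY := visible_rkH gY.
have YHA : Y `&` H `<=` A by move=> x [/YA].
have nYf : ~ (Y `&` H) f by move=> [].
have [rW WA] := rk_joinIn rY rA YHA (F'A _ F'f) nYf.
have gW : visible n.+1 ((Y `&` H) <+ f) by split=> //; exists f => //; exact: join1_in.
exists ((Y `&` H) <+ f); split=> //.
- rewrite (visible_joinH gF' F'f nHf) -e; apply: join1_min; first exact: join1_subspace.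
    by move=> x [/FY Yx Hx]; apply: join1_sub.
  exact: join1_in.
- by apply: (visible_trace_eq gW rY); [exact: join1_sub|move=> x []].
Qed.

(** Two lines of a projective plane meet, in the dual of the quotient A / P. *)
Lemma coplanar_meet n A F F' P C0 : rk n.+1 F -> rk n.+1 F' -> rk n P -> P `<=` F -> P `<=` F' ->
    rk n.+3 A -> F `<=` A -> F' `<=` A -> rk n.+2 C0 -> F `<=` C0 -> C0 `<=` A ->
  exists Z, [/\ rk n.+2 Z, F `<=` Z, F' `<=` Z & Z `<=` A].
Proof.
move=> rF rF' rP PF PF' rA FA F'A rC0 FC0 C0A.
have [s|/nonsubset[f [F'f nFf]]] := EM (F' `<=` F).
  by exists C0; split=> // x /s/FC0.
have [rZ ZA] := rk_joinIn rF rA FA (F'A _ F'f) nFf.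
exists (F <+ f); split=> //; first exact: join1_sub.
have nPf : ~ P f by move=> /PF.
rewrite (rk_cover rP rF' PF' F'f nPf); apply: join1_min; first exact: join1_subspace.
- by move=> x /PF; exact: join1_sub.
- exact: join1_in.
Qed.

End Affine.

(** * The descent predicates on an affine polar space *)
Section Step.
Variables (n : nat) (S T : Type) (PX : S -> Prop) (PY : T -> Prop) (In : S -> T -> Prop).
Variables (dX : S -> set Q) (dY : T -> set Q).
Hypothesis lnm : (n.+1 < m)%N.
Hypothesis nX : names PX (visible n.+2) dX.
Hypothesis nY : names PY (visible n.+3) dY.
Hypothesis InE : forall c a, PX c -> PY a -> (In c a <-> dX c `<=` dY a).

Local Notation hyp_of := (hyp_of PX In).
Local Notation joined := (joined PY In).
Local Notation side := (side PX PY In).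
Local Notation crossing := (crossing PX PY In).
Local Notation parallelism := (parallelism PX PY In).
Local Notation parallel := (parallel PX PY In).
Local Notation affine_crossing := (affine_crossing PX PY In).
Local Notation star := (star PX PY In).

Lemma visible_dX c : PX c -> visible n.+2 (dX c). Proof. by case: nX => h _ _; apply: h. Qed.
Lemma visible_dY a : PY a -> visible n.+3 (dY a). Proof. by case: nY => h _ _; apply: h. Qed.
Lemma dX_inj c c' : PX c -> PX c' -> dX c = dX c' -> c = c'. Proof. by case: nX => _ h _; apply: h. Qed.
Lemma dX_onto C : visible n.+2 C -> exists2 c, PX c & dX c = C. Proof. by case: nX => _ _ h; apply: h. Qed.
Lemma dY_onto A : visible n.+3 A -> exists2 a, PY a & dY a = A. Proof. by case: nY => _ _ h; apply: h. Qed.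

Lemma hyp_ofE a c : PY a -> hyp_of a c <-> PX c /\ dX c `<=` dY a.
Proof. by move=> Pa; split=> [[Pc /InE]|[Pc s]]; [split=> //; auto|split=> //; apply/InE]. Qed.

Lemma joinedE c c' : PX c -> PX c' ->
  joined c c' <-> dX c <> dX c' /\ exists B, [/\ visible n.+3 B, dX c `<=` B & dX c' `<=` B].
Proof.
move=> Pc Pc'; split=> [[ne [b [Pb /InE cb /InE c'b]]]|[ne [B [gB cB c'B]]]].
- by split; [move/(dX_inj Pc Pc')|exists (dY b); split; [exact: visible_dY|apply: cb|apply: c'b]].
- split=> [e|]; first by apply: ne; rewrite e.
  by have [b Pb eb] := dY_onto gB; exists b; split=> //; apply/InE; rewrite ?eb.
Qed.

Lemma crossing_rank a a' : crossing a a' ->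
  rk n.+1 (dY a `&` dY a') /\ forall c, side a a' c -> dY a `&` dY a' `<=` dX c.
Proof.
move=> [[Pa Pa'] none [c1 [_ [s1 _ _]]] [c0 [/(hyp_ofE _ Pa)[Pc0 c0a] ns0]]].
have main c : side a a' c -> rk n.+1 (dY a `&` dY a') /\ dY a `&` dY a' `<=` dX c.
  move=> [/(hyp_ofE _ Pa)[Pc ca] [c' [/(hyp_ofE _ Pa')[Pc' c'a'] /(joinedE Pc Pc')[ne [B [gB cB c'B]]]]]].
  apply: (cross_rank (visible_dY Pa) (visible_dY Pa') _ (visible_dX Pc) ca (visible_dX Pc') c'a' ne gB cB c'B (visible_dX Pc0) c0a).
  - move=> D gD Da Da'; have [d Pd ed] := dX_onto gD; apply: none; exists d.
    by split; apply/hyp_ofE => //; rewrite ed.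
  - move=> D B' gD Da' neD gB' C0B' DB'; have [d Pd ed] := dX_onto gD.
    apply: ns0; split; first exact/hyp_ofE.
    exists d; split; first by apply/hyp_ofE => //; rewrite ed.
    by apply/joinedE => //; rewrite ed; split=> //; exists B'.
by split=> [|c /main[]//]; case: (main c1 s1).
Qed.

Lemma side_pencil a a' c : PY a -> PY a' -> visible n.+1 (dY a `&` dY a') ->
  PX c -> dY a `&` dY a' `<=` dX c -> dX c `<=` dY a -> side a a' c.
Proof.
move=> Pa Pa' gF Pc Fc ca.
have [C' [B [gC' C'a' ne gB [cB C'B]]]] := side_full gF (visible_dY Pa) (visible_dY Pa') erefl (visible_dX Pc) Fc ca.
have [c' Pc' ec'] := dX_onto gC'.
split; first exact/hyp_ofE.
exists c'; split; first by apply/hyp_ofE => //; rewrite ec'.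
by apply/joinedE => //; rewrite ec'; split=> //; exists B.
Qed.

Lemma crossing_visible a a' : PY a -> PY a' -> visible n.+1 (dY a `&` dY a') -> crossing a a'.
Proof.
move=> Pa Pa' gF; set F := dY a `&` dY a' in gF.
have Fa : F `<=` dY a by move=> x [].
split=> //.
- move=> [c [/(hyp_ofE _ Pa)[Pc ca] /(hyp_ofE _ Pa')[_ ca']]].
  have := rk_leq (visible_dX Pc).1 gF.1 (fun x cx => conj (ca x cx) (ca' x cx)).
  by rewrite ltnn.
- have [C [D [rC rD ne [FC Ca FD Da]]]] := pencil2 gF.1 (visible_dY Pa).1 Fa.
  have [c Pc ec] := dX_onto (visible_sup gF rC FC); have [d Pd ed] := dX_onto (visible_sup gF rD FD).
  exists c, d; split; last by move=> e; apply: ne; rewrite -ec -ed e.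
  + by apply: side_pencil => //; rewrite ec.
  + by apply: side_pencil => //; rewrite ed.
- have [f Ff _] := gF.2; have [C [gC Ca nCf]] := visible_avoid (visible_dY Pa) (Fa _ Ff).
  have nFC : ~ F `<=` C by move/(_ f Ff).
  have [c Pc ec] := dX_onto gC; exists c; split; first by apply/hyp_ofE => //; rewrite ec.
  move=> [_ [c' [/(hyp_ofE _ Pa')[Pc' c'a'] /(joinedE Pc Pc')[nec [B [gB cB c'B]]]]]].
  have rI := rk_meet (visible_dX Pc).1 (visible_dX Pc').1 gB.1 cB c'B nec.
  have eI := rk_eq rI gF.1 (fun y Iy => conj (Ca y (eq_ind _ (fun Z => Z y) Iy.1 _ ec)) (c'a' y Iy.2)).
  by apply: nFC => x; rewrite -eI ec => -[].
Qed.

Lemma sideE a a' c : PY a -> PY a' -> visible n.+1 (dY a `&` dY a') ->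
  side a a' c <-> [/\ PX c, dY a `&` dY a' `<=` dX c & dX c `<=` dY a].
Proof.
move=> Pa Pa' gF; split=> [s|[Pc Fc ca]]; last exact: side_pencil.
have [_ h] := crossing_rank (crossing_visible Pa Pa' gF).
by case: (s) => /(hyp_ofE _ Pa)[Pc ca] _; split=> //; exact: h.
Qed.

Lemma pencil_ex a F : PY a -> visible n.+1 F -> F `<=` dY a ->
  exists a', [/\ PY a', dY a `&` dY a' = F & crossing a a'].
Proof.
move=> Pa gF Fa; have [A' gA' e] := transversal_ex gF (visible_dY Pa).1 Fa lnm.
have [a' Pa' ea'] := dY_onto gA'; exists a'; rewrite ea'; split=> //.
by apply: crossing_visible => //; rewrite ea' e.
Qed.

Definition trace_parallel : set (S * S) := [set p | dX p.1 `&` H = dX p.2 `&` H].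

(** Pencils of visible F correspond to the lines of the projective space of
    parallel classes, and those of F in H to its points. *)
Lemma trace_parallelism a : PY a -> parallelism a trace_parallel.
Proof.
move=> Pa; have rA := (visible_dY Pa).1; split.
- by split=> [c|c d|c d e] //; rewrite /trace_parallel /= => *; congruence.
- have ln : (0 < n.+1 <= n.+3)%N by lia.
  have [F gF Fa] := visible_parts (visible_dY Pa) ln.
  have [C [D [rC rD ne [FC Ca FD Da]]]] := pencil2 gF.1 rA Fa.
  have gC := visible_sup gF rC FC; have gD := visible_sup gF rD FD.
  have [c Pc ec] := dX_onto gC; have [d Pd ed] := dX_onto gD.
  exists c, d; split; [by apply/hyp_ofE => //; rewrite ec|by apply/hyp_ofE => //; rewrite ed|].
  rewrite /trace_parallel /= ec ed => e; have [f Ff nHf] := gF.2.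
  exact: ne (trace_eq gC gD e (FC _ Ff) (FD _ Ff) nHf).
- move=> c d /(hyp_ofE _ Pa)[Pc ca] /(hyp_ofE _ Pa)[Pd da] np.
  have [ne gI] := nonpar_meet rA (visible_dX Pc) (visible_dX Pd) ca da np.
  have Ia : dX c `&` dX d `<=` dY a by move=> x [/ca].
  have [a' [Pa' e cr]] := pencil_ex Pa gI Ia.
  by exists a'; split=> //; apply: side_pencil => //; rewrite e // => x [].
- move=> a' c d x cr sc sd sx ne.
  have [rF hF] := crossing_rank cr.
  have Fc := hF _ sc; have Fd := hF _ sd; have Fx := hF _ sx.
  case: sc sd sx => /(hyp_ofE _ Pa)[Pc ca] _ [/(hyp_ofE _ Pa)[Pd da] _] [/(hyp_ofE _ Pa)[Px xa] _].
  rewrite /trace_parallel /= => e.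
  have FH : dY a `&` dY a' `<=` H.
    move=> y Fy; apply: (par_meet rA (visible_dX Pc) (visible_dX Pd)) => //; last by split; [exact: Fc|exact: Fd].
    by move/(dX_inj Pc Pd).
  by rewrite (visible_trace_eq (visible_dX Pc) rF Fc FH) (visible_trace_eq (visible_dX Px) rF Fx FH).
- move=> a' a'' c x x' y cr cr' sc sc' sx sx'; rewrite /trace_parallel /= => e np sy.
  have [rF hF] := crossing_rank cr; have [rF' hF'] := crossing_rank cr'.
  have Fc := hF _ sc; have Fx := hF _ sx; have Fy := hF _ sy.
  have F'c := hF' _ sc'; have F'x' := hF' _ sx'.
  have Pa'' : PY a'' by case: cr' => -[].
  case: sc sx sy sx' => /(hyp_ofE _ Pa)[Pc ca] _ [/(hyp_ofE _ Pa)[Px xa] _] [/(hyp_ofE _ Pa)[Py ya] _] [/(hyp_ofE _ Pa)[Px' x'a] _].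
  have [_ gI] := nonpar_meet rA (visible_dX Pc) (visible_dX Px) ca xa np.
  have np' : dX c `&` H <> dX x' `&` H by rewrite -e.
  have [_ gI'] := nonpar_meet rA (visible_dX Pc) (visible_dX Px') ca x'a np'.
  have eF := rk_eq rF gI.1 (fun y Fy => conj (Fc y Fy) (Fx y Fy)).
  have eF' := rk_eq rF' gI'.1 (fun y Fy => conj (F'c y Fy) (F'x' y Fy)).
  have gF : visible n.+1 (dY a `&` dY a') by rewrite eF.
  have gF' : visible n.+1 (dY a `&` dY a'') by rewrite eF'.
  have eH : (dY a `&` dY a') `&` H = (dY a `&` dY a'') `&` H.
    by rewrite eF eF' -!setIA e.
  have F'a : dY a `&` dY a'' `<=` dY a by move=> z [].
  have [W [gW F'W Wa eW]] := par_transfer gF gF' rA F'a eH (visible_dX Py) Fy ya.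
  have [w Pw ew] := dX_onto gW; exists w; last by rewrite ew.
  by apply: side_pencil => //; rewrite ew.
Qed.

(** Suppose that a pencil lambda of a visible F lies in one class of E, and that c is
    outside this class.  Choose x' in lambda, parallel to c if possible, and
    another x in lambda; take y on the pencil of c and x.  The last
    condition gives w equivalent to y on a pencil of c and x'.  The choice of
    x' ensures that w is not parallel to y.  Then the pencil of w and y is
    visible, lies in one class and is coplanar with lambda; so both have a
    common member and y is in the class of lambda, which forces c into it. *)
Lemma parallelism_trace a E c0 d0 : parallelism a E -> PY a -> hyp_of a c0 -> hyp_of a d0 -> c0 <> d0 -> E (c0, d0) ->
  dX c0 `&` H = dX d0 `&` H.
Proof.
move=> [[refl sym trans] [c1 [c2 [tc1 tc2 n12]]] joinE lineE planeE] Pa tc0 td0 ne0 E0.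
apply: contrapT => np0; have rA := (visible_dY Pa).1.
have [Pc0 c0a] := (hyp_ofE c0 Pa).1 tc0; have [Pd0 d0a] := (hyp_ofE d0 Pa).1 td0.
have [_ gF] := nonpar_meet rA (visible_dX Pc0) (visible_dX Pd0) c0a d0a np0.
set F := dX c0 `&` dX d0 in gF.
have Fa : F `<=` dY a by move=> x [/c0a].
have [a1 [Pa1 eF cr1]] := pencil_ex Pa gF Fa.
have side1 x : side a a1 x <-> [/\ PX x, F `<=` dX x & dX x `<=` dY a].
  by rewrite -eF; apply: sideE => //; rewrite eF.
have lam x : side a a1 x -> E (c0, x).
  move=> sx; apply: (lineE a1 c0 d0 x) => //; apply/side1; split=> //; by move=> z [].
have [c tc nE] : exists2 c, hyp_of a c & ~ E (c0, c).
  have [E1|] := EM (E (c0, c1)); last by exists c1.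
  have [E2|] := EM (E (c0, c2)); last by exists c2.
  by case: n12; apply: (trans _ c0) => //; exact: sym.
have [Pc ca] := (hyp_ofE c Pa).1 tc.
have nFc : ~ F `<=` dX c by move=> Fc; apply/nE/lam/side1.
have [f [Ff nCf]] := nonsubset nFc.
have stops a' x : side a a' x -> hyp_of a x by case.
(* Taking x' parallel to c if possible keeps w from being parallel to y below. *)
have [x' sx' special] : exists2 x', side a a1 x' &
    dX x' `&` H = dX c `&` H \/ forall x, side a a1 x -> dX x `&` H <> dX c `&` H.
  have [[x' [sx' e]]|none] := EM (exists x', side a a1 x' /\ dX x' `&` H = dX c `&` H).
    by exists x' => //; left.
  exists c0; first by apply/side1; split=> // z [].
  by right=> x sx e; apply: none; exists x.
have [Px' Fx' x'a] := (side1 x').1 sx'.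
have [x [sx nxx' npx]] : exists x, [/\ side a a1 x, x <> x' & dX x `&` H <> dX c `&` H].
  have [x sx nxx'] : exists2 x, side a a1 x & x <> x'.
    have [e|ne] := EM (c0 = x'); last by exists c0 => //; apply/side1; split=> // z [].
    by exists d0; [apply/side1; split=> // z []|rewrite -e => /esym].
  exists x; split=> //; case: special => [e' e|]; last exact.
  have [Px Fx xa] := (side1 x).1 sx.
  have := par_meet rA (visible_dX Px) (visible_dX Px') xa x'a (fun h => nxx' (dX_inj Px Px' h)) (etrans e (esym e')).
  have [y Fy nHy] := gF.2; move/(_ y (conj (Fx y Fy) (Fx' y Fy))); exact: nHy.
have [Px Fx xa] := (side1 x).1 sx.
have [ncx gcx] := nonpar_meet rA (visible_dX Pc) (visible_dX Px) ca xa (fun h => npx (esym h)).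
have cxa : dX c `&` dX x `<=` dY a by move=> z [/ca].
have [a2 [Pa2 e2 cr2]] := pencil_ex Pa gcx cxa.
have side2 z : side a a2 z <-> [/\ PX z, dX c `&` dX x `<=` dX z & dX z `<=` dY a].
  by rewrite -e2; apply: sideE => //; rewrite e2.
have [Y [rY nYc nYx cxY Ya]] := pencil3 gcx.1 rA (visible_dX Pc).1 (visible_dX Px).1 ncx (@subIsetl _ _ _) (@subIsetr _ _ _) ca xa.
have gYY := visible_sup gcx rY cxY.
have [y Py ey] := dX_onto gYY.
have sy : side a a2 y by apply/side2; rewrite ey.
have sc2 : side a a2 c by apply/side2; split=> // z [].
have sx2 : side a a2 x by apply/side2; split=> // z [].
have nEcx' : ~ E (c, x').
  move=> h; apply: nE; apply: (trans _ x') => //; [exact: (stops a1)|exact: lam|].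
  by apply: sym => //; exact: (stops a1).
have nEcx : ~ E (c, x).
  move=> h; apply: nE; apply: (trans _ x) => //; [exact: (stops a1)|exact: lam|].
  by apply: sym => //; exact: (stops a1).
have Exx' : E (x, x').
  apply: (trans _ c0) => //; try exact: (stops a1); last exact: lam.
  by apply: sym => //; [exact: (stops a1)|exact: lam].
have [a3 [cr3 sc3 sx3]] := joinE c x' tc (stops a1 _ sx') nEcx'.
(* The pencils a2 of c, x and a3 of c, x' meet the same classes of E. *)
have [w sw Ewy] := planeE a2 a3 c x x' y cr2 cr3 sc2 sc3 sx2 sx3 Exx' nEcx sy.
have [Pw wa] := (hyp_ofE w Pa).1 (stops _ _ sw).
have [rF3 hF3] := crossing_rank cr3.
have F3c := hF3 _ sc3; have F3x := hF3 _ sx3; have F3w := hF3 _ sw.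
have ncx' : dX c <> dX x' by move=> e; apply: nFc; rewrite e.
have eF3 := rk_eq rF3 (rk_meet (visible_dX Pc).1 (visible_dX Px').1 rA ca x'a ncx') (fun z h => conj (F3c z h) (F3x z h)).
have FnC : blocks (dX c) F.
  exact: (blocks_sub Fa (blocks_hyp (visible_dX Pc).1 rA ca)).
have [rP _] := rk_section gF.1 (rk_subspace (visible_dX Pc).1) FnC Ff nCf.
set P := F `&` dX c in rP.
have PF : P `<=` F by move=> z [].
have PC : P `<=` dX c by move=> z [].
have PY' : P `<=` dX y by rewrite ey => z [Fz cz]; apply: cxY; split=> //; exact: Fx.
have PW : P `<=` dX w by move=> z [Fz cz]; apply: F3w; rewrite eF3; split=> //; exact: Fx'.
have ya : dX y `<=` dY a by rewrite ey.
have nyc : dX y <> dX c by rewrite ey.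
(* Otherwise y contains the meets of c with x and with x', and equals c. *)
have nyw : dX y <> dX w.
  move=> e; have rI := rk_meet (visible_dX Py).1 (visible_dX Pc).1 rA ya ca nyc.
  have s1 : dX c `&` dX x `<=` dX y `&` dX c by move=> z cz; split; [rewrite ey; exact: cxY|case: cz].
  have s2 : dX c `&` dX x' `<=` dX y `&` dX c.
    by rewrite -eF3 => z Fz; split; [rewrite e; exact: F3w|exact: F3c].
  have e1 := rk_eq gcx.1 rI s1.
  have e1' := rk_eq (rk_meet (visible_dX Pc).1 (visible_dX Px').1 rA ca x'a ncx') rI s2.
  have exx' : dX c `&` dX x `<=` P.
    move=> z cxz; have : (dX c `&` dX x') z by rewrite e1' -e1.
    move=> [cz x'z]; split=> //.
    have rxx' := rk_meet (visible_dX Px).1 (visible_dX Px').1 rA xa x'a (fun h => nxx' (dX_inj Px Px' h)).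
    rewrite (rk_eq gF.1 rxx' (fun u Fu => conj (Fx u Fu) (Fx' u Fu))); split=> //.
    by case: cxz.
  by have := rk_leq gcx.1 rP exx'; rewrite ltnn.
(* If nothing in lambda is parallel to c, then the meet P of F and c is visible, and P is in y and w. *)
have npyw : dX y `&` H <> dX w `&` H.
  move=> e; case: special => [e'|none].
    have sI : dX c `&` dX x' `<=` H by apply: (par_meet rA (visible_dX Pc) (visible_dX Px')).
    have e3 : dX c `&` H = dX c `&` dX x'.
      by rewrite -eF3; apply: (visible_trace_eq (visible_dX Pc) rF3 F3c); rewrite eF3.
    have e4 : dX w `&` H = dX c `&` dX x'.
      by rewrite -eF3; apply: (visible_trace_eq (visible_dX Pw) rF3 F3w); rewrite eF3.
    have := par_meet rA (visible_dX Py) (visible_dX Pc) ya ca nyc (etrans e (etrans e4 (esym e3))).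
    have [z cxz nHz] := gcx.2; move=> /(_ z) h; apply/nHz/h; split; last by case: cxz.
    by rewrite ey; exact: cxY.
  have nFHc : ~ F `&` H `<=` dX c.
    move=> FHc; have [g Fg nHg] := gF.2.
    have rcH := visible_rkH (visible_dX Pc).
    have cHa : dX c `&` H `<=` dY a by move=> z [/ca].
    have ncg : ~ (dX c `&` H) g by move=> [].
    have [rZ Za] := rk_joinIn rcH rA cHa (Fa _ Fg) ncg.
    have FZ : F `<=` dX c `&` H <+ g.
      rewrite {1}(visible_joinH gF Fg nHg); apply: join1_min; first exact: join1_subspace.
        by move=> z [Fz Hz]; apply: join1_sub; split=> //; exact: FHc.
      exact: join1_in.
    have gZ := visible_sup gF rZ FZ.
    have [z Pz ez] := dX_onto gZ.
    have sz : side a a1 z by apply/side1; rewrite ez.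
    by apply: (none z sz); rewrite ez; apply: (visible_trace_eq gZ rcH); [exact: join1_sub|move=> u []].
  have [p Pp nHp] : exists2 p, P p & ~ H p.
    apply: contrapT => no; apply: nFHc.
    have PH : P `<=` F `&` H.
      by move=> z Pz; split; [exact: PF|apply: contrapT => nHz; apply: no; exists z].
    by rewrite -(rk_eq rP (visible_rkH gF) PH).
  exact: nyw (trace_eq (visible_dX Py) (visible_dX Pw) e (PY' _ Pp) (PW _ Pp) nHp).
have [_ gyw] := nonpar_meet rA (visible_dX Py) (visible_dX Pw) ya wa npyw.
have Pyw : P `<=` dX y `&` dX w by move=> z Pz; split; [exact: PY'|exact: PW].
have ywa : dX y `&` dX w `<=` dY a by move=> z [/ya].
have Fc0 : F `<=` dX c0 by move=> z [].
(* Both the pencil of F and that of y and w lie in the dual plane over P. *)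
have [Z [rZ FZ ywZ Za]] := coplanar_meet gF.1 gyw.1 rP PF Pyw rA Fa ywa (visible_dX Pc0).1 Fc0 c0a.
have [z Pz ez] := dX_onto (visible_sup gF rZ FZ).
have sz1 : side a a1 z by apply/side1; rewrite ez.
have [a4 [Pa4 e4 cr4]] := pencil_ex Pa gyw ywa.
have side4 u : side a a4 u <-> [/\ PX u, dX y `&` dX w `<=` dX u & dX u `<=` dY a].
  by rewrite -e4; apply: sideE => //; rewrite e4.
have sy4 : side a a4 y by apply/side4; split=> // u [].
have sw4 : side a a4 w by apply/side4; split=> // u [].
have sz4 : side a a4 z by apply/side4; rewrite ez.
have Ewz : E (w, z) by apply: (lineE a4 w y z) => // e; apply: nyw; rewrite e.
have tx := stops _ _ sx; have ty := stops _ _ sy; have tw := stops _ _ sw.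
have tz := stops _ _ sz1; have t_c0 := tc0.
have Exy : E (x, y).
  apply: (trans _ c0) => //; first by apply: sym => //; exact: lam.
  apply: (trans _ z) => //; first exact: lam.
  by apply: (trans _ w) => //; apply: sym.
have nxy : x <> y by move=> e; apply: nYx; rewrite -ey e.
have Exc : E (x, c) by apply: (lineE a2 x y c).
by apply: nE; apply: (trans _ x) => //; exact: lam.
Qed.

Lemma parallelE a c d : PY a -> hyp_of a c -> hyp_of a d -> parallel a c d <-> dX c `&` H = dX d `&` H.
Proof.
move=> Pa tc td; split=> [[->//|[E cE Ecd]]|e].
  by have [->//|ne] := EM (c = d); exact: (parallelism_trace cE Pa tc td ne Ecd).
by right; exists trace_parallel => //; exact: trace_parallelism.
Qed.

Lemma affine_crossingE a a' : affine_crossing a a' <-> [/\ PY a, PY a' & visible n.+1 (dY a `&` dY a')].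
Proof.
split=> [[cr [c [d [sc sd np]]]]|[Pa Pa' gF]].
  have [Pa Pa'] : PY a /\ PY a' by case: cr.
  split=> //; have [rF hF] := crossing_rank cr.
  have [[tc _] [td _]] := (sc, sd).
  have [[Pc ca] [Pd da]] := ((hyp_ofE c Pa).1 tc, (hyp_ofE d Pa).1 td).
  have np' : dX c `&` H <> dX d `&` H by move/(parallelE Pa tc td).
  have [_ gI] := nonpar_meet (visible_dY Pa).1 (visible_dX Pc) (visible_dX Pd) ca da np'.
  by rewrite (rk_eq rF gI.1 (fun u Fu => conj (hF _ sc u Fu) (hF _ sd u Fu))).
have cr := crossing_visible Pa Pa' gF; split=> //.
have Fa : dY a `&` dY a' `<=` dY a by move=> x [].
have [C [D [rC rD ne [FC Ca FD Da]]]] := pencil2 gF.1 (visible_dY Pa).1 Fa.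
have gC := visible_sup gF rC FC; have gD := visible_sup gF rD FD.
have [c Pc ec] := dX_onto gC; have [d Pd ed] := dX_onto gD.
have sc : side a a' c by apply: side_pencil => //; rewrite ec.
have sd : side a a' d by apply: side_pencil => //; rewrite ed.
exists c, d; split=> //; have [[tc _] [td _]] := (sc, sd).
move=> /(parallelE Pa tc td); rewrite ec ed => e; have [f Ff nHf] := gF.2.
exact: ne (trace_eq gC gD e (FC _ Ff) (FD _ Ff) nHf).
Qed.

(** If [side a a''] equals [side a a'] then two of its members show that both have
    the same meet with a; conversely [transversal_through] supplies a''. *)
Lemma starE a a' c : affine_crossing a a' -> star a a' c <-> PX c /\ dY a `&` dY a' `<=` dX c.
Proof.
move=> /affine_crossingE[Pa Pa' gF]; have cr := crossing_visible Pa Pa' gF.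
split=> [[/(sideE _ Pa Pa' gF)[]//|[a'' [cr' same sc]]]|[Pc Fc]].
  have [rF' hF'] := crossing_rank cr'.
  have [_ _ [c1 [c2 [s1 s2 n12]]] _] := cr'.
  have Pa'' : PY a'' by case: cr' => -[].
  have [P1 F1 c1a] := (sideE c1 Pa Pa' gF).1 ((same c1).1 s1).
  have [P2 F2 c2a] := (sideE c2 Pa Pa' gF).1 ((same c2).1 s2).
  have n12' : dX c1 <> dX c2 by move/(dX_inj P1 P2).
  have rI := rk_meet (visible_dX P1).1 (visible_dX P2).1 (visible_dY Pa).1 c1a c2a n12'.
  have e1 := rk_eq gF.1 rI (fun u Fu => conj (F1 u Fu) (F2 u Fu)).
  have e2 := rk_eq rF' rI (fun u Fu => conj (hF' _ s1 u Fu) (hF' _ s2 u Fu)).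
  have gF'' : visible n.+1 (dY a'' `&` dY a) by rewrite setIC e2 -e1.
  have [Pc Fc _] := (sideE c Pa'' Pa gF'').1 sc.
  by split=> //; rewrite e1 -e2 setIC.
have Fa : dY a `&` dY a' `<=` dY a by move=> x [].
have [ca|nca] := EM (dX c `<=` dY a); first by left; exact: side_pencil.
have [A'' [rA'' cA'' eF]] := transversal_through gF.1 (visible_dY Pa).1 Fa (visible_dX Pc).1 Fc nca lnm.
have [a'' Pa'' ea''] := dY_onto (visible_sup (visible_dX Pc) rA'' cA'').
have gF' : visible n.+1 (dY a `&` dY a'') by rewrite ea'' eF.
right; exists a''; split; first exact: crossing_visible.
- by move=> d; rewrite (sideE d Pa Pa'' gF') (sideE d Pa Pa' gF) ea'' eF.
- by apply: side_pencil; rewrite 1?setIC ?ea'' ?eF // -eF.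
Qed.

Definition star_dec (f : set S) : set Q := [set x | forall c, f c -> dX c x].

Local Notation star_code := (star_code PX PY In).

Lemma star_names : names star_code (visible n.+1) star_dec /\
  forall f c, star_code f -> PX c -> (mem_code f c <-> star_dec f `<=` dX c).
Proof.
have key F : visible n.+1 F -> star_dec [set c | PX c /\ F `<=` dX c] = F.
  move=> gF; apply/seteqP; split=> [x h|x Fx c [_]]; last exact.
  have [A gA FA] : exists2 A, visible n.+3 A & F `<=` A by apply: (visible_extend gF); lia.
  have [C [D [rC rD ne [FC CA FD DA]]]] := pencil2 gF.1 gA.1 FA.
  have [c Pc ec] := dX_onto (visible_sup gF rC FC); have [d Pd ed] := dX_onto (visible_sup gF rD FD).
  rewrite (rk_eq gF.1 (rk_meet rC rD gA.1 CA DA ne) (fun u Fu => conj (FC u Fu) (FD u Fu))).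
  by split; [rewrite -ec; apply: h|rewrite -ed; apply: h]; rewrite /= ?ec ?ed.
have codeE f : star_code f -> exists2 F, visible n.+1 F & f = [set c | PX c /\ F `<=` dX c].
  move=> [a [a' [cra fE]]]; have [Pa Pa' gF] := (affine_crossingE a a').1 cra.
  exists (dY a `&` dY a') => //; apply/seteqP; split=> c /=; first by move/fE/(starE _ cra).
  by move=> h; apply/fE/starE.
split; first split.
- by move=> f /codeE[F gF ->]; rewrite key.
- by move=> f f' /codeE[F gF ->] /codeE[F' gF' ->]; rewrite !key // => ->.
- move=> F gF; exists [set c | PX c /\ F `<=` dX c]; last exact: key.
  have [A gA FA] : exists2 A, visible n.+3 A & F `<=` A by apply: (visible_extend gF); lia.
  have [a Pa ea] := dY_onto gA; rewrite -ea in FA.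
  have [a' [Pa' eF _]] := pencil_ex Pa gF FA.
  have cra : affine_crossing a a' by apply/affine_crossingE; rewrite eF.
  by exists a, a'; split=> // c; rewrite (starE c cra) eF.
- move=> f c /codeE[F gF ->] Pc; rewrite key // /mem_code /=.
  by split=> [[]|].
Qed.

End Step.
(** * What the graph predicates define on strong subspaces *)
Section GraphSpecs.
Variables (V : Type) (adj : V -> V -> Prop) (d : V -> set Q).
Implicit Types (C D F X Y Z : set Q) (u v w : V).

(** u and v generate a visible strong subspace of rank n, for u and v of rank n - 1. *)
Definition spans n u v := d u <> d v /\ exists Z, [/\ visible n Z, d u `<=` Z & d v `<=` Z].

Section Rank.
Variable n : nat.
Hypothesis nV : names (fun _ : V => True) (visible n.+1) d.

Lemma visible_d v : visible n.+1 (d v). Proof. by case: nV => h _ _; apply: h. Qed.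
Lemma d_inj u v : d u = d v -> u = v. Proof. by case: nV => _ h _; apply: h. Qed.
Lemma d_onto X : visible n.+1 X -> exists v, d v = X.
Proof. by case: nV => _ _ h /h[v _ <-]; exists v. Qed.

Lemma star_decE F : visible n F -> (n <= m)%N -> star_dec d [set w | F `<=` d w] = F.
Proof.
move=> gF lnm; apply/seteqP; split=> [x h|x Fx w]; last exact.
have [C [D [rC rD FC FD [y [z [Cy Dz nyz]]]]]] := over_pair gF.1 lnm.
have [u eu] := d_onto (visible_sup gF rC FC); have [v ev] := d_onto (visible_sup gF rD FD).
have ne : C <> D.
  by move=> e; apply: nyz; case: (rk_strong rC) => _; apply=> //; rewrite e.
rewrite -(inter_cover gF.1 rC rD FC FD ne).
by split; [rewrite -eu; apply: h; rewrite /= eu|rewrite -ev; apply: h; rewrite /= ev].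
Qed.

Lemma star_code_names (code : set V -> Prop) : (n <= m)%N ->
    (forall c, code c -> exists2 F, visible n F & c = [set w | F `<=` d w]) ->
    (forall F, visible n F -> code [set w | F `<=` d w]) ->
  names code (visible n) (star_dec d) /\
  forall c w, code c -> True -> (mem_code c w <-> star_dec d c `<=` d w).
Proof.
move=> lnm hc hF; split; first split.
- by move=> c /hc[F gF ->]; rewrite star_decE.
- by move=> c c' /hc[F gF ->] /hc[F' gF' ->]; rewrite !star_decE // => ->.
- by move=> F gF; exists [set w | F `<=` d w]; [exact: hF|exact: star_decE].
- by move=> c w /hc[F gF ->] _; rewrite star_decE.
Qed.

End Rank.

Section Meet.
Variable n : nat.
Hypothesis nV : names (fun _ : V => True) (visible n.+2) d.
Hypothesis lnm : (n.+1 <= m)%N.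
Hypothesis adjE : forall u v, adj u v <-> visible n.+1 (d u `&` d v).

(** If the ends of an edge are in no common strong subspace, every common neighbour
    contains their meet C by [triangle].  Otherwise a common neighbour that
    does not contain C is not adjacent to an extension of C outside the span
    of the edge. *)
Lemma pair_star_names : names (pair_star adj) (visible n.+1) (star_dec d) /\
  forall c w, pair_star adj c -> True -> (mem_code c w <-> star_dec d c `<=` d w).
Proof.
have g := visible_d nV; have rV v : rk n.+2 (d v) := (g v).1.
have sat_star F w u : visible n.+1 F -> F `<=` d w -> F `<=` d u -> w <> u -> adj w u.
  move=> gF Fw Fu ne; apply/adjE; rewrite (inter_cover gF.1 (rV w) (rV u)) //.
  by move/(d_inj nV).
apply: star_code_names => //.
- move=> c [u [v [auv cE cl]]]; have gC := (adjE u v).1 auv.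
  exists (d u `&` d v) => //; apply/seteqP; split=> w /=.
    move=> cw; have [->|[->|[awu awv]]] := (cE w).1 cw; [by move=> x []|by move=> x []|].
    apply: contrapT => nCw.
    have [D [rD uD vD wD]] := triangle (rV u) (rV v) (rV w) gC.1 ((adjE _ _).1 awu).1 ((adjE _ _).1 awv).1 nCw.
    have CD : d u `&` d v `<=` D by move=> x [/uD].
    have [E [rE CE nED]] := off_extension gC.1 (rk_strong rD) CD lnm.
    have [e ee] := d_onto nV (visible_sup gC rE CE).
    have Cu : d u `&` d v `<=` d u by move=> x [].
    have Cv : d u `&` d v `<=` d v by move=> x [].
    have Ce : d u `&` d v `<=` d e by rewrite ee.
    have ce : c e.
      apply/cE; right; right; split; apply: (sat_star _ _ _ gC) => // h; apply: nED; rewrite -ee h //.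
    have /adjE[rI _] : adj w e by apply: cl => // h; apply: nED; rewrite -ee -h.
    apply: nCw; have sI : d w `&` d e `<=` d u `&` d v.
      move=> x [wx ex]; have [p [lp rp ep]] := rk_sub rE (subspaceI (rk_subspace rE) (rk_subspace rD)) (@subIsetl _ E D).
      have np : p <> n.+2 by move/ep => h; apply: nED; rewrite -h => y [].
      have CED : d u `&` d v `<=` E `&` D by move=> y Cy; split; [exact: CE|exact: CD].
      have lp' := rk_leq gC.1 rp CED.
      have ep' : p = n.+1 by lia.
      rewrite ep' in rp.
      by rewrite (rk_eq gC.1 rp CED); split; [rewrite -ee|exact: wD].
    by rewrite -(rk_eq rI gC.1 sI) => x [].
  move=> Cw; apply/cE; have [->|nwu] := EM (w = u); first by left.
  have [->|nwv] := EM (w = v); first by right; left.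
  by right; right; split; apply: (sat_star _ _ _ gC) => // x [].
- move=> F gF; have [C [D [rC rD FC FD [y [z [Cy Dz nyz]]]]]] := over_pair gF.1 lnm.
  have [u eu] := d_onto nV (visible_sup gF rC FC); have [v ev] := d_onto nV (visible_sup gF rD FD).
  have noD Z : rk n.+3 Z -> d u `<=` Z -> d v `<=` Z -> False.
    move=> rZ uZ vZ; apply: nyz; case: (rk_strong rZ) => _; apply.
      by apply: uZ; rewrite eu. by apply: vZ; rewrite ev.
  have nuv : u <> v.
    by move=> e; apply: nyz; case: (rk_strong rC) => _; apply => //; rewrite -eu e ev.
  have eF : d u `&` d v = F.
    apply: (inter_cover gF.1) => //; rewrite ?eu ?ev // -eu -ev; exact: contra_not (d_inj nV (u:=u) (v:=v)) nuv.
  exists u, v; split.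
  + by apply: (sat_star _ _ _ gF); rewrite ?eu ?ev.
  + move=> w /=; split=> [Fw|].
      have [->|nwu] := EM (w = u); first by left.
      have [->|nwv] := EM (w = v); first by right; left.
      by right; right; split; apply: (sat_star _ _ _ gF) => //; rewrite ?eu ?ev.
    case=> [->|[->|[/adjE gwu /adjE gwv]]]; rewrite ?eu ?ev //.
    apply: contrapT => nFw; have [D' [rD' uD vD _]] := triangle (rV u) (rV v) (rV w) (n := n.+1)
      (eq_ind_r (fun Z => rk n.+1 Z) gF.1 eF) gwu.1 gwv.1 (fun h => nFw (subset_trans (eq_ind_r (fun Z => F `<=` Z) (fun x => id) eF) h)).
    exact: noD rD' uD vD.
  + by move=> w w' /= Fw Fw' ne; apply: (sat_star _ _ _ gF).
Qed.

End Meet.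

Section Pencils.
Variable n : nat.
Hypothesis nV : names (fun _ : V => True) (visible n.+1) d.
Hypothesis lnm : (n == 0%N) || (n.+2 <= m)%N.
Hypothesis adjE : forall u v, adj u v <-> spans n.+2 u v.

Lemma spans_rk u v : spans n.+2 u v -> rk n (d u `&` d v).
Proof.
have g := visible_d nV; move=> [ne [Z [gZ uZ vZ]]].
exact: (rk_meet (g u).1 (g v).1 gZ.1 uZ vZ ne).
Qed.

(** Extensions of C, the meet of u and v, by a point of D^perp are adjacent to both u and v.
    A member w of the double perp that does not contain C would meet them
    in too little, and if w is not in D then one of them is not perpendicular
    to w. *)
Lemma pencilE u v w D : adj u v -> visible n.+2 D -> d u `<=` D -> d v `<=` D ->
  pencil adj u v w <-> d u `&` d v `<=` d w /\ d w `<=` D.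
Proof.
have g := visible_d nV; have rV x : rk n.+1 (d x) := (g x).1.
move=> auv gD uD vD; have [ne _] := (adjE u v).1 auv.
have rC := spans_rk ((adjE u v).1 auv).
have CD : d u `&` d v `<=` D by move=> x [/uD].
have ext e : perp D e -> ~ D e -> ~ H e -> exists2 z, d z = (d u `&` d v) <+ e & adj z u /\ adj z v.
  move=> De nDe nHe; have nCe : ~ (d u `&` d v) e by move/CD.
  have Ce : perp (d u `&` d v) e by move=> x /CD; exact: De.
  have gE : visible n.+1 ((d u `&` d v) <+ e).
    by split; [exact: rkS|exists e => //; exact: join1_in].
  have [z ez] := d_onto nV gE; exists z => //.
  have key t : d t `<=` D -> d u `&` d v `<=` d t -> adj z t.
    move=> tD Ct; apply/adjE; split.
      by rewrite ez => h; apply/nDe/tD; rewrite -h; exact: join1_in.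
    have nte : ~ d t e by move/tD.
    have te : perp (d t) e by move=> x /tD; exact: De.
    exists (d t <+ e); split.
    - by apply: (visible_sup (g t)); [exact: rkS (rV t) te nte|exact: join1_sub].
    - rewrite ez; apply: join1_min; [exact: join1_subspace|by move=> x /Ct; exact: join1_sub|exact: join1_in].
    - exact: join1_sub.
  by split; apply: key => // x [].
have meetE Z w' : rk n.+1 Z -> d u `&` d v `<=` Z -> ~ Z `<=` D -> d w' `<=` D ->
    rk n (Z `&` d w') -> d u `&` d v `<=` d w'.
  move=> rZ CZ nZD w'D rI.
  have [p [lp rp ep]] := rk_sub rZ (subspaceI (rk_subspace rZ) (rk_subspace gD.1)) (@subIsetl _ Z D).
  have np : p <> n.+1 by move/ep => h; apply: nZD; rewrite -h => y [].
  have CZD : d u `&` d v `<=` Z `&` D by move=> y Cy; split; [exact: CZ|exact: CD].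
  have lp' := rk_leq rC rp CZD; have ep' : p = n by lia.
  rewrite ep' in rp; have e := rk_eq rC rp CZD.
  have sI : Z `&` d w' `<=` d u `&` d v by rewrite e => y [Zy /w'D].
  by rewrite -(rk_eq rI rC sI) => y [].
split=> [[hu hv hz]|[Cw wD]].
- have [nCw|Cw'] := EM (~ d u `&` d v `<=` d w).
    have nwu : w <> u by move=> e; apply: nCw; rewrite e => x [].
    have nwv : w <> v by move=> e; apply: nCw; rewrite e => x [].
    have {hu} awu : adj w u by case: hu. have {hv} awv : adj w v by case: hv.
    have r1 := spans_rk ((adjE _ _).1 awu); have r2 := spans_rk ((adjE _ _).1 awv).
    have [D' [rD' uD' vD' wD']] := triangle (rV u) (rV v) (rV w) rC r1 r2 nCw.
    have wD : d w `<=` D by rewrite (rk_join_eq (rV u) (rV v) ne gD.1 uD vD rD' uD' vD').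
    exfalso; case/orP: lnm => [/eqP n0|ln2].
      by apply: nCw; move: rC; rewrite n0 => /rk0_eq->.
    have [e [De nDe nHe]] := perp_extra_visible gD ln2.
    have [z ez [azu azv]] := ext e De nDe nHe.
    have nzD : ~ d z `<=` D by move=> h; apply: nDe; apply: h; rewrite ez; exact: join1_in.
    case: (hz z azu azv) => [e'|azw]; first by apply: nzD; rewrite e'.
    apply: nCw; apply: (meetE (d z)) => //; first by rewrite ez; exact: join1_sub.
    exact: spans_rk ((adjE _ _).1 azw).
  move/contrapT: Cw' => Cw; split=> //.
  apply: contrapT => /nonsubset[x [wx nDx]].
  have coll t : w = t \/ adj w t -> forall y, d t y -> collinear x y.
    move=> [<-|/adjE[_ [Z [gZ wZ tZ]]]] y ty; first by case: (rk_strong (rV w)) => _; apply.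
    by case: (rk_strong gZ.1) => _; apply; [exact: wZ|exact: tZ].
  have Dx : perp D x.
    have /nonsubset[y [vy nuy]] : ~ d v `<=` d u by move=> /(rk_eq (rV v) (rV u))/esym.
    rewrite (rk_cover (rV u) gD.1 uD (vD _ vy) nuy); apply/perp_join1; split.
      by move=> z uz; exact: coll hu _ uz.
    exact: coll hv _ vy.
  have [e [De nHe nex]] := perp_witness_visible gD Dx nDx.
  have nDe : ~ D e by move=> h; apply/nex/coll_sym/Dx.
  have [z ez [azu azv]] := ext e De nDe nHe.
  have zx : forall y, d z y -> collinear x y.
    by apply: coll; case: (hz z azu azv) => [->|azw]; [left|right; apply/adjE; case: ((adjE _ _).1 azw) => h [Z [gZ zZ wZ]]; split; [exact: nesym|exists Z]].
  by apply: nex; apply: coll_sym; apply: zx; rewrite ez; exact: join1_in.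
- have inD t : d t `<=` D -> w = t \/ adj w t.
    move=> tD; have [e|nwt] := EM (d w = d t); first by left; exact: (d_inj nV).
    by right; apply/adjE; split=> //; exists D.
  split; [exact: inD|exact: inD|] => z azu azv.
  have [->|nzw] := EM (z = w); [by left|right].
  have nzw' : d z <> d w by move/(d_inj nV).
  have [[nzu [Z1 [gZ1 zZ1 uZ1]]] [nzv [Z2 [gZ2 zZ2 vZ2]]]] := ((adjE _ _).1 azu, (adjE _ _).1 azv).
  apply/adjE; split=> //.
  have [nCz|Cz'] := EM (~ d u `&` d v `<=` d z).
    have r1 := spans_rk ((adjE _ _).1 azu); have r2 := spans_rk ((adjE _ _).1 azv).
    have [D' [rD' uD' vD' zD']] := triangle (rV u) (rV v) (rV z) rC r1 r2 nCz.
    exists D; split=> //.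
    by rewrite (rk_join_eq (rV u) (rV v) ne gD.1 uD vD rD' uD' vD').
  move/contrapT: Cz' => Cz.
  have /nonsubset[x [zx nwx]] : ~ d z `<=` d w by move=> /(rk_eq (rV z) (rV w)).
  have Dx : perp D x.
    have /nonsubset[y [vy nuy]] : ~ d v `<=` d u by move=> /(rk_eq (rV v) (rV u))/esym.
    rewrite (rk_cover (rV u) gD.1 uD (vD _ vy) nuy); apply/perp_join1; split.
      by move=> t ut; case: (rk_strong gZ1.1) => _; apply; [exact: zZ1|exact: uZ1].
    by case: (rk_strong gZ2.1) => _; apply; [exact: zZ2|exact: vZ2].
  have wx : perp (d w) x by move=> y /wD; exact: Dx.
  exists (d w <+ x); split.
  + by apply: (visible_sup (g w)); [exact: rkS (rV w) wx nwx|exact: join1_sub].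
  + have nCx : ~ (d u `&` d v) x by move/Cw.
    rewrite (rk_cover rC (rV z) Cz zx nCx); apply: join1_min; first exact: join1_subspace.
      by move=> y /Cw; exact: join1_sub.
    exact: join1_in.
  + exact: join1_sub.
Qed.

End Pencils.

Section Tops.
Variable n : nat.
Hypothesis nV : names (fun _ : V => True) (visible n.+1) d.

Definition top_dec (c : set V) : set Q := span (union_dec d c).

Lemma top_decE D : visible n.+2 D -> top_dec [set w | d w `<=` D] = D.
Proof.
move=> gD; apply/seteqP; split.
  by apply: span_min => [|x [w wD wx]]; [exact: rk_subspace gD.1|exact: wD].
apply: (visible_sub gD); first exact: span_subspace.
move=> x Dx nHx; have sx : [set x] `<=` D by move=> y ->.
have ln : (1 <= n.+1 <= n.+2)%N by lia.
have [Z [rZ xZ ZD]] := rk_between (rk1 x) gD.1 sx ln.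
have gZ : visible n.+1 Z by split=> //; exists x => //; exact: xZ.
have [w ew] := d_onto nV gZ; apply: sub_span; exists w; first by rewrite /= ew.
by rewrite ew; apply: xZ.
Qed.

Lemma two_tops D : visible n.+2 D ->
  exists u v, [/\ d u <> d v, d u `<=` D & d v `<=` D].
Proof.
move=> gD; have [c Dc _] := gD.2.
have [Z [gZ ZD _]] := visible_avoid gD Dc.
have [z Zz _] := gZ.2; have [Z' [gZ' Z'D nZ'z]] := visible_avoid gD (ZD _ Zz).
have [u eu] := d_onto nV gZ; have [v ev] := d_onto nV gZ'; exists u, v; rewrite eu ev; split=> //.
by move=> e; apply: nZ'z; rewrite -e.
Qed.

Lemma top_code_names (code : set V -> Prop) :
    (forall c, code c -> exists2 D, visible n.+2 D & c = [set w | d w `<=` D]) ->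
    (forall D, visible n.+2 D -> code [set w | d w `<=` D]) ->
  names code (visible n.+2) top_dec /\
  forall w c, True -> code c -> (mem_code c w <-> d w `<=` top_dec c).
Proof.
move=> hc hD; split; first split.
- by move=> c /hc[F gF ->]; rewrite top_decE.
- by move=> c c' /hc[F gF ->] /hc[F' gF' ->]; rewrite !top_decE // => ->.
- by move=> F gF; exists [set w | d w `<=` F]; [exact: hD|exact: top_decE].
- by move=> w c _ /hc[F gF ->]; rewrite top_decE.
Qed.

End Tops.

(** For points the pencil of an edge consists of all the affine points of a line. *)
Lemma pencil_code_names : names (fun _ : V => True) (visible 1) d ->
    (forall u v, adj u v <-> spans 2 u v) ->
  names (pencil_code adj) (visible 2) top_dec /\
  forall w c, True -> pencil_code adj c -> (mem_code c w <-> d w `<=` top_dec c).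
Proof.
move=> nV adjE; apply: (top_code_names nV).
- move=> c [u [v [auv cE]]]; have [_ [D [gD uD vD]]] := (adjE u v).1 auv.
  exists D => //; apply/seteqP; split=> w /=.
    by move/cE/(pencilE nV isT adjE w auv gD uD vD) => -[].
  move=> wD; apply/cE/(pencilE nV isT adjE w auv gD uD vD); split=> //.
  by rewrite (rk0_eq (spans_rk nV ((adjE u v).1 auv))).
- move=> D gD; have [u [v [ne uD vD]]] := two_tops nV gD.
  have auv : adj u v by apply/adjE; split=> //; exists D.
  exists u, v; split=> // w /=; rewrite (pencilE nV isT adjE w auv gD uD vD).
  rewrite (rk0_eq (spans_rk nV ((adjE u v).1 auv))).
  by split=> [wD|[_ wD]]; [split|].
Qed.

(** Vertices adjacent to two hyperplanes of a maximal strong subspace D are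
    perpendicular to D, hence contained in it. *)
Lemma pair_top_names n : m = n.+1 -> names (fun _ : V => True) (visible n.+1) d ->
    (forall u v, adj u v <-> spans n.+2 u v) ->
  names (pair_top adj) (visible n.+2) top_dec /\
  forall w c, True -> pair_top adj c -> (mem_code c w <-> d w `<=` top_dec c).
Proof.
move=> em nV adjE; have g := visible_d nV; have rV x : rk n.+1 (d x) := (g x).1.
have topE u v w D : adj u v -> visible n.+2 D -> d u `<=` D -> d v `<=` D ->
    pair_hull adj u v w <-> d w `<=` D.
  move=> auv gD uD vD; have [ne _] := (adjE u v).1 auv; split.
    case=> [->//|[->//|[/adjE[_ [Z1 [gZ1 wZ1 uZ1]]] /adjE[_ [Z2 [gZ2 wZ2 vZ2]]]]]] x wx.
    apply: max_perp; first by rewrite em; exact: gD.1.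
    have /nonsubset[y [vy nuy]] : ~ d v `<=` d u by move=> /(rk_eq (rV v) (rV u))/esym.
    rewrite (rk_cover (rV u) gD.1 uD (vD _ vy) nuy); apply/perp_join1; split.
      by move=> t ut; case: (rk_strong gZ1.1) => _; apply; [exact: wZ1|exact: uZ1].
    by case: (rk_strong gZ2.1) => _; apply; [exact: wZ2|exact: vZ2].
  move=> wD; have [->|nwu] := EM (w = u); first by left.
  have [->|nwv] := EM (w = v); first by right; left.
  by right; right; split; apply/adjE; (split; last by exists D); move/(d_inj nV).
apply: (top_code_names nV).
- move=> c [u [v [auv cE]]]; have [_ [D [gD uD vD]]] := (adjE u v).1 auv.
  exists D => //; apply/seteqP; split=> w /=; first by move/cE/(topE u v w D auv gD uD vD).
  by move=> wD; apply/cE/(topE u v w D auv gD uD vD).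
- move=> D gD; have [u [v [ne uD vD]]] := two_tops nV gD.
  have auv : adj u v by apply/adjE; split=> //; exists D.
  by exists u, v; split=> // w; split=> h; apply/(topE u v w D auv gD uD vD).
Qed.

Section Meeting.
Variable n : nat.
Hypothesis nV : names (fun _ : V => True) (visible n.+2) d.
Hypothesis lnm : (n.+3 <= m)%N.
Hypothesis adjE : forall u v, adj u v <-> spans n.+3 u v.

(** If the meet C of u and v is in H, take e not containing C, a member u' of
    the pencil of e and u, and the member v' of the pencil of e and v parallel
    to u'.  A common member of the pencils of u, v and of u', v' would have both C
    and the meet of u' and v' as its trace in H, whence u and u' would be equal.
    If C is visible, the Veblen axiom holds for the two pencils, either in
    the dual of D or in the quotient of the join of D and e by C. *)
Lemma meetingE u v : meeting adj u v <-> spans n.+3 u v /\ visible n.+1 (d u `&` d v).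
Proof.
have g := visible_d nV; have rV x : rk n.+2 (d x) := (g x).1.
have lnm' : (n.+1 == 0%N) || (n.+3 <= m)%N by [].
have pE := pencilE nV lnm' adjE.
have inD D x y : visible n.+3 D -> d x `<=` D -> d y `<=` D -> d x <> d y -> adj x y.
  by move=> gD xD yD ne; apply/adjE; split=> //; exists D.
split=> [[auv ngap]|[suv gC]].
  have suv := (adjE u v).1 auv; split=> //.
  have rC := spans_rk nV suv; have [ne [D [gD uD vD]]] := suv.
  set C := d u `&` d v in rC *.
  have Cu : C `<=` d u by move=> x []. have Cv : C `<=` d v by move=> x [].
  split=> //; apply: contrapT => none; apply: ngap.
  have CH : C `<=` H by move=> x Cx; apply: contrapT => nHx; apply: none; exists x.
  have [c Cc _] := rk_lt_nonsub rk0 rC isT.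
  have [E [gE ED nEc]] := visible_avoid gD (uD _ (Cu _ Cc)).
  have [e ee] := d_onto nV gE; rewrite -ee in ED nEc => {gE}.
  have euH := visible_trace_eq (g u) rC Cu CH; have evH := visible_trace_eq (g v) rC Cv CH.
  have npu : d e `&` H <> d u `&` H.
    by rewrite euH => h; apply: nEc; have : C c by []; rewrite -h => -[].
  have npv : d e `&` H <> d v `&` H.
    by rewrite evH => h; apply: nEc; have : C c by []; rewrite -h => -[].
  have [neu gP1] := nonpar_meet gD.1 (g e) (g u) ED uD npu.
  have [nev gP2] := nonpar_meet gD.1 (g e) (g v) ED vD npv.
  have aeu := inD D e u gD ED uD neu; have aev := inD D e v gD ED vD nev.
  have [U' [rU' nU'e nU'u P1U' U'D]] := pencil3 gP1.1 gD.1 (rV e) (rV u) neu (@subIsetl _ _ _) (@subIsetr _ _ _) ED uD.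
  have gU' := visible_sup gP1 rU' P1U'; have [u' eu'] := d_onto nV gU'.
  have eP : (d e `&` d u) `&` H = (d e `&` d v) `&` H by rewrite -!setIA euH evH.
  have P2D : d e `&` d v `<=` D by move=> x [/ED].
  have [V' [visible_d' P2V' V'D eV'H]] := par_transfer gP1 gP2 gD.1 P2D eP gU' P1U' U'D.
  have [v' ev'] := d_onto nV visible_d'.
  have [p [ep up] nHp] := gP1.2; have U'p := P1U' _ (conj ep up).
  have nU'uH : U' `&` H <> d u `&` H.
    by move=> h; apply: nU'u; exact: (trace_eq gU' (g u) h U'p up nHp).
  have nP : d e `&` d u <> d e `&` d v.
    by move=> h; apply: nHp; apply: CH; split=> //; have : (d e `&` d u) p by []; rewrite h => -[].
  have nUV' : U' <> V'.
    move=> h; apply: nP; apply/esym/(rk_eq gP2.1 gP1.1).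
    by rewrite -(inter_cover gP1.1 rU' (rV e) P1U' (@subIsetl _ _ _) nU'e) => x Px; split; [rewrite h; exact: P2V'|case: Px].
  exists e, u', v'; split.
  - by split=> //; move=> /(pE u v e D auv gD uD vD)[/(_ c Cc) h _]; exact: nEc h.
  - split; first by apply/(pE e u u' D aeu gD ED uD); rewrite eu'.
    + by move=> h; apply: nU'e; rewrite -eu' h.
    + by move=> h; apply: nU'u; rewrite -eu' h.
  - split; first by apply/(pE e v v' D aev gD ED vD); rewrite ev'.
    + move=> h; apply: nU'e; apply: (trace_eq gU' (g e) _ U'p ep nHp).
      by rewrite -eV'H -ev' h.
    + by move=> h; apply: nU'uH; rewrite -eV'H -ev' h evH euH.
  - move=> w /(pE u v w D auv gD uD vD)[Cw wD].
    have nuv' : d u' <> d v' by rewrite eu' ev'.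
    have u'D : d u' `<=` D by rewrite eu'. have v'D : d v' `<=` D by rewrite ev'.
    have auv' := inD D u' v' gD u'D v'D nuv'.
    move=> /(pE u' v' w D auv' gD u'D v'D)[Iw _].
    have rI := spans_rk nV ((adjE _ _).1 auv').
    have eH' : d u' `&` H = d v' `&` H by rewrite eu' ev' eV'H.
    have IH := par_meet gD.1 (g u') (g v') u'D v'D nuv' eH'.
    apply: nU'uH; rewrite euH -(visible_trace_eq (g w) rC Cw CH) (visible_trace_eq (g w) rI Iw IH).
    by rewrite -eu'; apply: (visible_trace_eq (g u') rI) => // x [].
have auv := (adjE u v).2 suv; split=> //.
have [ne [D [gD uD vD]]] := suv.
set C := d u `&` d v in gC.
have Cu : C `<=` d u by move=> x []. have Cv : C `<=` d v by move=> x [].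
have CD : C `<=` D by move=> x /Cu/uD.
move=> [e [u' [v' [[aeu aev npe] [peu nu'e nu'u] [pev nv'e nv'v] gap]]]].
have [neu [D1 [gD1 eD1 uD1]]] := (adjE _ _).1 aeu.
have [nev [D2 [gD2 eD2 vD2]]] := (adjE _ _).1 aev.
have [P1u' u'D1] := (pE e u u' D1 aeu gD1 eD1 uD1).1 peu.
have [P2v' v'D2] := (pE e v v' D2 aev gD2 eD2 vD2).1 pev.
have nu'e' : d u' <> d e by move/(d_inj nV).
have nv'e' : d v' <> d e by move/(d_inj nV).
have rP1 := spans_rk nV ((adjE _ _).1 aeu); have rP2 := spans_rk nV ((adjE _ _).1 aev).
have [Ce|nCe] := EM (C `<=` d e); last first.
  have rP1' : rk n.+1 (d e `&` d u) by []. have rP2' : rk n.+1 (d e `&` d v) by [].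
  have [D' [rD' uD' vD' eD']] := triangle (rV u) (rV v) (rV e) gC.1 rP1' rP2' nCe.
  have eD : d e `<=` D by rewrite (rk_join_eq (rV u) (rV v) ne gD.1 uD vD rD' uD' vD').
  have u'D : d u' `<=` D by rewrite -(rk_join_eq (rV e) (rV u) neu gD1.1 eD1 uD1 gD.1 eD uD).
  have v'D : d v' `<=` D by rewrite -(rk_join_eq (rV e) (rV v) nev gD2.1 eD2 vD2 gD.1 eD vD).
  have nP : d e `&` d u <> d e `&` d v.
    move=> h; apply: nCe; rewrite -(rk_eq rP1 gC.1) => x //; first by case.
    by move=> Px; split; [case: Px|move: Px; rewrite h => -[]].
  have nuv' : d u' <> d v'.
    move=> h; apply: nP; apply/esym/(rk_eq rP2 rP1).
    by rewrite -(inter_cover rP1 (rV u') (rV e) P1u' (@subIsetl _ _ _) nu'e') => x Px; split; [rewrite h; exact: P2v'|case: Px].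
  have auv' := inD D u' v' gD u'D v'D nuv'.
  have rI := spans_rk nV ((adjE _ _).1 auv').
  have [c [Cc nec]] := nonsubset nCe.
  have [rP _] := rk_section gC.1 (rk_subspace (rV e)) (blocks_sub CD (blocks_hyp (rV e) gD.1 eD)) Cc nec.
  have PC : C `&` d e `<=` C by move=> x [].
  have PI : C `&` d e `<=` d u' `&` d v'.
    by move=> x [[ux vx] ex]; split; [exact: P1u'|exact: P2v'].
  have ID : d u' `&` d v' `<=` D by move=> x [/u'D].
  have [Z [rZ CZ IZ ZD]] := coplanar_meet gC.1 rI rP PC PI gD.1 CD ID (rV u) Cu uD.
  have [w ew] := d_onto nV (visible_sup gC rZ CZ).
  apply: (gap w); first by apply/(pE u v w D auv gD uD vD); rewrite ew.
  by apply/(pE u' v' w D auv' gD u'D v'D); rewrite ew.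
have neD : ~ d e `<=` D by move=> eD; apply: npe; apply/(pE u v e D auv gD uD vD).
have [e0 [ee0 nDe0]] := nonsubset neD.
have nue0 : ~ d u e0 by move/uD. have nve0 : ~ d v e0 by move/vD.
have De0 : perp D e0.
  have /nonsubset[y [vy nuy]] : ~ d v `<=` d u by move=> /(rk_eq (rV v) (rV u))/esym.
  rewrite (rk_cover (rV u) gD.1 uD (vD _ vy) nuy); apply/perp_join1; split.
    by move=> t ut; case: (rk_strong gD1.1) => _; apply; [exact: eD1|exact: uD1].
  by case: (rk_strong gD2.1) => _; apply; [exact: eD2|exact: vD2].
have rS := rkS gD.1 De0 nDe0; set S := D <+ e0 in rS.
have DS : D `<=` S by exact: join1_sub.
have D1S : D1 `<=` S.
  rewrite (rk_cover (rV u) gD1.1 uD1 (eD1 _ ee0) nue0); apply: join1_min; [exact: join1_subspace|by move=> x /uD/DS|exact: join1_in].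
have D2S : D2 `<=` S.
  rewrite (rk_cover (rV v) gD2.1 vD2 (eD2 _ ee0) nve0); apply: join1_min; [exact: join1_subspace|by move=> x /vD/DS|exact: join1_in].
have Cu' : C `<=` d u' by move=> x Cx; apply: P1u'; split; [exact: Ce|exact: Cu].
have Cv' : C `<=` d v' by move=> x Cx; apply: P2v'; split; [exact: Ce|exact: Cv].
have nD12 : D1 <> D2.
  move=> h; apply: neD.
  by rewrite -(rk_join_eq (rV u) (rV v) ne gD1.1 uD1 _ gD.1 uD vD) // h.
have nuv' : d u' <> d v'.
  move=> h; apply: nu'e'; apply: (rk_eq (rV u') (rV e)).
  rewrite -(inter_cover (rV e) gD1.1 gD2.1 eD1 eD2 nD12) => x ux; split; first exact: u'D1.
  by apply: v'D2; rewrite -h.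
have u'S : d u' `<=` S by move=> x /u'D1/D1S.
have v'S : d v' `<=` S by move=> x /v'D2/D2S.
have /nonsubset[y [v'y nu'y]] : ~ d v' `<=` d u' by move=> /(rk_eq (rV v') (rV u'))/esym.
have [rD3 D3S] := rk_joinIn (rV u') rS u'S (v'S _ v'y) nu'y.
set D3 := d u' <+ y in rD3 D3S.
have u'D3 : d u' `<=` D3 by exact: join1_sub.
have gD3 := visible_sup (g u') rD3 u'D3.
have eI : d u' `&` d v' = C by exact: (inter_cover gC.1 (rV u') (rV v') Cu' Cv' nuv').
have v'D3 : d v' `<=` D3.
  have nCy : ~ C y by move/Cu'.
  rewrite (rk_cover gC.1 (rV v') Cv' v'y nCy); apply: join1_min; [exact: join1_subspace|by move=> x /Cu'/u'D3|exact: join1_in].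
have auv' := inD D3 u' v' gD3 u'D3 v'D3 nuv'.
have [Z [gZ CZ ZD ZD3]] : exists Z, [/\ visible n.+2 Z, C `<=` Z, Z `<=` D & Z `<=` D3].
  have [<-|nD3] := EM (D = D3); first by exists (d u); split=> //; exact: g.
  have CDD : C `<=` D `&` D3 by move=> x Cx; split; [exact: CD|by apply: u'D3; apply: Cu'].
  exists (D `&` D3); split=> //.
  exact: visible_sup gC (rk_meet gD.1 rD3 rS DS D3S nD3) CDD.
have [w ew] := d_onto nV gZ.
apply: (gap w); first by apply/(pE u v w D auv gD uD vD); rewrite ew.
by apply/(pE u' v' w D3 auv' gD3 u'D3 v'D3); rewrite ew eI.
Qed.

End Meeting.

Section Cliques.
Variable n : nat.
Hypothesis nV : names (fun _ : V => True) (visible n.+2) d.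
Hypothesis lnm : (n.+3 <= m)%N.
Hypothesis adjE : forall u v, adj u v <-> spans n.+3 u v /\ visible n.+1 (d u `&` d v).

Definition between C Y : set V := [set w | C `<=` d w /\ d w `<=` Y].

Let g := visible_d nV.
Let rV x : rk n.+2 (d x) := (g x).1.

Lemma adj_between C Y p u v : visible n.+1 C -> rk p Y -> between C Y u -> between C Y v -> u <> v ->
  adj u v.
Proof.
move=> gC rY [Cu uY] [Cv vY] ne; have ne' : d u <> d v by move/(d_inj nV).
apply/adjE; rewrite (inter_cover gC.1 (rV u) (rV v) Cu Cv ne'); split=> //; split=> //.
have /nonsubset[y [vy nuy]] : ~ d v `<=` d u by move=> /(rk_eq (rV v) (rV u))/esym.
have [rZ ZY] := rk_joinIn (rV u) rY uY (vY _ vy) nuy.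
exists (d u <+ y); split; [|exact: join1_sub|].
  by apply: (visible_sup (g u) rZ); exact: join1_sub.
have nCy : ~ C y by move/Cu.
rewrite (rk_cover gC.1 (rV v) Cv vy nCy); apply: join1_min; [exact: join1_subspace|by move=> x /Cu; exact: join1_sub|exact: join1_in].
Qed.

Lemma adj_coll u v x y : adj u v -> d u x -> d v y -> collinear x y.
Proof.
move=> /adjE[[_ [Z [gZ uZ vZ]]] _] ux vy.
by case: (rk_strong gZ.1) => _; apply; [exact: uZ|exact: vZ].
Qed.

Lemma adj_triangle u v w : adj u v -> adj w u -> adj w v -> ~ d u `&` d v `<=` d w ->
  exists D, [/\ rk n.+3 D, d u `<=` D, d v `<=` D & d w `<=` D].
Proof.
move=> /adjE[_ g1] /adjE[_ g2] /adjE[_ g3].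
exact: (triangle (rV u) (rV v) (rV w) g1.1 g2.1 g3.1).
Qed.

Lemma named_ext C y : visible n.+1 C -> perp C y -> ~ C y -> exists u, d u = C <+ y.
Proof.
move=> gC Cy nCy; apply: (d_onto nV); apply: (visible_sup gC (rkS gC.1 Cy nCy)).
exact: join1_sub.
Qed.

Lemma two_between C Y : visible n.+1 C -> rk m.+1 Y -> C `<=` Y -> forall u1,
  exists2 u, between C Y u & u <> u1.
Proof.
move=> gC rY CY u1.
have ln : (n.+1 <= n.+3 <= m.+1)%N by lia.
have [A [rA CA AY]] := rk_between gC.1 rY CY ln.
have [C1 [C2 [r1 r2 ne [CC1 C1A CC2 C2A]]]] := pencil2 gC.1 rA CA.
have [v1 e1] := d_onto nV (visible_sup gC r1 CC1); have [v2 e2] := d_onto nV (visible_sup gC r2 CC2).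
have [e|ne1] := EM (v1 = u1); last first.
  by exists v1 => //; split; rewrite e1 // => x /C1A/AY.
exists v2; first by split; rewrite e2 // => x /C2A/AY.
by move=> h; apply: ne; rewrite -e1 -e2 e h.
Qed.

(** If w contains C and is adjacent to all members of the interval except u1, then it
    is perpendicular to Y, as Y is generated by the points outside u1.
    If w does not contain C, then [triangle] puts it into the span of any
    two members other than u1, and three independent ones leave no room. *)
Lemma two_nonadj C Y w u1 : visible n.+1 C -> rk m.+1 Y -> C `<=` Y -> ~ between C Y w ->
  between C Y u1 -> exists v, [/\ between C Y v, v <> u1 & ~ adj w v].
Proof.
move=> gC rY CY nw [Cu1 u1Y]; apply: contrapT => none.
have h v : C `<=` d v -> d v `<=` Y -> d v <> d u1 -> adj w v.
  move=> Cv vY ne; apply: contrapT => na; apply: none; exists v; split=> //.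
  by move=> e; apply: ne; rewrite e.
have Yp y : Y y -> perp C y by move=> Yy; exact: (rk_sub_perp rY CY).
have lt : (n.+2 < m.+1)%N by lia.
have [y2 Yy2 nu1y2] := rk_lt_nonsub (rV u1) rY lt.
have sub y u : Y y -> d u = C <+ y -> d u `<=` Y.
  by move=> Yy ->; apply: join1_min => //; exact: rk_subspace rY.
have [Cw|nCw] := EM (C `<=` d w).
  apply: nw; split=> // x wx; apply: (max_perp rY).
  have off y : Y y -> ~ d u1 y -> collinear x y.
    move=> Yy nu1y; have nCy : ~ C y by move/Cu1.
    have [u eu] := named_ext gC (Yp y Yy) nCy.
    have uy : d u y by rewrite eu; exact: join1_in.
    apply: (@adj_coll w u) => //; apply: h; [by rewrite eu; exact: join1_sub|exact: sub eu|].
    by move=> e; apply: nu1y; rewrite -e.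
  move=> y Yy; have [u1y|] := EM (d u1 y); last exact: off.
  have nyy2 : y <> y2 by move=> e; apply: nu1y2; rewrite -e.
  have [L [LL Ly Ly2 sL]] := line_in (rk_strong rY) Yy Yy2 nyy2.
  have [y3 [Ly3 n3 n32]] := line_third y y2 LL.
  have nu1y3 : ~ d u1 y3.
    by move=> h3; apply: nu1y2; apply: (rk_subspace (rV u1) LL Ly Ly3 (nesym n3)).
  by apply: (coll_two LL Ly2 Ly3 (nesym n32) _ _ Ly); apply: off => //; exact: sL.
have nCy2 : ~ C y2 by move/Cu1.
have [u2 eu2] := named_ext gC (Yp _ Yy2) nCy2.
have u2Y := sub _ _ Yy2 eu2.
have Cu2 : C `<=` d u2 by rewrite eu2; exact: join1_sub.
have n21 : d u2 <> d u1 by move=> e; apply: nu1y2; rewrite -e eu2; exact: join1_in.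
have [rD0 D0Y] := rk_joinIn (rV u1) rY u1Y Yy2 nu1y2.
set D0 := d u1 <+ y2 in rD0 D0Y.
have u1D0 : d u1 `<=` D0 by exact: join1_sub.
have CD0 : C `<=` D0 by move=> x /Cu1/u1D0.
have u2D0 : d u2 `<=` D0.
  by rewrite eu2; apply: join1_min; [exact: join1_subspace|exact: CD0|exact: join1_in].
(* With u3 in the span of u1 and u2, any u4 outside of that span differs from u1. *)
have [U3 [r3 n31 n32 CU3 U3D0]] := pencil3 gC.1 rD0 (rV u1) (rV u2) (nesym n21) Cu1 Cu2 u1D0 u2D0.
have [u3 eu3] := d_onto nV (visible_sup gC r3 CU3); rewrite -eu3 in n31 n32 CU3 U3D0.
have a2 := h u2 Cu2 u2Y n21.
have a3 : adj w u3 by apply: h => // x /U3D0/D0Y.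
have b2 : between C Y u2 by [].
have b3 : between C Y u3 by split=> // x /U3D0/D0Y.
have a23 : adj u2 u3.
  by apply: (adj_between gC rY b2 b3) => e; apply: n32; rewrite e.
have e23 := inter_cover gC.1 (rV u2) (rV u3) Cu2 CU3 (nesym n32).
have nI : ~ d u2 `&` d u3 `<=` d w by rewrite e23.
have [D [rD u2D u3D wD]] := adj_triangle a23 a2 a3 nI.
have wD0 : d w `<=` D0.
  by rewrite (rk_join_eq (rV u2) (rV u3) (nesym n32) rD0 u2D0 U3D0 rD u2D u3D).
have lt4 : (n.+3 < m.+1)%N by lia.
have [y4 Yy4 nD0y4] := rk_lt_nonsub rD0 rY lt4.
have nCy4 : ~ C y4 by move/CD0.
have [u4 eu4] := named_ext gC (Yp _ Yy4) nCy4.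
have u4Y := sub _ _ Yy4 eu4.
have u4y4 : d u4 y4 by rewrite eu4; exact: join1_in.
have Cu4 : C `<=` d u4 by rewrite eu4; exact: join1_sub.
have n41 : d u4 <> d u1 by move=> e; apply: nD0y4; apply: u1D0; rewrite -e.
have n24 : d u2 <> d u4 by move=> e; apply: nD0y4; apply: u2D0; rewrite e.
have a4 := h u4 Cu4 u4Y n41.
have b4 : between C Y u4 by [].
have a24 : adj u2 u4 by apply: (adj_between gC rY b2 b4) => e; apply: n24; rewrite e.
have nI4 : ~ d u2 `&` d u4 `<=` d w by rewrite (inter_cover gC.1 (rV u2) (rV u4) Cu2 Cu4 n24).
have [D' [rD' u2D' u4D' wD']] := adj_triangle a24 a2 a4 nI4.
have nD : D0 <> D' by move=> e; apply: nD0y4; rewrite e; exact: u4D'.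
apply: nCw; rewrite (_ : d w = d u2) //; apply: (rk_eq (rV w) (rV u2)).
rewrite -(inter_cover (rV u2) rD0 rD' u2D0 u2D' nD) => x wx; split; [exact: wD0|exact: wD'].
Qed.

Lemma between_star C Y : visible n.+1 C -> rk m.+1 Y -> C `<=` Y -> star_clique adj (between C Y).
Proof.
move=> gC rY CY; have two := two_nonadj gC rY CY; split; first split.
- by move=> u v Ku Kv; exact: (adj_between gC rY Ku Kv).
- move=> w hw; apply: contrapT => nw.
  have [u1 Ku1 _] := two_between gC rY CY w.
  have [v [Kv _ na]] := two w u1 nw Ku1.
  by apply/na/hw => // e; apply: nw; rewrite -e.
- move=> [w [u [nw Ku _ hv]]]; have [v [Kv nvu na]] := two w u nw Ku.
  exact/na/hv.
Qed.

(** If all members of K contain the meet C of two of them, K is an interval by maximality.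
    Otherwise [triangle] puts K into one D, and a hyperplane w of D parallel
    to a member u1 is adjacent to all the other members, as these are not
    parallel to u1. *)
Lemma star_between K : star_clique adj K ->
  exists C Y, [/\ visible n.+1 C, rk m.+1 Y, C `<=` Y & K = between C Y].
Proof.
move=> [[cl mx] crit].
have [u1 K1] : exists u, K u.
  apply: contrapT => none; apply: (none).
  have [x nHx] : exists x, ~ H x.
    by apply: contrapT => h; case: hypH => _ nT _; apply: nT; apply/seteqP; split=> // x _; apply: contrapT => nHx; apply: h; exists x.
  have g1 : visible 1 [set x] by split; [exact: rk1|exists x].
  have [X gX _] : exists2 X, visible n.+2 X & [set x] `<=` X by apply: (visible_extend g1); lia.
  have [w _] := d_onto nV gX; exists w; apply: mx => u Ku.
  by case: none; exists u.
have [u2 [K2 n21]] : exists u, K u /\ u <> u1.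
  apply: contrapT => none.
  have [C gC Cu] : exists2 C, visible n.+1 C & C `<=` d u1 by apply: (visible_parts (g u1)); lia.
  have [e u1e nu1e] := perp_extra (rV u1) (ltnW lnm).
  have nCe : ~ C e by move/Cu.
  have Ce : perp C e by move=> x /Cu; exact: u1e.
  have [w ew] := named_ext gC Ce nCe.
  have nwu : w <> u1 by move=> h; apply: nu1e; rewrite -h ew; exact: join1_in.
  apply: (none); exists w; split=> //; apply: mx => u Ku nuw.
  have [->|nu] := EM (u = u1); last by exfalso; apply: none; exists u.
  apply: (adj_between gC (rkS (rV u1) u1e nu1e)) => //.
  - split; first by rewrite ew; exact: join1_sub.
    by rewrite ew; apply: join1_min; [exact: join1_subspace|by move=> x /Cu; exact: join1_sub|exact: join1_in].
  - by split=> //; exact: join1_sub.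
have a12 : adj u1 u2 by apply: cl => //; exact: nesym.
have [[n12 [D [gD D1 D2]]] gC] := (adjE u1 u2).1 a12.
set C := d u1 `&` d u2 in gC.
have [all|] := EM (forall u, K u -> C `<=` d u).
  have cliq : union_dec d K `<=` perp (union_dec d K).
    move=> x [u Ku ux] y [v Kv vy].
    have [e|ne] := EM (u = v); last exact: adj_coll (cl u v Ku Kv ne) ux vy.
    by case: (rk_strong (rV u)) => _; apply=> //; rewrite e.
  have [p lp rp] := strong_rk (span_strong cliq).
  have [Y rY XY] : exists2 Y, rk m.+1 Y & span (union_dec d K) `<=` Y.
    by apply: (rk_extend rp); rewrite lp /=.
  have uY u : K u -> d u `<=` Y.
    by move=> Ku x ux; apply: XY; apply: sub_span; exists u.
  exists C, Y; split=> //; first by move=> x [x1 _]; exact: uY x1.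
  apply/seteqP; split=> w; first by move=> Kw; split; [exact: all|exact: uY].
  move=> bw; apply: mx => u Ku nuw; apply: (adj_between gC rY bw) => [|e]; last exact: nuw.
  by split; [exact: all|exact: uY].
move=> /existsNP[u3 /not_implyP[K3 nC3]].
have n31 : u3 <> u1 by move=> e; apply: nC3; rewrite e => x [].
have n32 : u3 <> u2 by move=> e; apply: nC3; rewrite e => x [].
have a31 := cl _ _ K3 K1 n31; have a32 := cl _ _ K3 K2 n32.
have inD u : K u -> d u `<=` D.
  have tri v w : K v -> K w -> v <> w -> d v `<=` D -> d w `<=` D -> K u ->
      ~ d v `&` d w `<=` d u -> d u `<=` D.
    move=> Kv Kw nvw vD wD Ku nI.
    have nuv : u <> v by move=> e; apply: nI; rewrite e => x [].
    have nuw : u <> w by move=> e; apply: nI; rewrite e => x [].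
    have [D' [rD' vD' wD' uD']] := adj_triangle (cl _ _ Kv Kw nvw) (cl _ _ Ku Kv nuv) (cl _ _ Ku Kw nuw) nI.
    have nvw' : d v <> d w by move/(d_inj nV).
    by rewrite (rk_join_eq (rV v) (rV w) nvw' gD.1 vD wD rD' vD' wD').
  have D3 : d u3 `<=` D.
    have [D' [rD' vD' wD' uD']] := adj_triangle a12 a31 a32 nC3.
    by rewrite (rk_join_eq (rV u1) (rV u2) n12 gD.1 D1 D2 rD' vD' wD').
  move=> Ku; have [Cu|nCu] := EM (C `<=` d u); last first.
    by apply: (tri u1 u2) => // e; apply: n21.
  have [Iu|nIu] := EM (d u1 `&` d u3 `<=` d u); last first.
    by apply: (tri u1 u3) => // e; apply: n31.
  suff -> : d u = d u1 by [].
  have [_ gI] := (adjE _ _).1 a31; rewrite setIC in gI.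
  have /nonsubset[x [[x1 x3] nCx]] : ~ d u1 `&` d u3 `<=` C.
    by move/(rk_eq gI.1 gC.1) => e; apply: nC3; rewrite -e => y [].
  apply/esym/(rk_eq (rV u1) (rV u)).
  rewrite (rk_cover gC.1 (rV u1) (@subIsetl _ _ _) x1 nCx); apply: join1_min => //.
  - exact: rk_subspace (rV u).
  - by apply: Iu.
exfalso; apply: crit.
have n_D1 : ~ D `<=` d u1 by move/(rk_leq gD.1 (rV u1)); rewrite ltnn.
have [a [Da n1a nHa]] := visible_off gD (rk_subspace (rV u1)) n_D1.
have rT := visible_rkH (g u1).
have TD : d u1 `&` H `<=` D by move=> x [/D1].
(* The hyperplane w of D is parallel to u1. *)
have [rW WD] := rk_joinIn rT gD.1 TD Da (fun h => n1a h.1).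
have gW : visible n.+2 ((d u1 `&` H) <+ a) by split=> //; exists a => //; exact: join1_in.
have [w ew] := d_onto nV gW; rewrite -ew in WD.
have wa : d w a by rewrite ew; exact: join1_in.
have nw1 : d w <> d u1 by move=> e; apply: n1a; rewrite -e.
have ewH : d w `&` H = d u1 `&` H.
  by apply: (visible_trace_eq (g w) rT); [rewrite ew; exact: join1_sub|move=> x []].
have IH := par_meet gD.1 (g w) (g u1) WD D1 nw1 ewH.
have nadj : ~ adj w u1.
  by move/adjE => [_ [_ [x Ix nHx]]]; apply: nHx; exact: IH.
exists w, u1; split=> //.
- by move=> Kw; apply: nadj; apply: cl => // e; apply: nw1; rewrite e.
- move=> v Kv nv1; have vD := inD v Kv.
  have [[n1v _] [_ [x [vx ux] nHx]]] := (adjE _ _).1 (cl _ _ Kv K1 nv1).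
  have npar : d w `&` H <> d v `&` H.
    move=> e; apply: n1v; apply: (trace_eq (g v) (g u1) _ vx ux nHx).
    by rewrite -e ewH.
  have [nwv gI] := nonpar_meet gD.1 (g w) (g v) WD vD npar.
  by apply/adjE; split=> //; split=> //; exists D.
Qed.

(** Given w over C, choose x in w outside Y; then C is contained in the hyperplane
    Y `&` x^perp of Y, and its join with x is a maximal subspace that
    contains w. *)
Lemma share_between C Y w : visible n.+1 C -> rk m.+1 Y -> C `<=` Y ->
  (exists K' u v, [/\ star_clique adj K', K' w, u <> v, between C Y u /\ between C Y v & K' u /\ K' v])
  <-> C `<=` d w.
Proof.
move=> gC rY CY; split.
  move=> [K' [u [v [/star_between[C' [Y' [gC' rY' CY' ->]]] [Cw _] nuv [[Cu _] [Cv _]] [[C'u _] [C'v _]]]]]].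
  have nuv' : d u <> d v by move/(d_inj nV).
  by rewrite -(inter_cover gC.1 (rV u) (rV v) Cu Cv nuv') (inter_cover gC'.1 (rV u) (rV v) C'u C'v nuv').
move=> Cw.
(* X is the hyperplane of Y perpendicular to x, and Y' its join with x. *)
have [X [p [Y' [rX le CX XY [rY' wY' XY']]]]] : exists X p Y', [/\ rk p X, (n.+3 <= p)%N, C `<=` X, X `<=` Y &
    [/\ rk m.+1 Y', d w `<=` Y' & X `<=` Y']].
  have [wY|/nonsubset[x [wx nYx]]] := EM (d w `<=` Y).
    by exists Y, m.+1, Y; split=> //; [lia|split].
  have [b [Yb nb]] : Y `&` ~` perp [set x] !=set0.
    apply: nonsubset => h; apply: nYx; apply: (max_perp rY) => y Yy.
    by apply: coll_sym; apply: (h y Yy).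
  have [rX _] := rk_section rY (@perp_subspace _) (@blocks_perp x _) Yb nb.
  set X := Y `&` perp [set x] in rX.
  have Xx : perp X x by move=> y [_ xy]; apply: coll_sym; apply: xy.
  have nXx : ~ X x by move=> [].
  have rXx := rkS rX Xx nXx.
  have CX : C `<=` X.
    move=> y Cy; split; first exact: CY.
    by move=> z ->; case: (rk_strong (rV w)) => _; apply=> //; exact: Cw.
  exists X, m, (X <+ x); split=> //; first by move=> y [].
  split=> //; last exact: join1_sub.
  have nCx : ~ C x by move/CX.
  rewrite (rk_cover gC.1 (rV w) Cw wx nCx); apply: join1_min; [exact: join1_subspace|by move=> y /CX; exact: join1_sub|exact: join1_in].
have CY' : C `<=` Y' by move=> y /CX/XY'.
have ln : (n.+1 <= n.+3 <= p)%N by lia.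
have [A [rA CA AX]] := rk_between gC.1 rX CX ln.
have [C1 [C2 [r1 r2 ne [CC1 C1A CC2 C2A]]]] := pencil2 gC.1 rA CA.
have [u eu] := d_onto nV (visible_sup gC r1 CC1); have [v ev] := d_onto nV (visible_sup gC r2 CC2).
rewrite -eu -ev in ne CC1 CC2 C1A C2A.
have uX : d u `<=` X by move=> y /C1A/AX. have vX : d v `<=` X by move=> y /C2A/AX.
exists (between C Y'), u, v; split=> //.
- exact: between_star.
- by move=> e; apply: ne; rewrite e.
- by split; split=> // y; [move/uX/XY|move/vX/XY].
- by split; split=> // y; [move/uX/XY'|move/vX/XY'].
Qed.

Lemma clique_star_names : names (clique_star adj) (visible n.+1) (star_dec d) /\
  forall c w, clique_star adj c -> True -> (mem_code c w <-> star_dec d c `<=` d w).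
Proof.
apply: (star_code_names nV); first by lia.
- move=> c [K [/star_between[C [Y [gC rY CY ->]]] cE]].
  exists C => //; apply/seteqP; split=> w /=; first by move/cE/(share_between w gC rY CY).
  by move=> Cw; apply/cE/(share_between w gC rY CY).
- move=> F gF.
  have [Y rY FY] : exists2 Y, rk m.+1 Y & F `<=` Y by apply: (rk_extend gF.1); lia.
  exists (between F Y); split; first exact: between_star.
  by move=> w; rewrite (share_between w gF rY FY).
Qed.

End Cliques.

(** For m = n + 2 a vertex adjacent to two hyperplanes of a maximal D is contained
    in D.  Conversely, two parallel hyperplanes u, v of D have common
    neighbours a, b that are not parallel to each other: b is a third
    member of the pencil of a and u. *)
Lemma twice_adjE n : m = n.+2 -> names (fun _ : V => True) (visible n.+2) d ->
    (forall u v, adj u v <-> spans n.+3 u v /\ visible n.+1 (d u `&` d v)) ->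
  forall u v, twice_adj adj u v <-> spans n.+3 u v.
Proof.
move=> em nV adjE u v; have g := visible_d nV; have rV x : rk n.+2 (d x) := (g x).1.
split=> [[ne h]|[ne [D [gD uD vD]]]].
  have ne' : d u <> d v by move/(d_inj nV).
  case: h => [/adjE[]//|[a [b [ab [au bu] [av bv]]]]].
  have [[nab [D [gD aD bD]]] _] := (adjE a b).1 ab.
  have inD w : adj a w -> adj b w -> d w `<=` D.
    move=> /adjE[[_ [Z1 [gZ1 aZ1 wZ1]]] _] /adjE[[_ [Z2 [gZ2 bZ2 wZ2]]] _] x wx.
    apply: max_perp; first by rewrite em; exact: gD.1.
    have /nonsubset[y [vy nuy]] : ~ d b `<=` d a by move=> /(rk_eq (rV b) (rV a))/esym.
    rewrite (rk_cover (rV a) gD.1 aD (bD _ vy) nuy); apply/perp_join1; split.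
      by move=> t ut; case: (rk_strong gZ1.1) => _; apply; [exact: wZ1|exact: aZ1].
    by case: (rk_strong gZ2.1) => _; apply; [exact: wZ2|exact: bZ2].
  by split=> //; exists D; split=> //; apply: inD.
have adjD x y : d x `<=` D -> d y `<=` D -> d x `&` H <> d y `&` H -> adj x y.
  move=> xD yD np; have [nxy gI] := nonpar_meet gD.1 (g x) (g y) xD yD np.
  by apply/adjE; split=> //; split=> //; exists D.
split; first by move=> e; apply: ne; rewrite e.
have [e|np] := EM (d u `&` H = d v `&` H); last by left; exact: adjD.
right; have rT := visible_rkH (g u).
have [c [uc Hc] _] := rk_lt_nonsub rk0 rT isT.
have [A [gA AD nAc]] := visible_avoid gD (uD _ uc).
have [a ea] := d_onto nV gA; rewrite -ea in AD nAc.
have npa : d a `&` H <> d u `&` H by move=> h; apply: nAc; have : (d u `&` H) c by []; rewrite -h => -[].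
have [nau gI] := nonpar_meet gD.1 (g a) (g u) AD uD npa.
have [B [rB nBa nBu IB BD]] := pencil3 gI.1 gD.1 (rV a) (rV u) nau (@subIsetl _ _ _) (@subIsetr _ _ _) AD uD.
have gB := visible_sup gI rB IB; have [b eb] := d_onto nV gB.
have [x [ax ux] nHx] := gI.2; have Bx := IB _ (conj ax ux).
have npab : d a `&` H <> d b `&` H.
  by rewrite eb => h; apply: nBa; apply/esym/(trace_eq (g a) gB h ax Bx nHx).
have npbu : d b `&` H <> d u `&` H.
  by rewrite eb => h; apply: nBu; exact: (trace_eq gB (g u) h Bx ux nHx).
have bD : d b `<=` D by rewrite eb.
exists a, b; split; first exact: adjD.
- by split; apply: adjD.
- by split; apply: adjD => //; rewrite -e.
Qed.

End GraphSpecs.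
(** * The graphs on the k-dimensional subspaces *)
Section Vertices.
Implicit Types (X Y Z : set Q).
Local Notation tr := (@trace Q H).

Lemma visible_Posz k X : StrongSub (Posz k) X /\ ~ X `<=` H <-> visible k.+1 X.
Proof.
have e : Posz k = (Posz k.+1 - 1)%R by lia.
rewrite e; split=> [[/StrongSub_rk rX /nonsubset[x [Xx nHx]]]|gX]; first by split=> //; exists x.
by split; [exact/StrongSub_rk/gX.1|exact: visible_notH gX].
Qed.

Lemma SubU_visible k (A : set (affine_polar H)) :
  SubU (Posz k) A <-> exists2 X, visible k.+1 X & A = tr X.
Proof.
split=> [[[]//|[X [sX nX eA]]]|[X /visible_Posz[sX nX] eA]].
- by exists X => //; apply/visible_Posz.
- by right; exists X.
Qed.

Lemma SubU_m1 (A : set (affine_polar H)) : SubU (-1)%R A <-> A = set0.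
Proof.
split=> [[[]//|[X [[sX /(has_dim_rk _ sX)[n e rX]] nX _]]]|->]; last by left.
have n0 : n = 0%N by lia.
by case: nX; move: rX; rewrite n0 => /rk0_eq->.
Qed.

Lemma traceS n X Y : visible n X -> subspace Y -> tr X `<=` tr Y -> X `<=` Y.
Proof.
move=> gX SY h; apply: (visible_sub gX SY) => x Xx nHx.
exact: (h (exist _ x nHx) Xx).
Qed.

(** The strong subspace of the polar space that a subspace of the affine
    polar space comes from. *)
Definition span_vertices (A : set (affine_polar H)) : set Q := span [set proj1_sig u | u in A].

Lemma span_vertices_trace n X : visible n X -> span_vertices (tr X) = X.
Proof.
move=> gX; apply/seteqP; split; first by apply: span_min => [|x [u Xu <-]//]; exact: rk_subspace gX.1.
apply: (visible_sub gX); first exact: span_subspace.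
by move=> x Xx nHx; apply: sub_span; exists (exist _ x nHx).
Qed.

Lemma adj_meet_visible k n X Y : visible n X -> visible n Y ->
  adj_meet (Posz k.+1) (tr X) (tr Y) <-> visible k.+1 (X `&` Y).
Proof.
move=> gX gY; rewrite /adj_meet (_ : (Posz k.+1 - 1)%R = Posz k); last by lia.
rewrite SubU_visible; split=> [[Z gZ e]|gI]; last by exists (X `&` Y).
have ZX : Z `<=` X by apply: (traceS gZ (rk_subspace gX.1)); rewrite -e => u [].
have ZY : Z `<=` Y by apply: (traceS gZ (rk_subspace gY.1)); rewrite -e => u [].
have SI := subspaceI (rk_subspace gX.1) (rk_subspace gY.1).
have [p [_ rp _]] := rk_sub gX.1 SI (@subIsetl _ X Y).
have ZI : Z `<=` X `&` Y by move=> z Zz; split; [exact: ZX|exact: ZY].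
have gI := visible_sup gZ rp ZI.
suff <- : Z = X `&` Y by [].
apply/seteqP; split=> //; apply: (traceS gI (rk_subspace gZ.1)).
by rewrite -e.
Qed.

(** Distinct points are disjoint, so that [adj_both 0] and [adj_join 0] coincide
    on points. *)
Lemma adj_meet0_visible X Y : visible 1 X -> visible 1 Y -> X <> Y -> adj_meet (Posz 0) (tr X) (tr Y).
Proof.
move=> gX gY ne; apply/SubU_m1/seteqP; split=> // u [Xu Yu].
have [x eX] := rk1_ex gX.1; have [y eY] := rk1_ex gY.1.
case: ne; rewrite eX eY; move: Xu Yu; rewrite eX eY /trace /= => -> ->.
by [].
Qed.

(** [joinU] of two traces is the trace of the span, so that it is a trace of a strong
    subspace Z of one rank more exactly if both subspaces are distinct
    hyperplanes of Z. *)
Lemma adj_join_visible k X Y : visible k.+1 X -> visible k.+1 Y ->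
  adj_join (Posz k) (tr X) (tr Y) <->
    X <> Y /\ exists Z, [/\ visible k.+2 Z, X `<=` Z & Y `<=` Z].
Proof.
move=> gX gY; rewrite /adj_join (_ : (Posz k + 1)%R = Posz k.+1); last by lia.
rewrite SubU_visible; split=> [[Z gZ e]|[ne [Z [gZ XZ YZ]]]].
  have sub W : W = X \/ W = Y -> W `<=` Z.
    move=> hW; have gW : visible k.+1 W by case: hW => ->.
    apply: (traceS gW (rk_subspace gZ.1)) => u Wu.
    have : joinU (tr X) (tr Y) u by move=> S _; apply; case: hW Wu => ->; [left|right].
    by rewrite e.
  split; last by exists Z; split=> //; apply: sub; [left|right].
  move=> eXY; have : Z `<=` X.
    apply: (traceS gZ (rk_subspace gX.1)); rewrite -e => u; apply.
      by exists X => //; exact: rk_subspace gX.1.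
    by rewrite -eXY => v [].
  by move/(rk_leq gZ.1 gX.1); rewrite ltnn.
exists Z => //; apply/seteqP; split=> u.
  apply; first by exists Z => //; exact: rk_subspace gZ.1.
  by move=> v [/XZ|/YZ].
move=> Zu S [S0 SS ->] h.
have XS : X `<=` S0 by apply: (traceS gX SS) => v Xv; apply: h; left.
have YS : Y `<=` S0 by apply: (traceS gY SS) => v Yv; apply: h; right.
have /nonsubset[y [Yy nXy]] : ~ Y `<=` X by move=> /(rk_eq gY.1 gX.1)/esym.
have eZ := rk_cover gX.1 gZ.1 XZ (YZ _ Yy) nXy.
have : Z `<=` S0 by rewrite eZ; apply: join1_min => //; exact: YS.
by apply.
Qed.

Section Graph.
Variables (k : nat) (r : set (affine_polar H) -> set (affine_polar H) -> Prop).
Local Notation V := (@SubU_graph Q H (Posz k) r).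

Definition vertex_dec (v : V) : set Q := span_vertices (proj1_sig v).

Lemma vertexE (v : V) : visible k.+1 (vertex_dec v) /\ proj1_sig v = tr (vertex_dec v).
Proof.
have [X gX e] := (SubU_visible k (proj1_sig v)).1 (proj2_sig v).
by rewrite /vertex_dec e (span_vertices_trace gX).
Qed.

Lemma vertex_names : names (fun _ : V => True) (visible k.+1) vertex_dec.
Proof.
split=> [v _|v w _ _ e|X gX]; first by case: (vertexE v).
- have : proj1_sig v = proj1_sig w by rewrite (vertexE v).2 (vertexE w).2 e.
  case: v {e} => A hA; case: w => B hB /= eAB.
  by move: hA; rewrite eAB => hA; rewrite (Prop_irrelevance hA hB).
- have hX : SubU (Posz k) (tr X) by apply/SubU_visible; exists X.
  by exists (exist _ _ hX : V) => //; exact: span_vertices_trace gX.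
Qed.

End Graph.

End Vertices.

End PolarSpace.

(** * Interpretations of incidence structures in graphs *)
(** One choice of formulas codes the visible subspaces of ranks n and n + 1 and their
    incidence, for all polar spaces of index m and all hyperplanes. *)
Definition interpretable (Gr : forall Q : point_line, set Q -> graph) (m n : nat) : Prop :=
  exists (s t : ty) (PX : forall M : graph, obj M s -> Prop) (PY : forall M : graph, obj M t -> Prop)
         (In : forall M : graph, obj M s -> obj M t -> Prop),
  [/\ definable1 PX, definable1 PY, definable2 In &
    forall (Q : point_line) (H : set Q), polar_space_of_index Q m -> hyperplane H ->
    exists (dX : obj (Gr Q H) s -> set Q) (dY : obj (Gr Q H) t -> set Q),
      [/\ names (@PX (Gr Q H)) (visible H n) dX, names (@PY (Gr Q H)) (visible H n.+1) dY &
        forall c a, @PX (Gr Q H) c -> @PY (Gr Q H) a -> (@In (Gr Q H) c a <-> dX c `<=` dY a)]].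

(** The codes of rank n + 1 become sets of codes of rank n + 2, and the codes of rank
    n + 2 are kept. *)
Lemma interpretable_step Gr m n : (n.+1 < m)%N -> interpretable Gr m n.+2 -> interpretable Gr m n.+1.
Proof.
move=> lnm [s [t [PX [PY [In [defX defY defI hyp]]]]]].
exists (Pow s), s, (fun (M : graph) (f : obj M (Pow s)) => star_code (@PX M) (@PY M) (@In M) f), PX,
  (fun (M : graph) (f : obj M (Pow s)) (c : obj M s) => mem_code f c).
split=> //; first exact: def_star_code. exact: def_mem_code.
move=> Q H polQ hypH; have [dX [dY [nX nY InE]]] := hyp Q H polQ hypH.
have [nS inS] := star_names polQ hypH lnm nX nY InE.
by exists (star_dec dX), dX.
Qed.

Lemma interpretable_descend Gr m n : (0 < n <= m)%N -> interpretable Gr m n -> interpretable Gr m 1.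
Proof.
elim: n => [//|[//|n] IH] /andP[_ lnm] int.
by apply: IH; [lia|apply: interpretable_step => //; lia].
Qed.

(** Visible subspaces of rank 1 are the affine points, and those of rank 2 are the
    lines not contained in H. *)
Lemma interpretable_recovers Gr m : interpretable Gr m 1 ->
  exists D : description, forall (Q : point_line) (H : set Q),
    polar_space_of_index Q m -> hyperplane H -> recovers D (Gr Q H) (affine_polar H).
Proof.
move=> [s [t [PX [PY [In [defX defY defI hyp]]]]]].
have [fp hfp] := defX [:: s] (VZ _ _).
have [fl hfl] : dfn (G := [:: Pow s]) (fun M e => exists a : obj M t, PY M a /\
    forall c : obj M s, mem_code (e.1 : obj M (Pow s)) c <-> (PX M c /\ In M c a)).
  by have h := @def_mem_code s; dfn_solve.
exists (@Description s fp fl) => Q H polQ hypH.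
have [dX [dY [[gX iX sX] [gY iY sY] InE]]] := hyp Q H polQ hypH.
have g1 (p : affine_point H) : visible H 1 [set proj1_sig p].
  by split; [exact: rk1|exists (proj1_sig p) => //; exact: (proj2_sig p)].
pose iota (p : affine_point H) := s2val (cid2 (sX _ (g1 p))).
have iotaP p : PX (Gr Q H) (iota p) by exact: (s2valP (cid2 (sX _ (g1 p)))).
have iotaE p : dX (iota p) = [set proj1_sig p] by exact: (s2valP' (cid2 (sX _ (g1 p)))).
have iota_inj : injective iota.
  move=> p q e; have : [set proj1_sig p] (proj1_sig q) by rewrite -iotaE e iotaE.
  case: p q {e} => [x nx] [y ny] /= e; move: ny; rewrite e => ny.
  by rewrite (Prop_irrelevance nx ny).
have iota_sur c : PX (Gr Q H) c -> exists p, iota p = c.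
  move=> Pc; have [rc [x cx nHx]] := gX c Pc; have [y ey] := rk1_ex polQ rc.
  have xy : x = y by move: cx; rewrite ey.
  exists (exist _ x nHx); apply: iX => //; rewrite iotaE ey /=.
  by rewrite xy.
exists iota; split=> // [c|C].
  by rewrite /= (hfp (Gr Q H) (c, tt)) /=; split=> [/iota_sur|[p <-]].
rewrite /= (hfl (Gr Q H) (C, tt)) /= /mem_code.
split=> [[a [Pa aE]]|[l [L [LL nLH ->]] eC]].
  have [ra [x ax nHx]] := gY a Pa.
  exists (@trace Q H (dY a)).
    by exists (dY a); split=> //; [exact/(rk2_line polQ)|move=> s'; apply/nHx/s'].
  apply/seteqP; split=> c.
    move=> /aE[Pc /(InE _ _ Pc Pa) ca]; have [p ep] := iota_sur c Pc.
    by exists p => //; rewrite /trace /=; apply: ca; rewrite -ep iotaE.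
  move=> [p ap <-]; apply/aE; split=> //; apply/InE => //.
  by rewrite iotaE => y ->.
have gL : visible H 2 L.
  by split; [exact/(rk2_line polQ)|have [x [Lx nHx]] := nonsubset nLH; exists x].
have [a Pa ea] := sY L gL; exists a; split=> // c; rewrite eC; split.
  by move=> [p Lp <-]; split=> //; apply/InE => //; rewrite iotaE ea => y ->.
move=> [Pc /(InE _ _ Pc Pa)]; have [p <-] := iota_sur c Pc.
by rewrite iotaE ea => h; exists p => //; apply: h.
Qed.

Section Start.
Variable m : nat.
Implicit Types (Gr : forall Q : point_line, set Q -> graph).

Definition vertices_named Gr (n : nat)
    (dV : forall (Q : point_line) (H : set Q), Gr Q H -> set Q) :=
  forall (Q : point_line) (H : set Q), polar_space_of_index Q m -> hyperplane H ->
    names (fun _ : Gr Q H => True) (visible H n) (@dV Q H).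

Lemma interpretable_stars Gr n (code : forall M : graph, set M -> Prop) dV :
    @vertices_named Gr n.+1 dV ->
    definable1 (fun M (c : obj M (Pow Elt)) => code M c) ->
    (forall (Q : point_line) (H : set Q), polar_space_of_index Q m -> hyperplane H ->
      names (code (Gr Q H)) (visible H n) (star_dec (@dV Q H)) /\
      forall c w, code (Gr Q H) c -> True -> (mem_code c w <-> star_dec (@dV Q H) c `<=` dV Q H w)) ->
  interpretable Gr m n.
Proof.
move=> nV dC h; exists (Pow Elt), Elt, (fun (M : graph) (c : obj M (Pow Elt)) => code M c),
  (fun (M : graph) (w : obj M Elt) => True),
  (fun (M : graph) (c : obj M (Pow Elt)) (w : obj M Elt) => mem_code c w).
split=> //; [exact: def_true|exact: def_mem_code|].
move=> Q H polQ hypH; have [nC inC] := h Q H polQ hypH.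
by exists (star_dec (@dV Q H)), (@dV Q H); split=> //; exact: nV.
Qed.

Lemma interpretable_tops Gr n (code : forall M : graph, set M -> Prop) dV :
    @vertices_named Gr n dV ->
    definable1 (fun M (c : obj M (Pow Elt)) => code M c) ->
    (forall (Q : point_line) (H : set Q), polar_space_of_index Q m -> hyperplane H ->
      names (code (Gr Q H)) (visible H n.+1) (top_dec (@dV Q H)) /\
      forall w c, True -> code (Gr Q H) c -> (mem_code c w <-> dV Q H w `<=` top_dec (@dV Q H) c)) ->
  interpretable Gr m n.
Proof.
move=> nV dC h; exists Elt, (Pow Elt), (fun (M : graph) (w : obj M Elt) => True),
  (fun (M : graph) (c : obj M (Pow Elt)) => code M c),
  (fun (M : graph) (w : obj M Elt) (c : obj M (Pow Elt)) => mem_code c w).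
split=> //; [exact: def_true|exact: def_mem_code_rev|].
move=> Q H polQ hypH; have [nC inC] := h Q H polQ hypH.
by exists (@dV Q H), (top_dec (@dV Q H)); split=> //; exact: nV.
Qed.

Local Notation Gm k := (fun (Q : point_line) (H : set Q) => @SubU_graph Q H (Posz k) (adj_meet (Posz k))).
Local Notation Gj k := (fun (Q : point_line) (H : set Q) => @SubU_graph Q H (Posz k) (adj_join (Posz k))).
Local Notation Gb k := (fun (Q : point_line) (H : set Q) => @SubU_graph Q H (Posz k) (adj_both (Posz k))).

Section Spec.
Variables (Q : point_line) (H : set Q).
Hypotheses (polQ : polar_space_of_index Q m) (hypH : hyperplane H).

Lemma meet_adjE k (u v : Gm k.+1 Q H) : adj u v <-> visible H k.+1 (vertex_dec u `&` vertex_dec v).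
Proof.
have [gu eu] := vertexE polQ hypH u; have [gv ev] := vertexE polQ hypH v.
by rewrite /adj /= eu ev; exact: (adj_meet_visible polQ hypH k gu gv).
Qed.

Lemma join_adjE k (u v : Gj k Q H) : adj u v <-> spans H (@vertex_dec Q H k _) k.+2 u v.
Proof.
have [gu eu] := vertexE polQ hypH u; have [gv ev] := vertexE polQ hypH v.
by rewrite /adj /= eu ev; exact: (adj_join_visible polQ hypH gu gv).
Qed.

Lemma both_adjE k (u v : Gb k.+1 Q H) :
  adj u v <-> spans H (@vertex_dec Q H k.+1 _) k.+3 u v /\ visible H k.+1 (vertex_dec u `&` vertex_dec v).
Proof.
have [gu eu] := vertexE polQ hypH u; have [gv ev] := vertexE polQ hypH v.
rewrite /adj /= eu ev /adj_both (adj_join_visible polQ hypH gu gv).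
by rewrite (adj_meet_visible polQ hypH k gu gv); split=> -[].
Qed.

Lemma both_adjE0 (u v : Gb 0%N Q H) : adj u v <-> spans H (@vertex_dec Q H 0%N _) 2 u v.
Proof.
have [gu eu] := vertexE polQ hypH u; have [gv ev] := vertexE polQ hypH v.
rewrite /adj /= eu ev /adj_both (adj_join_visible polQ hypH gu gv).
split=> [[]//|h]; split=> //.
by case: h => ne _; exact: (adj_meet0_visible polQ gu gv ne).
Qed.

End Spec.

Lemma vertices_namedP k (r : forall (Q : point_line) (H : set Q), set (affine_polar H) -> set (affine_polar H) -> Prop) :
  @vertices_named (fun Q H => @SubU_graph Q H (Posz k) (r Q H)) k.+1
    (fun Q H => @vertex_dec Q H k (r Q H)).
Proof. by move=> Q H polQ hypH; exact: (vertex_names polQ hypH). Qed.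

Lemma interpretable_meet k : (k < m)%N -> interpretable (Gm k.+1) m 1.
Proof.
move=> lkm; apply: (@interpretable_descend _ _ k.+1) => //.
apply: (interpretable_stars (code := fun M => pair_star (@adj M)) (@vertices_namedP _ (fun Q H => adj_meet (Posz k.+1)))).
  exact: (def_pair_star def_adj).
move=> Q H polQ hypH; apply: (pair_star_names polQ (vertex_names polQ hypH _ _)) => //.
by move=> u v; exact: meet_adjE.
Qed.

Lemma interpretable_join k : (k < m)%N -> interpretable (Gj k) m 1.
Proof.
have vn := @vertices_namedP k (fun Q H => adj_join (Posz k)).
case: k vn => [|k] vn lkm.
  apply: (interpretable_tops (code := fun M => pencil_code (@adj M)) vn); first exact: (def_pencil_code def_adj).
  move=> Q H polQ hypH; apply: (pencil_code_names polQ hypH (vertex_names polQ hypH _ _)).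
  by move=> u v; exact: join_adjE.
have [em|nm] := EM (m = k.+2).
  apply: (@interpretable_descend _ _ k.+2); first by rewrite em /=.
  apply: (interpretable_tops (code := fun M => pair_top (@adj M)) vn); first exact: (def_pair_top def_adj).
  move=> Q H polQ hypH; apply: (pair_top_names polQ hypH em (vertex_names polQ hypH _ _)).
  by move=> u v; exact: join_adjE.
have l3 : (k.+3 <= m)%N by lia.
apply: (@interpretable_descend _ _ k.+1); first by lia.
apply: (interpretable_stars (code := fun M => clique_star (meeting (@adj M))) vn).
  exact: (def_clique_star (def_meeting def_adj)).
move=> Q H polQ hypH; apply: (clique_star_names polQ hypH (vertex_names polQ hypH _ _) l3) => u v.
apply: (meetingE polQ hypH (vertex_names polQ hypH _ _) l3).
by move=> u' v'; exact: join_adjE.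
Qed.

Lemma interpretable_both k : (k < m)%N -> interpretable (Gb k) m 1.
Proof.
have vn := @vertices_namedP k (fun Q H => adj_both (Posz k)).
case: k vn => [|k] vn lkm.
  apply: (interpretable_tops (code := fun M => pencil_code (@adj M)) vn); first exact: (def_pencil_code def_adj).
  move=> Q H polQ hypH; apply: (pencil_code_names polQ hypH (vertex_names polQ hypH _ _)).
  by move=> u v; exact: both_adjE0.
have [em|nm] := EM (m = k.+2).
  apply: (@interpretable_descend _ _ k.+2); first by rewrite em /=.
  apply: (interpretable_tops (code := fun M => pair_top (twice_adj (@adj M))) vn).
    exact: (def_pair_top (def_twice_adj def_adj)).
  move=> Q H polQ hypH; apply: (pair_top_names polQ hypH em (vertex_names polQ hypH _ _)) => u v.
  apply: (twice_adjE polQ hypH em (vertex_names polQ hypH _ _)).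
  by move=> u' v'; exact: both_adjE.
have l3 : (k.+3 <= m)%N by lia.
apply: (@interpretable_descend _ _ k.+1); first by lia.
apply: (interpretable_stars (code := fun M => clique_star (@adj M)) vn).
  exact: (def_clique_star def_adj).
move=> Q H polQ hypH; apply: (clique_star_names polQ hypH (vertex_names polQ hypH _ _) l3) => u v.
exact: both_adjE.
Qed.

End Start.

Theorem theorem1p5 (m k : nat) :
  ((0 < k <= m)%N ->
     exists D : description, forall (Q : point_line) (H : set Q),
       polar_space_of_index Q m -> hyperplane H ->
       recovers D (@SubU_graph Q H (Posz k) (adj_meet (Posz k)))
                  (affine_polar H)) /\
  ((k < m)%N ->
     (exists D : description, forall (Q : point_line) (H : set Q),
       polar_space_of_index Q m -> hyperplane H ->
       recovers D (@SubU_graph Q H (Posz k) (adj_join (Posz k)))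
                  (affine_polar H)) /\
     (exists D : description, forall (Q : point_line) (H : set Q),
       polar_space_of_index Q m -> hyperplane H ->
       recovers D (@SubU_graph Q H (Posz k) (adj_both (Posz k)))
                  (affine_polar H))).
Proof.
split=> [|lkm].
  by case: k => [//|k] /= lkm; exact: interpretable_recovers (interpretable_meet lkm).
by split; [exact: interpretable_recovers (interpretable_join lkm)|exact: interpretable_recovers (interpretable_both lkm)].
Qed.
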